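(* Let $H$ be a real separable infinite-dimensional Hilbert space, $\Psi\in\mathcal L(H,H)$ with $\|\Psi\|_{\mathcal L(H,H)}<1$, and let $\{X_n\}_{n\ge1}$ be an ARH(1) process, i.e. the stationary process $X_n=\sum_{j\ge0}\Psi^j(\varepsilon_{n-j})$ satisfying $X_{n+1}=\Psi(X_n)+\varepsilon_{n+1}$. Put $Y_k=X_{k+1}$, and let $H=\overline{\mathrm{Im}(C)}$ with $C=E[X_1\otimes X_1]$. (1) If $\{\varepsilon_i\}$ is $H$-white noise and Assumption (A) (stated in the context) holds for the linear model $Y_k=\Psi(X_k)+\varepsilon_{k+1}$, then for every sequence $m_n\to\infty$ with $m_n=o(\sqrt n)$ and $K_n=\max\{j\ge1:\hat\lambda_1/\hat\lambda_j\le m_n\}$, the estimator $\hat\Psi_{K_n}(x)=\sum_{j=1}^{K_n}\hat\lambda_j^{-1}\langle\hat v_j,x\rangle_H\hat\Delta(\hat v_j)$ satisfies $\|\Psi(X_n)-\hat\Psi_{K_n}(X_n)\|_H\to0$ in probability as $n\to\infty$. (2) In particular, if $\{\varepsilon_i\}$ is i.i.d. with zero mean in $L^4_H$, then Assumption (A) holds for this linear model.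
   Context: Notation: $\mathcal L(H,H)$ is the space of bounded linear operators on $H$. $(x\otimes y)(v)=\langle x,v\rangle y$. $X\in L^p_H$ means $\nu_{p,H}(X):=(E\|X\|_H^p)^{1/p}<\infty$. $X\perp Y$ means $E[X\otimes Y]=0$. $H$-white noise: a sequence of pairwise orthogonal elements of $L^2_H$ with constant mean and constant covariance operator. $L^p$–$m$–approximability: a sequence $\{X_n\}$ in $L^p_H$ is $L^p$–$m$–approximable if $X_n=f(\delta_n,\delta_{n-1},\dots)$ with $\delta_i$ ($i\in\mathbb Z$) i.i.d. in a measurable space $S$ and $f:S^\infty\to H$ measurable, and, with $\{\delta_i'\}$ an independent copy of $\{\delta_i\}$ and $X_n^{(m)}=f(\delta_n,\dots,\delta_{n-m+1},\delta'_{n-m},\delta'_{n-m-1},\dots)$, one has $\sum_{m\ge1}\nu_{p,H}(X_m-X_m^{(m)})<\infty$. Assumption (A) for the model $Y_k=\Psi(X_k)+e_k$, $k\ge1$ (here $e_k=\varepsilon_{k+1}$): $\Psi$ is bounded linear; $\{X_k\}$ and $\{e_k\}$ are zero mean and $L^4$–$m$–approximable, with representations $X_k=f(\delta_k,\delta_{k-1},\dots)$ and $e_k=g(\delta_k,\delta_{k-1},\dots)$ in terms of the same innovations $\{\delta_i\}$; $\{e_k\}$ is $H$-white noise; $X_k\perp e_k$ for every $k\ge1$. From $(X_1,Y_1),\dots,(X_n,Y_n)$ put $\hat C=\frac1n\sum_{k=1}^nX_k\otimes X_k$ and $\hat\Delta=\frac1n\sum_{k=1}^nX_k\otimes Y_k$.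 $\hat\lambda_1\ge\hat\lambda_2\ge\cdots\ge0$ are the eigenvalues of $\hat C$ (zero beyond its rank) and $\hat v_j$ corresponding orthonormal eigenvectors. Conventions: $a/0=+\infty$ for every $a\ge0$, $\max\emptyset=0$, empty sums are $0$. *)

(* Defs.v *)
From HB Require Import structures.
From mathcomp Require Import all_boot all_order all_algebra.
From mathcomp Require Import all_classical all_reals all_analysis.

Set Implicit Arguments.
Unset Strict Implicit.
Unset Printing Implicit Defensive.

Import Order.TTheory GRing.Theory Num.Theory.
Import numFieldNormedType.Exports.

Local Open Scope classical_set_scope.
Local Open Scope ring_scope.

HB.mixin Record isHilbert (R : realType) H of CompleteNormedModule R H := {
  inner : H -> H -> R ;
  innerC : forall x y, inner x y = inner y x ;
  innerDl : forall x y z, inner (x + y) z = inner x z + inner y z ;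
  innerZl : forall (a : R) x y, inner (a *: x) y = a * inner x y ;
  inner_norm : forall x, inner x x = `|x| ^+ 2
}.

#[short(type="hilbertType")]
HB.structure Definition Hilbert (R : realType) :=
  {H of isHilbert R H & CompleteNormedModule R H}.

Section hilbert_space.
Context {R : realType} (H : hilbertType R).
Implicit Types (T : H -> H) (x y u : H).

Definition separable := exists2 D : set H, countable D & dense D.

Definition infinite_dimensional := ~ exists s : seq H,
  forall x, exists c : nat -> R, x = \sum_(i < size s) c i *: s`_i.

Definition bounded_operator T := exists M : R, forall x, `|T x| <= M * `|x|.

Definition opnorm T : R := sup [set `|T x| | x in [set x | `|x| <= 1]].

Definition tensor x y : H -> H := fun u => inner x u *: y.

(* Indices start at 1 ([lam 0] and [v 0] are irrelevant). The last clause says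
   that the [v j] with [lam j = mu] exhaust the eigenspace of each nonzero
   eigenvalue [mu], i.e. that eigenvalues are listed with full multiplicity;
   for [T] of finite rank, [lam j] is then zero for [j] beyond the rank. *)
Definition eigen_system T (lam : nat -> R) (v : nat -> H) :=
  [/\ forall i j, (1 <= i)%N -> (1 <= j)%N -> inner (v i) (v j) = (i == j)%:R,
      forall j, (1 <= j)%N -> T (v j) = lam j *: v j,
      forall j, (1 <= j)%N -> 0 <= lam j.+1 <= lam j
    & forall (mu : R) x, mu != 0 -> T x = mu *: x ->
        (forall j, (1 <= j)%N -> lam j = mu -> inner (v j) x = 0) -> x = 0].

Definition borel := g_sigma_algebraType (@open H).

End hilbert_space.

Arguments borel {R} H.

(* The space of sequences [s_0, s_1, ...] with the product sigma-algebra. *)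
Definition cylinder d (S : measurableType d) : set (set (nat -> S)) :=
  [set A | exists i (B : set S), measurable B /\ A = [set s | B (s i)]].

Definition seqspace d (S : measurableType d) :=
  g_sigma_algebraType (@cylinder d S).

Section random_sequences.
Context d (Omega : measurableType d) (R : realType) (P : probability Omega R).

Definition identically_distributed d' (S : measurableType d') (I : Type)
    (xi : I -> Omega -> S) :=
  forall i j (B : set S), measurable B -> P (xi i @^-1` B) = P (xi j @^-1` B).

Definition mutually_independent d' (S : measurableType d') (I : eqType)
    (xi : I -> Omega -> S) :=
  forall (s : seq I) (B : I -> set S), uniq s -> (forall i, measurable (B i)) ->
    P (\big[setI/setT]_(i <- s) (xi i @^-1` B i)) =
    (\prod_(i <- s) P (xi i @^-1` B i))%E.

Definition iid d' (S : measurableType d') (I : eqType) (xi : I -> Omega -> S) :=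
  [/\ forall i, measurable_fun setT (xi i),
      identically_distributed xi & mutually_independent xi].

Definition cvg0_in_probability (Z : nat -> Omega -> R) :=
  forall eta : R, 0 < eta -> P [set w | eta < `|Z n w|] @[n --> \oo] --> 0%E.

End random_sequences.

Section hilbert_valued.
Context {R : realType} (H : hilbertType R).

Definition random_element d (Omega : measurableType d) (Z : Omega -> H) :=
  measurable_fun setT (Z : Omega -> borel H).

Definition nu d (Omega : measurableType d) (mu : {measure set Omega -> \bar R})
    (p : R) (Z : Omega -> H) : \bar R :=
  Lnorm mu p%:E (fun w => `|Z w|%:E).

Context d (Omega : measurableType d) (P : probability Omega R).
Implicit Types (Z : Omega -> H) (X Y e : nat -> Omega -> H).

Definition LpH (p : R) Z := random_element Z /\ (nu P p Z < +oo)%E.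

(* [a = E[Z]], as the vector representing [u |-> E<Z, u>]; for [E|Z| < oo] this
   is the Bochner expectation. The equation with a finite right-hand side
   forces [<Z, u>] to be integrable. *)
Definition is_mean Z (a : H) :=
  forall u : H, ('E_P[fun w => inner (Z w) u] = (inner a u)%:E)%E.

(* [T = E[Z1 (x) Z2]], the expectation being taken after application to each
   vector; for [Z1], [Z2] in [L^2] this is the Bochner expectation. *)
Definition is_mean_tensor Z1 Z2 (T : H -> H) :=
  forall u : H, is_mean (fun w => tensor (Z1 w) (Z2 w) u) (T u).

Definition orthogonal Z1 Z2 := is_mean_tensor Z1 Z2 (fun=> 0).

Definition white_noise (I : Type) (D : set I) (e : I -> Omega -> H) :=
  [/\ forall i, D i -> LpH 2 (e i),
      forall i j, D i -> D j -> i <> j -> orthogonal (e i) (e j)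
    & exists (a : H) (Q : H -> H), forall i, D i ->
        is_mean (e i) a /\
        is_mean_tensor (fun w => e i w - a) (fun w => e i w - a) Q].

(* Processes [X : nat -> Omega -> H] are indexed from 1; [X 0] is irrelevant. *)
Definition stationary X :=
  forall (N h : nat) (B : nat -> set (borel H)), (forall k, measurable (B k)) ->
    P (\big[setI/setT]_(1 <= k < N.+1) (X (k + h)%N @^-1` B k)) =
    P (\big[setI/setT]_(1 <= k < N.+1) (X k @^-1` B k)).

Definition ARH1 (Psi : {linear H -> H}) (eps : int -> Omega -> H) X :=
  [/\ forall i, random_element (eps i),
      forall n, (1 <= n)%N -> random_element (X n),
      stationary X,
      forall n, (1 <= n)%N ->
        {ae P, forall w, X n.+1 w = Psi (X n w) + eps n.+1%:Z w}
    & forall n, (1 <= n)%N -> {ae P, forall w,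
        series (fun j => iter j Psi (eps (n%:Z - j%:Z) w)) @ \oo --> X n w}].

Definition past d' (S : measurableType d') (delta : int -> Omega -> S) (n : nat)
    (w : Omega) : seqspace S :=
  fun i => delta (n%:Z - i%:Z) w.

(* The independent copy of [delta] is realized on [Omega * Omega] with
   [P \x P]: the sequence itself lives on the first factor and
   [delta' i w = delta i w.2]. This does not require [Omega] to carry an
   independent copy, and only the joint law of [delta] and [delta'] matters. *)
Definition coupled_past d' (S : measurableType d') (delta : int -> Omega -> S)
    (n m : nat) (w : Omega * Omega) : seqspace S :=
  fun i => delta (n%:Z - i%:Z) (if (i < m)%N then w.1 else w.2).

Definition Lp_m_approximable (p : R) d' (S : measurableType d')
    (delta : int -> Omega -> S) (f : seqspace S -> H) X :=
  [/\ forall n, (1 <= n)%N -> LpH p (X n),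
      iid P delta,
      measurable_fun setT (f : seqspace S -> borel H),
      forall n, (1 <= n)%N -> {ae P, forall w, X n w = f (past delta n w)}
    & (\sum_(1 <= m <oo)
        nu (P \x P) p (fun w => X m w.1 - f (coupled_past delta m m w))%R
         < +oo)%E].

Definition assumptionA (Psi : {linear H -> H}) X Y e :=
  [/\ bounded_operator Psi,
      forall k, (1 <= k)%N -> {ae P, forall w, Y k w = Psi (X k w) + e k w},
      forall k, (1 <= k)%N -> is_mean (X k) 0 /\ is_mean (e k) 0,
      exists (d' : measure_display) (S : measurableType d')
             (delta : int -> Omega -> S) (f g : seqspace S -> H),
        Lp_m_approximable 4 delta f X /\ Lp_m_approximable 4 delta g e
    & white_noise [set k | (1 <= k)%N] e /\
      forall k, (1 <= k)%N -> orthogonal (X k) (e k)].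

End hilbert_valued.

Section estimator.
Context {R : realType} (H : hilbertType R) (Omega : Type).
Implicit Types X Y : nat -> Omega -> H.

Definition Delta_hat X Y (n : nat) (w : Omega) : H -> H :=
  fun u => n%:R^-1 *: \sum_(1 <= k < n.+1) tensor (X k w) (Y k w) u.

Definition C_hat X := Delta_hat X X.

(* [a / b] with [a / 0 = +oo], also for [a = 0]. *)
Definition ratio (a b : R) : \bar R :=
  if b == 0 then +oo%E else (a / b)%:E.

(* Maximum of a bounded set of naturals, 0 for the empty set. *)
Definition max_nat (A : set nat) : nat :=
  xget 0%N [set k | A k /\ forall j, A j -> (j <= k)%N].

Definition K_trunc (lam : nat -> R) (m : R) : nat :=
  max_nat [set j | (1 <= j)%N /\ (ratio (lam 1%N) (lam j) <= m%:E)%E].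

Definition Psi_hat X Y (n : nat) (w : Omega) (lam : nat -> R) (v : nat -> H)
    (K : nat) : H -> H :=
  fun x => \sum_(1 <= j < K.+1)
    ((lam j)^-1 * inner (v j) x) *: Delta_hat X Y n w (v j).

End estimator.

(* Main.v *)
Require Import Defs.
From HB Require Import structures.
From mathcomp Require Import all_boot all_order all_algebra.
From mathcomp Require Import all_classical all_reals all_analysis.
From mathcomp Require Import measurable_realfun zify ring lra.

Set Implicit Arguments.
Unset Strict Implicit.
Unset Printing Implicit Defensive.

Import Order.TTheory GRing.Theory Num.Theory.
Import numFieldNormedType.Exports.

Local Open Scope classical_set_scope.
Local Open Scope ring_scope.

(** Write [\hat\Delta = Psi \hat C + L] with [L = n^-1 \sum_k X_k (x) e_k]. If [P_K] is
    the projection onto the first [K] empirical eigenvectors, the prediction error at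
    [x] is [Psi (x - P_K x) - L A x], where [A = \sum_{j <= K} lam_j^-1 v_j (x) v_j] has
    norm at most [m_n / lam_1].
    - Each of [L] and [\hat C z - C z] has mean square [O(1/n)]: the square is a double
      sum of a degenerate kernel in [(X_k, e_k)] and [(X_l, e_l)]; replacing the later
      variable by its coupled version, which is independent of the earlier one, costs
      at most a multiple of the approximability coefficient at lag [|k - l|], and these
      are summable. As [lam_1] stays away from [0] and [m_n = o(sqrt n)], [L A X_n]
      tends to [0].
    - For the first term no rate is needed. By tightness and stationarity [X_n] is close
      to one of finitely many points, each close to some [C z] since [Im C] is dense, and
      [|(1 - P_K) C z| <= |C z - \hat C z| + lam_{K+1} |z|] with [lam_{K+1} <= lam_1 / m_n].

    For i.i.d. innovations, [X_n] is a linear filter of the past whose tail from lag [m]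
    on is of order [c ^ m] in [L^4], with [c = opnorm Psi < 1]. The remaining clauses of
    Assumption (A) follow from independence of distinct coordinates and, for the
    covariance operator, from Riesz representation. *)

(** * Hilbert space geometry *)

(** The eigenvalues and eigenvectors of [C_hat] enter as arbitrary functions of the sample point,
    without a measurable choice, while convergence in probability concerns the measure of an error
    event. The truncated sum is therefore identified as a function of the operator [C_hat],
    independent of the chosen eigenvectors, and shown to be measurable as such. [X_n] belongs to the
    sample from which the estimator is built, so it cannot be averaged out separately. The noise
    operator is bounded uniformly in its argument, through its Hilbert-Schmidt norm, whose square is
    a double sum of the required kind; the bias is controlled at finitely many deterministic points
    that do not depend on [n]. Both second-moment bounds involve products of four norms, which is
    where [L^4] enters. A Young inequality whose weight is matched to the coupling coefficient at
    each lag makes the coupling cost linear in that coefficient. As [C_hat] has finite rank, its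
    spectral theory reduces to maximising a quadratic form on a Euclidean sphere. *)

Section inner_product.
Context {R : realType} (H : hilbertType R).
Implicit Types (x y z u : H) (a : R).

Lemma innerDr x y z : inner x (y + z) = inner x y + inner x z.
Proof. by rewrite innerC innerDl !(innerC x). Qed.

Lemma innerZr a x y : inner x (a *: y) = a * inner x y.
Proof. by rewrite innerC innerZl innerC. Qed.

Lemma inner0l y : inner 0 y = 0.
Proof. by rewrite -[X in inner X](scale0r 0) innerZl mul0r. Qed.

Lemma inner0r y : inner y 0 = 0.
Proof. by rewrite innerC inner0l. Qed.

Lemma innerNl x y : inner (- x) y = - inner x y.
Proof. by rewrite -scaleN1r innerZl mulN1r. Qed.

Lemma innerNr x y : inner x (- y) = - inner x y.
Proof. by rewrite innerC innerNl innerC. Qed.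

Lemma innerBl x y z : inner (x - y) z = inner x z - inner y z.
Proof. by rewrite innerDl innerNl. Qed.

Lemma innerBr x y z : inner x (y - z) = inner x y - inner x z.
Proof. by rewrite innerDr innerNr. Qed.

Lemma inner_suml (I : Type) (r : seq I) (Q : pred I) (F : I -> H) y :
  inner (\sum_(i <- r | Q i) F i) y = \sum_(i <- r | Q i) inner (F i) y.
Proof.
elim/big_rec2: _ => [|i a b _ <-]; first by rewrite inner0l.
by rewrite innerDl.
Qed.

Lemma inner_sumr (I : Type) (r : seq I) (Q : pred I) (F : I -> H) y :
  inner y (\sum_(i <- r | Q i) F i) = \sum_(i <- r | Q i) inner y (F i).
Proof. by rewrite innerC inner_suml; apply: eq_bigr => i _; rewrite innerC. Qed.

Lemma sqr_normD x y : `|x + y| ^+ 2 = `|x| ^+ 2 + 2 * inner x y + `|y| ^+ 2.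
Proof.
rewrite -!inner_norm innerDl !innerDr (innerC y x) mulrDl mul1r.
by rewrite !addrA.
Qed.

Lemma sqr_normB x y : `|x - y| ^+ 2 = `|x| ^+ 2 - 2 * inner x y + `|y| ^+ 2.
Proof. by rewrite sqr_normD innerNr normrN mulrN. Qed.

Lemma inner_sqr_le x y : inner x y ^+ 2 <= `|x| ^+ 2 * `|y| ^+ 2.
Proof.
have [->|y0] := eqVneq y 0; first by rewrite inner0r expr0n/= mulr_ge0 ?sqr_ge0.
have y20 : 0 < `|y| ^+ 2 by rewrite exprn_gt0// normr_gt0.
have := sqr_ge0 `| `|y| ^+ 2 *: x - inner x y *: y|.
rewrite sqr_normB !normrZ !exprMn innerZl innerZr ger0_norm ?sqr_ge0//.
rewrite real_normK ?num_real// => h.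
rewrite -(ler_pM2l y20) -subr_ge0; apply: le_trans h _.
by rewrite le_eqVlt; apply/orP; left; apply/eqP; ring.
Qed.

Lemma inner_le x y : `|inner x y| <= `|x| * `|y|.
Proof.
rewrite -(@ler_pXn2r _ 2)// ?nnegrE ?mulr_ge0//.
by rewrite real_normK ?num_real// exprMn inner_sqr_le.
Qed.

Lemma cvg_inner (T : Type) (F : set_system T) (FF : Filter F) (f g : T -> H) x y :
  f t @[t --> F] --> x -> g t @[t --> F] --> y ->
  inner (f t) (g t) @[t --> F] --> inner x y.
Proof.
move=> fx gy.
have E t : inner (f t) (g t) =
    2^-1 * (`|f t + g t| ^+ 2 - `|f t| ^+ 2 - `|g t| ^+ 2).
  by rewrite sqr_normD; field.
have -> : inner x y = 2^-1 * (`|x + y| ^+ 2 - `|x| ^+ 2 - `|y| ^+ 2).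
  by rewrite sqr_normD; field.
under eq_cvg do rewrite E.
have sq (h : T -> H) z : h t @[t --> F] --> z ->
    `|h t| ^+ 2 @[t --> F] --> `|z| ^+ 2.
  by move=> hz; under eq_cvg do rewrite expr2; rewrite expr2; apply: cvgM;
    apply: cvg_norm.
apply: cvgM; first exact: cvg_cst.
by apply: cvgB; [apply: cvgB|]; apply: sq => //; exact: cvgD.
Qed.

End inner_product.

Lemma cauchy_seq_cvg (R : realType) (V : completeNormedModType R) (x : nat -> V) :
  (forall e : R, 0 < e -> exists N, forall n, (N <= n)%N -> `|x N - x n| < e) ->
  cvgn x.
Proof.
move=> xC; apply/cauchy_cvgP/cauchyP => e /xC [N hN]; exists (x N).
by exists N => // n /hN; rewrite -ball_normE.
Qed.

Lemma cvg_sum_seq (R : realType) (V : normedModType R) (T : Type)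
    (F : set_system T) {FF : Filter F} (I : Type) (r : seq I) (Q : pred I)
    (f : I -> T -> V) (a : I -> V) :
  (forall i, Q i -> f i t @[t --> F] --> a i) ->
  (\sum_(i <- r | Q i) f i t) @[t --> F] --> \sum_(i <- r | Q i) a i.
Proof.
move=> fa; elim: r => [|i r IHr].
  rewrite big_nil; under eq_cvg do rewrite big_nil; exact: cvg_cst.
rewrite big_cons; under eq_cvg do rewrite big_cons.
by case: ifP => // Qi; apply: cvgD => //; exact: fa.
Qed.

(** The first-order condition at a minimum. With [A] equal to |a| + 1, the single test point
    [- b / A] gives a value at most [- b ^+ 2 / A], with no case split on [a]. It serves for the
    minimiser in [riesz] and for the maximiser in [frame_top_eigenvector]. *)
Lemma quad_nonneg_lin0 (R : realFieldType) (a b : R) :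
  (forall t, 0 <= 2 * t * b + t ^+ 2 * a) -> b = 0.
Proof.
pose A := `|a| + 1; have A0 : 0 < A by rewrite ltr_wpDl.
move=> /(_ (- b / A)) h; apply/eqP; rewrite -sqrf_eq0 eq_le sqr_ge0 andbT.
have {}h : 0 <= - (2 * b ^+ 2) * A + b ^+ 2 * a.
  have := mulr_ge0 h (sqr_ge0 A).
  suff -> : (2 * (- b / A) * b + (- b / A) ^+ 2 * a) * A ^+ 2 =
    - (2 * b ^+ 2) * A + b ^+ 2 * a by [].
  by field; rewrite gt_eqF.
have ba : b ^+ 2 * a <= b ^+ 2 * A.
  by rewrite ler_wpM2l ?sqr_ge0// (le_trans (ler_norm _))// lerDl.
have bA : b ^+ 2 * A <= 0 by lra.
by rewrite -(pmulr_lle0 _ A0).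
Qed.

(** * Riesz representation *)

Section riesz.
Context {R : realType} (H : hilbertType R).

(** The representing vector minimises |x|^2 - 2 phi(x). A minimising sequence is Cauchy by the
    parallelogram law ([parJ]). The first-order condition is derived along that sequence, with error
    [n.+1%:R^-1], and then passed to the limit. *)
Lemma riesz (phi : H -> R) (M : R) :
  (forall a x y, phi (a *: x + y) = a * phi x + phi y) ->
  (forall x, `|phi x| <= M * `|x|) ->
  exists z, forall x, phi x = inner z x.
Proof.
move=> phil phib.
have phiZ a x : phi (a *: x) = a * phi x.
  have p0 : phi 0 = 0.
    by have := phil 1 0 0; rewrite scaler0 addr0 mul1r; lra.
  by have := phil a x 0; rewrite p0 !addr0.
have phiD x y : phi (x + y) = phi x + phi y.
  by have := phil 1 x y; rewrite scale1r mul1r.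
pose J x := `|x| ^+ 2 - 2 * phi x.
have Jlb : has_inf (range J).
  split; first by exists (J 0), 0.
  exists (- M ^+ 2) => _ [x _ <-]; rewrite /J.
  have := phib x; have := ler_norm (phi x); have := sqr_ge0 (`|x| - M).
  nra.
pose m := inf (range J).
have mJ x : m <= J x by apply: ge_inf; [case: Jlb|exists x].
have /choice[x xJ] : forall n : nat, exists x, J x < m + n.+1%:R^-1.
  move=> n; have n0 : (0 : R) < n.+1%:R^-1 by [].
  by have [_ [x _ <-] Jx] := inf_adherent n0 Jlb; exists x.
have parJ y z : `|y - z| ^+ 2 <= 2 * (J y + J z - 2 * m).
  have := mJ (2^-1 *: (y + z)).
  rewrite /J phiZ phiD normrZ exprMn ger0_norm ?invr_ge0//.
  rewrite sqr_normD sqr_normB exprVn; set A := inner _ _.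
  move: (`|y| ^+ 2) (`|z| ^+ 2) => a b.
  move: (phi y) (phi z) => p q h; lra.
have xc : cvgn x.
  apply: cauchy_seq_cvg => e e0.
  have e24 : 0 < e ^+ 2 / 4 by rewrite divr_gt0// exprn_gt0.
  have [N _ hN] := near_infty_natSinv_lt (PosNum e24).
  exists N => n Nn; rewrite -(@ltr_pXn2r _ 2) ?nnegrE ?normr_ge0 ?(ltW e0)//.
  apply: le_lt_trans (parJ _ _) _.
  have := xJ N; have := xJ n.
  have /= := hN N (leqnn N); have /= := hN n Nn.
  by move: (N.+1%:R^-1) (n.+1%:R^-1) => p q; lra.
have /cvg_ex[z xz] := xc.
exists z => y; apply/esym/eqP; rewrite -subr_eq0; apply/eqP.
have b0 n t : 0 <= 2 * t * (inner (x n) y - phi y) + t ^+ 2 * `|y| ^+ 2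
    + n.+1%:R^-1.
  have := mJ (x n + t *: y); have := xJ n.
  rewrite /J sqr_normD phiD phiZ innerZr normrZ exprMn real_normK ?num_real//.
  move: (n.+1%:R^-1) => r; lra.
apply: (@quad_nonneg_lin0 _ (`|y| ^+ 2)) => t.
have h : 2 * t * (inner (x n) y - phi y) + t ^+ 2 * `|y| ^+ 2 + n.+1%:R^-1
    @[n --> \oo] --> 2 * t * (inner z y - phi y) + t ^+ 2 * `|y| ^+ 2 + 0.
  apply: cvgD; last exact: cvg_harmonic.
  apply: cvgD; last exact: cvg_cst.
  apply: cvgM; first exact: cvg_cst.
  apply: cvgB; last exact: cvg_cst.
  by apply: cvg_inner => //; exact: cvg_cst.
rewrite -[leRHS]addr0; apply: (cvgr_to_ge h).
by near=> n; exact: b0.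
Unshelve. all: by end_near. Qed.

Lemma adjoint_vector (T : {linear H -> H}) (u : H) :
  bounded_operator T -> exists u', forall x, inner (T x) u = inner x u'.
Proof.
move=> [M TM]; have [|x|z zE] := @riesz (fun x => inner (T x) u) (M * `|u|).
- by move=> a x y; rewrite linearP innerDl innerZl.
- apply: le_trans (inner_le _ _) _.
  by rewrite mulrAC ler_wpM2r.
- by exists z => x; rewrite zE innerC.
Qed.

End riesz.

(** * Hilbert-Schmidt norm of a finite sum of tensors *)

Section hilbert_schmidt.
Context {R : realType} (H : hilbertType R) (I : Type).
Implicit Types (x e : I -> H) (r : seq I).

(* The squared Hilbert-Schmidt norm of [y |-> \sum_(k <- r) inner (x k) y *: e k]. *)
Definition gram_trace r x e : R :=
  \sum_(k <- r) \sum_(l <- r) inner (x k) (x l) * inner (e k) (e l).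

(** Pythagoras for the Hilbert-Schmidt norm, along the line of [y] and its orthogonal complement:
    the adjusted vectors describe the operator on the complement, and the last term is its squared
    norm at the unit vector along [y]. For [y = 0] both quotients are [0] and nothing is removed. *)
Lemma gram_trace_proj r x e y :
  gram_trace r x e =
  gram_trace r (fun k => x k - (inner (x k) y / `|y| ^+ 2) *: y) e
  + `| \sum_(k <- r) inner (x k) y *: e k| ^+ 2 / `|y| ^+ 2.
Proof.
rewrite /gram_trace -[`|\sum_(k <- r) _| ^+ 2]inner_norm inner_suml mulr_suml.
rewrite -big_split/=; apply: eq_bigr => k _.
rewrite inner_sumr mulr_suml -big_split/=; apply: eq_bigr => l _.
rewrite innerBl !innerBr !innerZl !innerZr inner_norm (innerC y (x l)).
have [->|y0] := eqVneq y 0; first by rewrite !inner0r; ring.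
by field; rewrite normr_eq0.
Qed.

(** Induction on the list, which avoids an orthonormal basis of [H]: projecting out [x k0] splits
    off a nonnegative term and replaces the head vector by [0], so that its row and column
    disappear. *)
Lemma gram_trace_ge0 r x e : 0 <= gram_trace r x e.
Proof.
elim: r x => [x|k0 r IHr x]; first by rewrite /gram_trace big_nil.
rewrite (gram_trace_proj _ _ _ (x k0)); set x' := fun k => _.
rewrite addr_ge0 ?divr_ge0 ?sqr_ge0//.
suff -> : gram_trace (k0 :: r) x' e = gram_trace r x' e by [].
have x'0 : x' k0 = 0.
  rewrite /x' inner_norm; have [->|x0] := eqVneq (x k0) 0.
    by rewrite scaler0 subrr.
  by rewrite divff ?sqrf_eq0 ?normr_eq0// scale1r subrr.
rewrite /gram_trace big_cons big1 ?add0r => [|l _]; last first.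
  by rewrite x'0 inner0l mul0r.
by apply: eq_bigr => k _; rewrite big_cons x'0 inner0r mul0r add0r.
Qed.

Lemma operator_le_gram_trace r x e y :
  `|\sum_(k <- r) inner (x k) y *: e k| ^+ 2 <= `|y| ^+ 2 * gram_trace r x e.
Proof.
have [->|y0] := eqVneq y 0.
  by rewrite big1 ?normr0 ?expr0n ?mul0r// => k _; rewrite inner0r scale0r.
rewrite mulrC -ler_pdivrMr ?exprn_gt0 ?normr_gt0//.
by rewrite (gram_trace_proj _ _ _ y) lerDr gram_trace_ge0.
Qed.

End hilbert_schmidt.

(** * Top eigenvector of a finite-rank frame operator *)

Section frame_operator.
Context {R : realType} (H : hilbertType R).

(** Let V send coefficients [c] to the sum of the [c i *: x i], with adjoint V'. Then [T] is V V',
    which has the same nonzero eigenvalues as the Gram matrix V' V. So |V c|^2 is maximised over the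
    unit sphere of coefficients, which is compact. The maximum is [mu] and [u = V c], whence |u|^2 =
    [mu]. The norm bound is |V a|^2 <= mu |a|^2 at a = V' y, where |a|^2 = <T y, y>. For [n = 0] the
    sphere is empty, hence the separate case. *)
Lemma frame_top_eigenvector n (x : 'I_n -> H) :
  let T y := \sum_i inner (x i) y *: x i in
  exists mu u, [/\ 0 <= mu, T u = mu *: u, mu != 0 -> u != 0
    & forall y, `|T y| <= mu * `|y|].
Proof.
move=> T; case: n x @T => [|n] x T.
  exists 0, 0; split => //; first by rewrite /T big_ord0 scaler0.
    by rewrite eqxx.
  by move=> y; rewrite /T big_ord0 normr0 mul0r.
pose N (c d : 'rV[R]_n.+1) := \sum_i c ord0 i * d ord0 i.
pose V (c : 'rV[R]_n.+1) := \sum_i c ord0 i *: x i.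
pose f c := `|V c| ^+ 2.
pose A := [set c | N c c = 1].
have Vcont : continuous (V : 'rV[R]_n.+1 -> H).
  move=> c; apply: (@cvg_sum_seq R H _ (nbhs c) (nbhs_filter c)) => i _.
  by apply: cvgZ; [exact: coord_continuous|exact: cvg_cst].
have fcont : continuous f.
  have -> : f = (fun v => inner v v) \o V.
    by apply/funext => d; rewrite /f /= inner_norm.
  move=> c; apply: continuous_comp; first exact: Vcont.
  by apply: cvg_inner; exact: cvg_id.
have Ncont : continuous (fun c => N c c).
  move=> c; apply: (@cvg_sum_seq R R^o _ (nbhs c) (nbhs_filter c)) => i _.
  by apply: cvgM; exact: coord_continuous.
have Acl : closed A.
  rewrite (_ : A = (fun c => N c c) @^-1` [set 1])//.
  by apply: closed_comp => // c _; exact: Ncont.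
have Acompact : compact A.
  have box : compact [set v : 'rV[R]_n.+1 | forall i, v ord0 i \in `[(-1 : R), 1]].
    apply: (@rV_compact _ _ (fun=> `[(-1 : R), 1]%classic)) => _.
    exact: segment_compact.
  apply: subclosed_compact Acl box _ => c Ac i /=.
  rewrite in_itv/= -ler_norml -(@ler_pXn2r _ 2)// ?nnegrE// expr1n.
  rewrite real_normK ?num_real// -[leRHS]Ac /N (bigD1 i)//= expr2 lerDl.
  by apply: sumr_ge0 => j _; rewrite -expr2 sqr_ge0.
have A0 : A !=set0.
  exists (delta_mx 0 0); rewrite /A/= /N (bigD1 ord0)//= big1 ?addr0.
    by rewrite mxE !eqxx mulr1.
  by move=> i /negPf i0; rewrite mxE i0 andbF mul0r.
have [c /set_mem Ac cmax] := EVT_max_rV A0 Acompact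
  (continuous_subspaceT fcont).
pose mu := f c.
have VD d d' t : V (d + t *: d') = V d + t *: V d'.
  rewrite /V scaler_sumr -big_split/=; apply: eq_bigr => i _.
  by rewrite !mxE scalerDl scalerA.
have VZ d t : V (t *: d) = t *: V d.
  by rewrite /V scaler_sumr; apply: eq_bigr => i _; rewrite mxE scalerA.
have NZ d t : N (t *: d) (t *: d) = t ^+ 2 * N d d.
  by rewrite /N mulr_sumr; apply: eq_bigr => i _; rewrite !mxE; ring.
have fmu d : f d <= mu * N d d.
  have Nge : 0 <= N d d.
    by apply: sumr_ge0 => j _; rewrite -expr2 sqr_ge0.
  have [N0|N0] := eqVneq (N d d) 0.
    suff -> : d = 0 by rewrite /f /V big1 ?normr0 ?expr0n/= ?mulr_ge0 ?sqr_ge0//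
      => [|i _]; [apply: sumr_ge0 => i _; rewrite mxE mul0r
                 | rewrite mxE scale0r].
    apply/rowP => i; rewrite mxE; apply/eqP; rewrite -sqrf_eq0.
    rewrite eq_le sqr_ge0 andbT -N0 /N (bigD1 i)//= -expr2 lerDl.
    by apply: sumr_ge0 => j _; rewrite -expr2 sqr_ge0.
  have Ngt : 0 < N d d by rewrite lt_neqAle eq_sym N0.
  have s0 : 0 < Num.sqrt (N d d) by rewrite sqrtr_gt0.
  have := cmax ((Num.sqrt (N d d))^-1 *: d).
  rewrite /f VZ normrZ exprMn normfV ger0_norm ?sqrtr_ge0// exprVn sqr_sqrtr//.
  rewrite mulrC ler_pdivrMr// -/(f d); apply; apply: mem_set.
  by rewrite /A/= NZ exprVn sqr_sqrtr// mulVf.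
have xu i : inner (x i) (V c) = mu * c ord0 i.
  apply/esym/eqP; rewrite -subr_eq0; apply/eqP.
  have [d [Vd Nd]] : exists d : 'rV[R]_n.+1, V d = x i /\ N c d = c ord0 i.
    exists (delta_mx 0 i); split.
      rewrite /V (bigD1 i)//= big1 ?addr0 ?mxE ?eqxx ?scale1r// => j /negPf ji.
      by rewrite mxE ji andbF scale0r.
    rewrite /N (bigD1 i)//= big1 ?addr0 ?mxE ?eqxx ?mulr1// => j /negPf ji.
    by rewrite mxE ji andbF mulr0.
  have fd : f d = `|x i| ^+ 2 by rewrite /f Vd.
  (* [fmu] is an equality at [c], so its first-order term along the [i]-th basis vector [d] must
     vanish. *)
  apply: (@quad_nonneg_lin0 _ (mu * N d d - f d)) => t.
  have := fmu (c + t *: d); rewrite {1}/f VD Vd sqr_normD normrZ exprMn fd.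
  rewrite real_normK ?num_real// innerZr (innerC (V c)) -/(f c) -/mu.
  have -> : N (c + t *: d) (c + t *: d) = 1 + 2 * t * c ord0 i + t ^+ 2 * N d d.
    rewrite -Nd -[X in _ = X + _ + _]Ac /N !mulr_sumr -!big_split/=; apply: eq_bigr => j _.
    by rewrite !mxE; ring.
  lra.
exists mu, (V c); split.
- exact: sqr_ge0.
- rewrite /T [in RHS]/V scaler_sumr; apply: eq_bigr => i _.
  by rewrite xu scalerA.
- by rewrite /mu /f sqrf_eq0 normr_eq0.
- move=> y; pose a : 'rV[R]_n.+1 := \row_i inner (x i) y.
  have aE : V a = T y by apply: eq_bigr => i _; rewrite mxE.
  have := fmu a; rewrite /f aE.
  have -> : N a a = inner (T y) y.
    rewrite /N inner_suml; apply: eq_bigr => i _.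
    by rewrite !mxE innerZl.
  move=> h; have [Ty0|Ty0] := eqVneq (T y) 0.
    by rewrite Ty0 normr0 mulr_ge0// sqr_ge0.
  have Tyg : 0 < `|T y| by rewrite normr_gt0.
  rewrite -(ler_pM2l Tyg) -expr2; apply: le_trans h _.
  rewrite mulrCA ler_wpM2l ?sqr_ge0//.
  by apply: le_trans (ler_norm _) _; exact: inner_le.
Qed.

End frame_operator.

(** * Spectral truncation *)

Definition eigen_proj (R : realType) (H : hilbertType R) (v : nat -> H) K (y : H) :=
  \sum_(1 <= j < K.+1) inner (v j) y *: v j.

Section eigen_system.
Context {R : realType} (H : hilbertType R) (n : nat) (x : 'I_n -> H).
Variables (T : H -> H) (lam : nat -> R) (v : nat -> H).
Hypothesis TE : forall y, T y = \sum_i inner (x i) y *: x i.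
Hypothesis esT : eigen_system T lam v.

Let v_orth i j : (1 <= i)%N -> (1 <= j)%N -> inner (v i) (v j) = (i == j)%:R.
Proof. by case: esT => + _ _ _; exact. Qed.

Let Tv j : (1 <= j)%N -> T (v j) = lam j *: v j.
Proof. by case: esT => _ + _ _; exact. Qed.

Lemma eigenvalue_ge0 j : (1 <= j)%N -> 0 <= lam j.
Proof.
case: esT => _ _ h _ j1; have /andP[] := h j j1; exact: le_trans.
Qed.

Lemma eigenvalue_mono i j : (1 <= i)%N -> (i <= j)%N -> lam j <= lam i.
Proof.
case: esT => _ _ h _ i1; elim: j => [|j IHj]; first by case: i i1.
rewrite leq_eqVlt => /predU1P[->//|ij].
have /andP[_ /le_trans] := h j (leq_trans i1 ij); apply; exact: IHj.
Qed.

Lemma frame_sym y z : inner (T y) z = inner y (T z).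
Proof.
rewrite !TE inner_suml inner_sumr; apply: eq_bigr => i _.
by rewrite innerZl innerZr mulrC (innerC y).
Qed.

Lemma frameD y z : T (y + z) = T y + T z.
Proof.
by rewrite !TE -big_split/=; apply: eq_bigr => i _; rewrite innerDr scalerDl.
Qed.

Lemma frameZ a y : T (a *: y) = a *: T y.
Proof.
rewrite !TE scaler_sumr; apply: eq_bigr => i _.
by rewrite innerZr scalerA.
Qed.

Lemma frame_sum (I : Type) (r : seq I) (F : I -> H) :
  T (\sum_(i <- r) F i) = \sum_(i <- r) T (F i).
Proof.
elim: r => [|i r IHr]; last by rewrite !big_cons frameD IHr.
by rewrite !big_nil TE big1 // => i _; rewrite inner0r scale0r.
Qed.

(** If [lam j] were nonzero, so would be all earlier eigenvalues, and the identity matrix of size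
    [j] would factor through dimension [n] by pairing the first [j] eigenvectors with the vectors
    [x]. *)
Lemma eigenvalue_rank j : (n < j)%N -> lam j = 0.
Proof.
case: j => // j nj; apply/eqP/negPn/negP => lj0.
have lj i : (i < j.+1)%N -> lam i.+1 != 0.
  move=> ij; rewrite gt_eqF// (lt_le_trans _ (eigenvalue_mono _ ij))//.
  by rewrite lt_neqAle eq_sym lj0 eigenvalue_ge0.
pose A : 'M[R]_(j.+1, n) :=
  \matrix_(i, k) ((lam i.+1)^-1 * inner (x k) (v i.+1)).
pose B : 'M[R]_(n, j.+1) := \matrix_(k, i) inner (x k) (v i.+1).
suff /mulmx1_min : A *m B = 1%:M by rewrite leqNgt nj.
apply/matrixP => i i'; rewrite !mxE.
under eq_bigr do rewrite !mxE -mulrA.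
rewrite -mulr_sumr; transitivity ((lam i.+1)^-1 * inner (T (v i.+1)) (v i'.+1)).
  congr (_ * _); rewrite TE inner_suml; apply: eq_bigr => k _.
  by rewrite innerZl.
by rewrite Tv// innerZl mulrA mulVf ?lj// mul1r v_orth.
Qed.

Lemma eigenvalue1_le_trace : lam 1%N <= \sum_i `|x i| ^+ 2.
Proof.
have v11 : inner (v 1%N) (v 1%N) = 1 by rewrite v_orth.
have -> : lam 1%N = inner (T (v 1%N)) (v 1%N) by rewrite Tv// innerZl v11 mulr1.
rewrite TE inner_suml; apply: ler_sum => i _.
rewrite innerZl -expr2; apply: le_trans (inner_sqr_le _ _) _.
by rewrite -[X in _ * X]inner_norm v11 mulr1.
Qed.

Local Notation P := (eigen_proj v).

Lemma inner_eigen_sum K (c : nat -> R) j : (1 <= j)%N -> (j <= K)%N ->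
  inner (v j) (\sum_(1 <= i < K.+1) c i *: v i) = c j.
Proof.
move=> j1 jK; rewrite inner_sumr (big_cat_nat (n := j))//= ?leqW//.
rewrite (@big_ltn _ _ _ j)//= innerZr v_orth// eqxx mulr1.
rewrite big_nat big1 => [|i /andP[i1 ij]]; last first.
  by rewrite innerZr v_orth// gtn_eqF// mulr0.
rewrite big_nat big1 => [|i /andP[ji iK]]; last first.
  by rewrite innerZr v_orth ?(leq_trans j1 (ltnW ji))// ltn_eqF// mulr0.
by rewrite add0r addr0.
Qed.

Let inner_v_P K y j : (1 <= j)%N -> (j <= K)%N -> inner (v j) (P K y) = inner (v j) y.
Proof. exact: inner_eigen_sum. Qed.

Let P_sym K y z : inner (P K y) z = inner y (P K z).
Proof.
rewrite /eigen_proj inner_suml inner_sumr; apply: eq_bigr => j _.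
by rewrite innerZl innerZr mulrC (innerC y).
Qed.

Let T_P K y : T (P K y) = \sum_(1 <= j < K.+1) (lam j * inner (v j) y) *: v j.
Proof.
rewrite /eigen_proj frame_sum big_nat [RHS]big_nat; apply: eq_bigr => j /andP[j1 _].
by rewrite frameZ Tv// scalerA mulrC.
Qed.

Let P_T K y : P K (T y) = T (P K y).
Proof.
rewrite T_P /eigen_proj big_nat [RHS]big_nat; apply: eq_bigr => j /andP[j1 _].
by rewrite -frame_sym Tv// innerZl.
Qed.

(** As [P K] commutes with [T], the difference is the frame operator of the projected vectors
    [x i - P K (x i)]; its norm is bounded by one of its eigenvalues [mu], with eigenvector [u]. For
    [mu != 0], [u] is orthogonal to the first [K] eigenvectors, hence an eigenvector of [T] itself.
    If [mu] exceeded [lam K.+1], every [v j] with [lam j = mu] would have [j <= K], and the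
    completeness clause of [eigen_system] would force [u = 0]. *)
Lemma truncation_error K y :
  `|T y - \sum_(1 <= j < K.+1) (lam j * inner (v j) y) *: v j|
  <= lam K.+1 * `|y|.
Proof.
rewrite -T_P.
pose x' i := x i - P K (x i).
have [mu [u [mu0 Tu u0 Tmu]]] := frame_top_eigenvector x'.
have T0 : T 0 = 0 by rewrite -(scale0r 0) frameZ !scale0r.
have T'E z : \sum_i inner (x' i) z *: x' i = T z - T (P K z).
  have -> : T z - T (P K z) = T (z - P K z) - P K (T (z - P K z)).
    rewrite P_T -scaleN1r -frameZ -frameD scaleN1r.
    suff -> : P K (z - P K z) = 0 by rewrite T0 subr0.
    rewrite /eigen_proj big_nat big1// => j /andP[j1 jK].
    by rewrite innerBr inner_v_P// subrr scale0r.
  rewrite TE; set w := z - _.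
  have -> : P K (\sum_i inner (x i) w *: x i) = \sum_i inner (x i) w *: P K (x i).
    rewrite /eigen_proj; under [RHS]eq_bigr do rewrite scaler_sumr.
    rewrite exchange_big/=; apply: eq_bigr => j _.
    rewrite inner_sumr scaler_suml; apply: eq_bigr => i _.
    by rewrite innerZr scalerA.
  rewrite -sumrB; apply: eq_bigr => i _.
  by rewrite -scalerBr /x' innerBl P_sym -innerBr.
rewrite -T'E; apply: le_trans (Tmu y) _; rewrite ler_wpM2r//.
have [->|mun0] := eqVneq mu 0; first exact: eigenvalue_ge0.
rewrite leNgt; apply/negP => lamu.
have vu j : (1 <= j)%N -> (j <= K)%N -> inner (v j) u = 0.
  move=> j1 jK; have -> : u = mu^-1 *: (T u - T (P K u)).
    by rewrite -T'E Tu scalerA mulVf// scale1r.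
  by rewrite -P_T innerZr innerBr inner_v_P// subrr mulr0.
have Tuu : T u = mu *: u.
  rewrite -Tu T'E T_P big_nat big1 ?subr0// => j /andP[j1 jK].
  by rewrite vu// mulr0 scale0r.
have /eqP := u0 mun0; apply; case: esT => _ _ _ /(_ mu u mun0 Tuu); apply.
move=> j j1 ljmu; have [jK|Kj] := leqP j K; first exact: vu.
by move: lamu; rewrite -ljmu ltNge eigenvalue_mono.
Qed.

Lemma frame_norm_le y : `|T y| <= lam 1%N * `|y|.
Proof. by have := truncation_error 0 y; rewrite big_geq// subr0. Qed.

Lemma frame_spectral y :
  T y = \sum_(1 <= j < n.+1) (lam j * inner (v j) y) *: v j.
Proof.
apply/eqP; rewrite -subr_eq0 -normr_le0; apply: le_trans (truncation_error n y) _.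
by rewrite eigenvalue_rank// mul0r.
Qed.

Lemma tail_le K y : `|T y - P K (T y)| <= lam K.+1 * `|y|.
Proof. by rewrite P_T T_P; exact: truncation_error. Qed.

Lemma sqr_norm_eigen_sum K (c : nat -> R) :
  `|\sum_(1 <= j < K.+1) c j *: v j| ^+ 2 = \sum_(1 <= j < K.+1) c j ^+ 2.
Proof.
rewrite -inner_norm inner_suml big_nat [RHS]big_nat.
apply: eq_bigr => j /andP[j1 jK].
by rewrite innerZl inner_eigen_sum// expr2.
Qed.

Let bessel K y : `|P K y| <= `|y|.
Proof.
have [->|Py0] := eqVneq (P K y) 0; first by rewrite normr0.
have Pg : 0 < `|P K y| by rewrite normr_gt0.
rewrite -(ler_pM2l Pg) -expr2 (_ : `|P K y| ^+ 2 = inner (P K y) y).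
  exact: le_trans (ler_norm _) (inner_le _ _).
rewrite sqr_norm_eigen_sum /eigen_proj inner_suml; apply: eq_bigr => j _.
by rewrite innerZl expr2.
Qed.

Lemma eigen_proj_error_le K y : `|y - P K y| <= `|y|.
Proof.
rewrite -(@ler_pXn2r _ 2) ?nnegrE ?normr_ge0// sqr_normB.
have -> : inner y (P K y) = `|P K y| ^+ 2.
  rewrite sqr_norm_eigen_sum /eigen_proj inner_sumr; apply: eq_bigr => j _.
  by rewrite innerZr (innerC y) expr2.
by have := sqr_ge0 `|P K y|; lra.
Qed.

Lemma eigen_projB K y z : P K (y - z) = P K y - P K z.
Proof.
by rewrite /eigen_proj -sumrB; apply: eq_bigr => j _; rewrite innerBr scalerBl.
Qed.

(* [spec g] is [g(T)]: the functional calculus, also on the kernel of [T]. *)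
Definition spec (g : R -> R) y :=
  g 0 *: y + \sum_(1 <= j < n.+1) ((g (lam j) - g 0) * inner (v j) y) *: v j.

Lemma spec_cst a y : spec (fun=> a) y = a *: y.
Proof.
by rewrite /spec big1 ?addr0// => j _; rewrite subrr mul0r scale0r.
Qed.

Lemma spec_id y : spec id y = T y.
Proof.
rewrite /spec frame_spectral scale0r add0r.
by apply: eq_bigr => j _; rewrite subr0.
Qed.

Lemma spec_add g h y : spec (fun t => g t + h t) y = spec g y + spec h y.
Proof.
rewrite /spec addrACA -scalerDl; congr (_ + _); rewrite -big_split/=.
by apply: eq_bigr => j _; rewrite -scalerDl; congr (_ *: _); ring.
Qed.

Let inner_v_spec g y j : (1 <= j)%N -> (j <= n)%N ->
  inner (v j) (spec g y) = g (lam j) * inner (v j) y.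
Proof.
by move=> j1 jn; rewrite /spec innerDr innerZr inner_eigen_sum//; ring.
Qed.

Lemma spec_mul g h y : spec (fun t => g t * h t) y = spec g (spec h y).
Proof.
rewrite {2}/spec [in RHS]big_nat.
under [in RHS]eq_bigr => j /andP[j1 jn] do rewrite inner_v_spec//.
rewrite -[in RHS]big_nat {2}/spec scalerDr scalerA scaler_sumr -addrA.
rewrite -big_split/= /spec; congr (_ + _); apply: eq_bigr => j _.
by rewrite scalerA -scalerDl; congr (_ *: _); ring.
Qed.

Lemma spec_cvg (Tp : Type) (F : set_system Tp) (FF : Filter F)
    (g_ : Tp -> R -> R) (g : R -> R) y :
  (forall t, t = 0 \/ (exists2 j, (1 <= j)%N & t = lam j) ->
    g_ i t @[i --> F] --> g t) ->
  spec (g_ i) y @[i --> F] --> spec g y.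
Proof.
move=> gg; have g0 := gg 0 (or_introl erefl).
apply: cvgD; first by apply: cvgZ => //; exact: cvg_cst.
rewrite big_nat; under eq_cvg do rewrite big_nat.
apply: (@cvg_sum_seq R H _ F FF) => j /andP[j1 _]; apply: cvgZ; last exact: cvg_cst.
apply: cvgM; last exact: cvg_cst.
by apply: cvgB => //; apply: gg; right; exists j.
Qed.

Section truncation.
Variable m : R.
Hypothesis m1 : 1 <= m.
Let K := K_trunc lam m.

(** Since [1 <= m], the index 1 qualifies; indices beyond [n] do not, because their eigenvalue is
    [0]. Hence [max_nat] returns a true maximum and not its default [0]. By monotonicity the
    admissible indices form an initial segment, and the failure of [K.+1] is the bound on
    [lam K.+1]. *)
Lemma K_truncP : 0 < lam 1%N ->
  [/\ (K <= n)%N, lam K.+1 <= lam 1%N / m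
    & forall j, (1 <= j)%N -> (j <= K)%N = (lam 1%N <= m * lam j)].
Proof.
move=> lam1; have m0 : 0 < m by exact: lt_le_trans m1.
pose A := [set j | (1 <= j)%N /\ (Defs.ratio (lam 1%N) (lam j) <= m%:E)%E].
have AE j : (1 <= j)%N -> A j <-> lam 1%N <= m * lam j.
  move=> j1; rewrite /A/= /Defs.ratio; case: ifPn => [/eqP -> |lj0].
    by rewrite mulr0 (leNgt (lam _)) lam1; split=> [[_]|].
  have ljgt : 0 < lam j by rewrite lt_neqAle eq_sym lj0 eigenvalue_ge0.
  by rewrite lee_fin ler_pdivrMr//; split=> [[]|].
have An j : A j -> (j <= n)%N.
  move=> Aj; have /AE := Aj; case: (Aj) => j1 _ /(_ j1).
  rewrite leqNgt; apply: contraTN => nj.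
  by rewrite (eigenvalue_rank nj) mulr0 -ltNge.
have A1 : A 1%N by apply/AE => //; rewrite ler_peMl// ltW.
have exA : exists j, `[< A j >] by exists 1%N; apply/asboolP.
have ubA j : `[< A j >] -> (j <= n)%N by move=> /asboolP /An.
case: (ex_maxnP exA ubA) => k /asboolP Ak kmax.
have kM j : A j -> (j <= k)%N by move=> Aj; apply/kmax/asboolP.
have KE : K = k.
  rewrite /K /K_trunc /max_nat; apply: xget_unique => [//|j [Aj jmax]].
  by apply/eqP; rewrite eqn_leq kM// jmax.
have KP j : (1 <= j)%N -> (j <= K)%N = (lam 1%N <= m * lam j).
  move=> j1; rewrite KE; apply/idP/idP => [jk|/(AE _ j1)]; last exact: kM.
  have [k1 _] := Ak; have := (AE _ k1).1 Ak => /le_trans; apply.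
  by rewrite ler_wpM2l ?(ltW m0)// eigenvalue_mono.
split => //; first by rewrite KE An.
have := KP K.+1 isT; rewrite ltnn => /esym/negbT; rewrite -ltNge => /ltW.
by rewrite ler_pdivlMr// mulrC.
Qed.

(** The right-hand side depends on the operator only, which is what makes the estimator measurable.
    If [lam 1 > 0], the cut-off function vanishes at [0] and keeps exactly the indices up to [K]. If
    [lam 1 = 0], all eigenvalues vanish and both sides are [0], whatever [K] is, because
    [0^-1 = 0]. *)
Lemma truncated_inverse y :
  \sum_(1 <= j < K.+1) ((lam j)^-1 * inner (v j) y) *: v j =
  spec (fun t => if lam 1%N <= m * t then t^-1 else 0) y.
Proof.
have m0 : 0 < m by exact: lt_le_trans m1.
rewrite /spec; have [lam1|lam1] := ltP 0 (lam 1%N); last first.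
  have l0 j : (1 <= j)%N -> lam j = 0.
    move=> j1; apply/eqP; rewrite eq_le eigenvalue_ge0// andbT.
    exact: le_trans (eigenvalue_mono _ j1) lam1.
  rewrite invr0 if_same scale0r add0r !big_nat !big1// => j /andP[j1 _].
    by rewrite (l0 j)// invr0 if_same subrr mul0r scale0r.
  by rewrite (l0 j)// invr0 mul0r scale0r.
have [Kn _ KP] := K_truncP lam1.
rewrite mulr0 leNgt lam1/= scale0r add0r.
rewrite [RHS](big_cat_nat (n := K.+1))//= [X in _ = _ + X]big_nat.
rewrite [X in _ = _ + X]big1 => [|j /andP[Kj _]]; last first.
  by rewrite -KP ?(leq_trans _ Kj)// leqNgt Kj/= subrr mul0r scale0r.
rewrite addr0 big_nat [RHS]big_nat; apply: eq_bigr => j /andP[j1 jK].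
by rewrite -KP// -ltnS jK subr0.
Qed.

Lemma truncated_inverse_apply y : 0 < lam 1%N ->
  T (\sum_(1 <= j < K.+1) ((lam j)^-1 * inner (v j) y) *: v j) = P K y.
Proof.
move=> lam1; have [_ _ KP] := K_truncP lam1.
rewrite frame_sum /eigen_proj big_nat [RHS]big_nat; apply: eq_bigr => j /andP[j1 jK].
rewrite frameZ Tv// scalerA mulrAC mulVf ?mul1r//.
have m0 : 0 < m by exact: lt_le_trans m1.
rewrite gt_eqF// -(pmulr_rgt0 _ m0) (lt_le_trans lam1)//.
by rewrite -KP// -ltnS.
Qed.

(** Every retained eigenvalue is at least [lam 1 / m]; the rest is Bessel's inequality. *)
Lemma truncated_inverse_norm y : 0 < lam 1%N ->
  `|\sum_(1 <= j < K.+1) ((lam j)^-1 * inner (v j) y) *: v j|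
  <= m / lam 1%N * `|y|.
Proof.
move=> lam1; have m0 : 0 < m by exact: lt_le_trans m1.
have [Kn _ KP] := K_truncP lam1.
have ml0 : 0 < m / lam 1%N by rewrite divr_gt0.
apply: le_trans (ler_wpM2l (ltW ml0) (bessel K y)).
rewrite -(@ler_pXn2r _ 2) ?nnegrE ?normr_ge0 ?mulr_ge0 ?invr_ge0 ?(ltW m0) ?(ltW lam1)//.
rewrite exprMn !sqr_norm_eigen_sum mulr_sumr !big_nat.
apply: ler_sum => j /andP[j1 jK].
rewrite exprMn ler_wpM2r ?sqr_ge0//.
have lj : lam 1%N <= m * lam j by rewrite -KP// -ltnS.
have lj0 : 0 < lam j by rewrite -(pmulr_rgt0 _ m0) (lt_le_trans lam1).
rewrite ler_pXn2r ?nnegrE ?invr_ge0 ?(ltW lj0) ?(ltW ml0)//.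
by rewrite -[leLHS]mul1r ler_pdivrMr// mulrAC ler_pdivlMr// mul1r.
Qed.

End truncation.
End eigen_system.

(** * Measurability *)

Lemma measurable_fun_superlevel d (T : measurableType d) (R : realType)
    (f : T -> R) :
  (forall c, measurable [set w | c < f w]) -> measurable_fun setT f.
Proof.
move=> fm mT; apply: (measurability _ (RGenOInfty.measurableE R)) => //.
move=> /= _ [_ [c ->] <-]; apply: measurableI => //.
rewrite [X in measurable X](_ : _ = [set w | c < f w])//.
by apply/seteqP; split => w /=; rewrite in_itv/= andbT.
Qed.

Section weak_measurability.
Context {R : realType} (H : hilbertType R) d (Omega : measurableType d).
Implicit Types (Z : Omega -> H).

(** Stable under sums, scalar factors, bounded operators and pointwise limits by reduction to real
    functions, and equivalent to Borel measurability when [H] is separable; all measurability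
    arguments go through it. *)
Definition weakly_measurable Z :=
  forall u, measurable_fun setT (fun w => inner (Z w) u).

Lemma random_element_weakly Z : random_element Z -> weakly_measurable Z.
Proof.
move=> mZ u; apply: measurable_fun_superlevel => c.
rewrite (_ : [set w | _] = setT `&` Z @^-1` [set x : borel H | c < inner (x : H) u]);
  last by rewrite setTI.
apply: mZ => //; apply: sub_sigma_algebra.
rewrite (_ : [set x | _] = (fun x : H => inner x u) @^-1` [set t | c < t])//.
apply: open_comp; last exact: open_gt.
by move=> x _; apply: cvg_inner => //; exact: cvg_cst.
Qed.

Lemma weakly_measurable_cst (x : H) : weakly_measurable (fun=> x).
Proof. by move=> u; exact: measurable_cst. Qed.

Lemma weakly_measurableD Z1 Z2 : weakly_measurable Z1 -> weakly_measurable Z2 ->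
  weakly_measurable (fun w => Z1 w + Z2 w).
Proof.
move=> m1 m2 u; under eq_fun do rewrite innerDl.
exact: measurable_funD.
Qed.

Lemma weakly_measurableZ (a : Omega -> R) Z :
  measurable_fun setT a -> weakly_measurable Z ->
  weakly_measurable (fun w => a w *: Z w).
Proof.
move=> ma mZ u; under eq_fun do rewrite innerZl.
exact: measurable_funM.
Qed.

Lemma weakly_measurableB Z1 Z2 : weakly_measurable Z1 -> weakly_measurable Z2 ->
  weakly_measurable (fun w => Z1 w - Z2 w).
Proof.
move=> m1 m2 u; under eq_fun do rewrite innerBl.
exact: measurable_funB.
Qed.

Lemma weakly_measurable_sum (I : Type) (r : seq I) (F : I -> Omega -> H) :
  (forall i, weakly_measurable (F i)) ->
  weakly_measurable (fun w => \sum_(i <- r) F i w).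
Proof.
move=> mF; elim: r => [|i r IHr].
  by under eq_fun do rewrite big_nil; exact: weakly_measurable_cst.
under eq_fun do rewrite big_cons; exact: weakly_measurableD.
Qed.

Lemma weakly_measurable_cvg (Z_ : nat -> Omega -> H) Z :
  (forall n, weakly_measurable (Z_ n)) ->
  (forall w, Z_ n w @[n --> \oo] --> Z w) -> weakly_measurable Z.
Proof.
move=> mZ_ ZZ u.
apply: (@measurable_fun_cvg _ _ _ _ (fun n w => inner (Z_ n w) u)).
  by move=> n; exact: mZ_.
by move=> w _; apply: cvg_inner => //; exact: cvg_cst.
Qed.

Lemma weakly_measurable_linear (T : {linear H -> H}) Z :
  bounded_operator T -> weakly_measurable Z -> weakly_measurable (T \o Z).
Proof.
move=> bT mZ u; have [u' Tu] := adjoint_vector u bT.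
by rewrite [X in measurable_fun _ X](_ : _ = fun w => inner (Z w) u')//;
  apply/funext => w /=.
Qed.

Hypothesis sepH : separable H.

Lemma dense_seq : exists q : nat -> H,
  forall (x : H) (e : R), 0 < e -> exists n, `|x - q n| < e.
Proof.
have [D cD dD] := sepH.
have D0 : D !=set0.
  have := dD setT; rewrite setTI; apply; [by exists 0|exact: openT].
have [q qD] : exists q : nat -> H, D `<=` range q.
  by have /pfcard_geP[|[q]] := cD; [move: D0 => /[swap] -> [] //|
    exists q => x Dx; have [n _ <-] := 'surj_q Dx; exists n].
exists q => x e e0.
have [||y [xy /qD[n _ qy]]] := dD (ball x e).
- by exists x; exact: ballxx.
- exact: ball_open.
- by exists n; rewrite qy; move: xy; rewrite -ball_normE.
Qed.

(** The norm is the supremum of <Z, q> / |q| over a dense sequence [q], so a superlevel set is a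
    countable union: one inclusion is Cauchy-Schwarz, the other takes [q n] close to [Z w]. *)
Lemma measurable_norm Z : weakly_measurable Z -> measurable_fun setT (fun w => `|Z w|).
Proof.
move=> mZ; have [q qd] := dense_seq.
apply: measurable_fun_superlevel => c.
have [c0|c0] := ltP c 0.
  rewrite (_ : [set w | _] = setT); first exact: measurableT.
  by apply/seteqP; split => w //= _; exact: lt_le_trans (normr_ge0 _).
rewrite (_ : [set w | _] =
    \bigcup_n [set w | c * `|q n| < inner (Z w) (q n)]); last first.
  apply/seteqP; split => w /=; last first.
    move=> [n _ /= cq]; have := lt_le_trans cq (le_trans (ler_norm _) (inner_le _ _)).
    have [->|q0] := eqVneq (q n) 0; first by rewrite normr0 !mulr0 ltxx.
    by rewrite ltr_pM2r// normr_gt0.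
  move=> cZ; have Z0 : 0 < `|Z w| by exact: le_lt_trans cZ.
  (* With p the distance from [Z w] to [q n], the claim follows from c (|Z| + p) < |Z|^2 - |Z| p;
     solving for p gives this threshold. *)
  pose e := `|Z w| * (`|Z w| - c) / (`|Z w| + c).
  have zc0 : 0 < `|Z w| + c by rewrite ltr_wpDr.
  have e0 : 0 < e by rewrite divr_gt0// mulr_gt0// subr_gt0.
  have [n Zn] := qd (Z w) e e0; exists n => //=.
  have -> : q n = Z w - (Z w - q n) by rewrite subKr.
  have := inner_le (Z w) (Z w - q n); rewrite ler_norml => /andP[_ h].
  apply: (@le_lt_trans _ _ (c * (`|Z w| + `|Z w - q n|))).
    by rewrite ler_wpM2l// ler_normB.
  rewrite innerBr inner_norm.
  have : (`|Z w| + c) * `|Z w - q n| < `|Z w| * (`|Z w| - c).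
    by rewrite mulrC -ltr_pdivlMr.
  move: h; set p := `|Z w - q n|; set a := `|Z w|; lra.
apply: bigcup_measurable => n _.
rewrite (_ : [set w | _] = (fun w => inner (Z w) (q n)) @^-1` `]c * `|q n|, +oo[).
  by rewrite -[X in measurable X]setTI; apply: mZ.
by apply/seteqP; split => w /=; rewrite in_itv/= andbT.
Qed.

(** By separability an open set is a countable union of balls with centres in the dense sequence and
    radii [k.+1%:R^-1]; the preimage of a ball is measurable by [measurable_norm]. *)
Lemma weakly_measurable_random_element Z : weakly_measurable Z -> random_element Z.
Proof.
move=> mZ; have [q qd] := dense_seq.
apply: (@measurability _ _ _ (borel H) setT Z (@open H)) => // _ [U oU <-].
rewrite setTI.
rewrite (_ : Z @^-1` U = \bigcup_p \bigcup_(k in [set k |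
    ball (q p) k.+1%:R^-1 `<=` U]) [set w | `|Z w - q p| < k.+1%:R^-1]).
  apply: bigcup_measurable => p _; apply: bigcup_measurable => k _.
  have mZq : measurable_fun setT (fun w => `|Z w - q p|).
    by apply: measurable_norm; apply: weakly_measurableB => //; exact: weakly_measurable_cst.
  rewrite (_ : [set w | _] = (fun w => `|Z w - q p|) @^-1` `]-oo, k.+1%:R^-1[).
    by rewrite -[X in measurable X]setTI; exact: mZq.
  by apply/seteqP; split => w /=; rewrite in_itv.
apply/seteqP; split => w /=; last first.
  move=> [p _ [k /= kU Zk]]; apply: kU.
  by rewrite -ball_normE /= distrC.
move=> UZ; have /nbhs_ballP[e /= e0 eU] : nbhs (Z w) U by exact: open_nbhs_nbhs.
have e20 : 0 < e / 2 by rewrite divr_gt0.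
have [k _ /(_ k (leqnn k))/= ke] := near_infty_natSinv_lt (PosNum e20).
have [p Zp] := qd (Z w) k.+1%:R^-1 (ltac:(by [])).
exists p => //; exists k => //= y; rewrite -ball_normE /= => qy.
apply: eU; rewrite -ball_normE /= (splitr e).
rewrite -(subrKA (q p)) (le_lt_trans (ler_normD _ _))//.
by apply: ltrD; [exact: lt_trans ke|exact: lt_trans ke].
Qed.

Lemma measurable_inner Z1 Z2 : weakly_measurable Z1 -> weakly_measurable Z2 ->
  measurable_fun setT (fun w => inner (Z1 w) (Z2 w)).
Proof.
move=> m1 m2.
rewrite [X in measurable_fun _ X](_ : _ = fun w =>
    2^-1 * (`|Z1 w + Z2 w| ^+ 2 - `|Z1 w| ^+ 2 - `|Z2 w| ^+ 2)); last first.
  by apply/funext => w; rewrite sqr_normD; field.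
apply: measurable_funM; first exact: measurable_cst.
apply: measurable_funB; [apply: measurable_funB|];
  apply: measurable_funX; apply: measurable_norm => //.
exact: weakly_measurableD.
Qed.

End weak_measurability.

(** * Measurability of the estimator *)

Section empirical_covariance.
Context {R : realType} (H : hilbertType R) d (Omega : measurableType d).
Variables (X : nat -> Omega -> H) (n : nat).

(** Splitting the factor 1/n evenly between the two arguments of each tensor makes [C_hat] a frame
    operator. *)
Definition scaled_sample (w : Omega) (i : 'I_n) : H :=
  (Num.sqrt n%:R)^-1 *: X i.+1 w.

Lemma C_hat_frame w y :
  C_hat X n w y = \sum_i inner (scaled_sample w i) y *: scaled_sample w i.
Proof.
rewrite /C_hat /Delta_hat big_add1/= big_mkord scaler_sumr; apply: eq_bigr => i _.
rewrite /tensor /scaled_sample innerZl !scalerA; congr (_ *: _).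
by rewrite mulrAC -expr2 exprVn sqr_sqrtr.
Qed.

Lemma scaled_sample_trace w :
  \sum_i `|scaled_sample w i| ^+ 2 = n%:R^-1 * \sum_(1 <= k < n.+1) `|X k w| ^+ 2.
Proof.
rewrite big_add1/= big_mkord mulr_sumr; apply: eq_bigr => i _.
by rewrite normrZ exprMn normfV ger0_norm ?sqrtr_ge0// exprVn sqr_sqrtr.
Qed.

Hypothesis sepH : separable H.
Hypothesis mX : forall k, (1 <= k)%N -> weakly_measurable (X k).

Lemma Delta_hat_measurable (Y : nat -> Omega -> H) Z :
  (forall k, (1 <= k)%N -> weakly_measurable (Y k)) ->
  weakly_measurable Z -> weakly_measurable (fun w => Delta_hat X Y n w (Z w)).
Proof.
move=> mY mZ; apply: weakly_measurableZ; first exact: measurable_cst.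
under eq_fun do rewrite big_add1.
apply: weakly_measurable_sum => k; apply: weakly_measurableZ; last exact: mY.
by apply: measurable_inner => //; exact: mX.
Qed.

Variables (lam : Omega -> nat -> R) (v : Omega -> nat -> H).
Hypothesis es : forall w, eigen_system (C_hat X n w) (lam w) (v w).

Let fr w := C_hat_frame w.

(** The top eigenvalue is the operator norm of [C_hat], hence a supremum over a dense sequence. The
    eigenvector is used only at a fixed [w], to see that the norm is attained. *)
Lemma top_eigenvalue_measurable : measurable_fun setT (fun w => lam w 1%N).
Proof.
have [q qd] := dense_seq sepH; apply: measurable_fun_superlevel => c.
have [c0|c0] := ltP c 0.
  rewrite (_ : [set w | _] = setT); first exact: measurableT.
  apply/seteqP; split => w //= _.
  by apply: (lt_le_trans c0); exact: (eigenvalue_ge0 (es w)).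
rewrite (_ : [set w | _] =
    \bigcup_p [set w | c * `|q p| < `|C_hat X n w (q p)|]); last first.
  apply/seteqP; split => w /=; last first.
    move=> [p _ /= cq].
    have := lt_le_trans cq (frame_norm_le (fr w) (es w) (q p)).
    have [->|q0] := eqVneq (q p) 0; first by rewrite normr0 !mulr0 ltxx.
    by rewrite ltr_pM2r// normr_gt0.
  move=> cl; have l0 : 0 < lam w 1%N by exact: le_lt_trans cl.
  have lc0 : 0 < lam w 1%N + c by rewrite ltr_wpDr.
  have e0 : 0 < (lam w 1%N - c) / (lam w 1%N + c) by rewrite divr_gt0// subr_gt0.
  have [p vp] := qd (v w 1%N) _ e0; exists p => //=.
  have v1 : `|v w 1%N| = 1.
    apply/eqP; rewrite -(@eqrXn2 _ 2)// expr1n -inner_norm.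
    by case: (es w) => ->.
  have -> : q p = v w 1%N - (v w 1%N - q p) by rewrite subKr.
  set z := v w 1%N - q p.
  apply: (@le_lt_trans _ _ (c * (1 + `|z|))).
    by rewrite ler_wpM2l// (le_trans (ler_normB _ _))// v1.
  apply: (@lt_le_trans _ _ (lam w 1%N - lam w 1%N * `|z|)).
    have : (lam w 1%N + c) * `|z| < lam w 1%N - c by rewrite mulrC -ltr_pdivlMr.
    lra.
  have -> : C_hat X n w (v w 1%N - z) = lam w 1%N *: v w 1%N - C_hat X n w z.
    rewrite -scaleN1r (frameD (fr w)) (frameZ (fr w)) scaleN1r.
    by case: (es w) => _ ->.
  apply: le_trans (lerB_dist _ _).
  rewrite normrZ v1 mulr1 ger0_norm; last exact: ltW.
  by rewrite lerB// (frame_norm_le (fr w) (es w)).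
apply: bigcup_measurable => p _.
have mq : measurable_fun setT (fun w => `|C_hat X n w (q p)|).
  apply: measurable_norm => //.
  by apply: (@Delta_hat_measurable X (fun=> q p)) => //; exact: weakly_measurable_cst.
rewrite (_ : [set w | _] = (fun w => `|C_hat X n w (q p)|) @^-1` `]c * `|q p|, +oo[).
  by rewrite -[X in measurable X]setTI; exact: mq.
by apply/seteqP; split => w /=; rewrite in_itv/= andbT.
Qed.

(* The eigenvectors are arbitrary functions of [w], possibly nonmeasurable. The
   estimator is measurable because it is a function of [C_hat] that pointwise limits
   of polynomials on the spectrum can reach. *)
Definition measurable_calculus (g : Omega -> R -> R) := forall Z,
  weakly_measurable Z ->
  weakly_measurable (fun w => spec n (lam w) (v w) (g w) (Z w)).

Definition in_spectrum w t := t = 0 \/ exists2 j, (1 <= j)%N & t = lam w j.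

Lemma in_spectrum_bounds w t : in_spectrum w t -> 0 <= t <= lam w 1%N.
Proof.
move=> [->|[j j1 ->]]; first by rewrite lexx (eigenvalue_ge0 (es w)).
by rewrite (eigenvalue_ge0 (es w))//= (eigenvalue_mono (es w)).
Qed.

Lemma calculus_cst a : measurable_fun setT a ->
  measurable_calculus (fun w => fun=> a w).
Proof.
move=> ma Z mZ; under eq_fun do rewrite spec_cst.
exact: weakly_measurableZ.
Qed.

Lemma calculus_id : measurable_calculus (fun=> id).
Proof.
move=> Z mZ; rewrite (_ : (fun w => _) = fun w => C_hat X n w (Z w)).
  exact: Delta_hat_measurable.
by apply/funext => w; rewrite (spec_id (fr w) (es w)).
Qed.

Lemma calculusD g h : measurable_calculus g -> measurable_calculus h ->
  measurable_calculus (fun w t => g w t + h w t).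
Proof.
move=> mg mh Z mZ; under eq_fun do rewrite spec_add.
by apply: weakly_measurableD; [exact: mg|exact: mh].
Qed.

Lemma calculusM g h : measurable_calculus g -> measurable_calculus h ->
  measurable_calculus (fun w t => g w t * h w t).
Proof.
move=> mg mh Z mZ.
rewrite (_ : (fun w => _) = fun w => spec n (lam w) (v w) (g w)
    (spec n (lam w) (v w) (h w) (Z w))); first exact/mg/mh.
by apply/funext => w; rewrite (spec_mul _ (es w)).
Qed.

Lemma calculusX g k : measurable_calculus g ->
  measurable_calculus (fun w t => g w t ^+ k).
Proof.
move=> mg; elim: k => [|k IHk].
  by apply: calculus_cst; exact: measurable_cst.
rewrite (_ : (fun w t => _) = fun w t => g w t * g w t ^+ k).
  exact: calculusM.
by apply/funext => w; apply/funext => t; rewrite exprS.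
Qed.

Lemma calculus_sum g k : (forall i : nat, measurable_calculus (g i)) ->
  measurable_calculus (fun w t => \sum_(0 <= i < k) g i w t).
Proof.
move=> mg; elim: k => [|k IHk].
  rewrite (_ : (fun w t => _) = fun _ _ => 0).
    by apply: calculus_cst; exact: measurable_cst.
  by apply/funext => w; apply/funext => t; rewrite big_geq.
rewrite (_ : (fun w t => _) = fun w t => \sum_(0 <= i < k) g i w t + g k w t).
  exact: calculusD.
by apply/funext => w; apply/funext => t; rewrite big_nat_recr.
Qed.

Lemma calculus_cvg (g_ : nat -> Omega -> R -> R) g :
  (forall k, measurable_calculus (g_ k)) ->
  (forall w t, in_spectrum w t -> g_ k w t @[k --> \oo] --> g w t) ->
  measurable_calculus g.
Proof.
move=> mg_ gg Z mZ.
apply: (@weakly_measurable_cvg _ _ _ _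
  (fun k w => spec n (lam w) (v w) (g_ k w) (Z w))); first by move=> k; exact: mg_.
by move=> w; apply: spec_cvg => t; exact: gg.
Qed.

(** Geometric series: on the spectrum [1 - b * g] lies in [[0, 1[], so the sums of
    [b * (1 - b * g) ^+ i] converge to the inverse of [g]. The scale [b] may vary with [w]. *)
Lemma calculusV (b : Omega -> R) g : measurable_fun setT b ->
  measurable_calculus g ->
  (forall w t, in_spectrum w t -> [/\ 0 < b w, 0 < g w t & b w * g w t <= 1]) ->
  measurable_calculus (fun w t => (g w t)^-1).
Proof.
move=> mb mg bg.
apply: (@calculus_cvg (fun k w t =>
  \sum_(0 <= i < k) b w * (1 + (- b w) * g w t) ^+ i)).
  move=> k; apply: calculus_sum => i; apply: calculusM; first exact: calculus_cst.
  apply: calculusX; apply: calculusD; first by apply: calculus_cst; exact: measurable_cst.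
  apply: calculusM => //; apply: calculus_cst.
  exact: measurable_funN.
move=> w t /bg[b0 g0 bg1].
have z1 : `|1 + - b w * g w t| < 1.
  have : 0 < b w * g w t by rewrite mulr_gt0.
  by move=> ?; rewrite ltr_norml; apply/andP; split; lra.
have := @cvg_geometric_series R (b w) _ z1.
have -> : b w * (1 - (1 + - b w * g w t))^-1 = (g w t)^-1.
  rewrite (_ : 1 - (1 + - b w * g w t) = b w * g w t); last by ring.
  by rewrite invfM mulrA divff ?mul1r// gt_eqF.
exact.
Qed.

Lemma measurable_inv (a : Omega -> R) : (forall w, 0 <= a w) ->
  measurable_fun setT a -> measurable_fun setT (fun w => (a w)^-1).
Proof.
move=> a0 ma; rewrite (_ : (fun w => _) = fun w => a w `^ (-1)).
  exact: (measurableT_comp (@measurable_powR R (-1)) ma).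
by apply/funext => w; rewrite powR_inv1.
Qed.

(** The cut-off is discontinuous in [t], so it is assembled from the indicator [J] of [r < 1]. For a
    positive top eigenvalue an eigenvalue is retained exactly when [r] is at least [1], and the
    target is (1 - J) / (t + J). *)
Lemma calculus_truncated_inverse (m : R) : 1 <= m ->
  measurable_calculus (fun w t => if lam w 1%N <= m * t then t^-1 else 0).
Proof.
move=> m1; have m0 : 0 < m by exact: lt_le_trans m1.
have l0 w : 0 <= lam w 1%N by exact: (eigenvalue_ge0 (es w)).
pose r w t := (lam w 1%N)^-1 * m * t.
have rb w t : in_spectrum w t -> 0 <= r w t <= m.
  move=> /in_spectrum_bounds/andP[t0 tl].
  rewrite /r !mulr_ge0 ?invr_ge0 ?(ltW m0)//=.
  have [->|l1] := eqVneq (lam w 1%N) 0; first by rewrite invr0 !mul0r ltW.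
  have lg : 0 < lam w 1%N by rewrite lt_neqAle eq_sym l1 l0.
  by rewrite -mulrA ler_pdivrMl// mulrC ler_wpM2r// ltW.
have mr : measurable_calculus r.
  apply: calculusM; last exact: calculus_id.
  apply: calculus_cst; apply: measurable_funM; last exact: measurable_cst.
  apply: measurable_inv => //; exact: top_eigenvalue_measurable.
(* [(1 + r ^ k)^-1] and then powers of its limit isolate the indicator of [r < 1]. *)
pose J1 w t : R := if r w t < 1 then 1 else if r w t == 1 then 2^-1 else 0.
have mJ1 : measurable_calculus J1.
  apply: (@calculus_cvg (fun k w t => (1 + r w t ^+ k)^-1)).
    move=> k; apply: (@calculusV (fun=> (1 + m ^+ k)^-1)); first exact: measurable_cst.
      apply: calculusD; first by apply: calculus_cst; exact: measurable_cst.
      exact: calculusX.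
    move=> w t /rb/andP[r0 rm].
    have rk0 : 0 <= r w t ^+ k by rewrite exprn_ge0.
    have mk0 : 0 <= m ^+ k by rewrite exprn_ge0// ltW.
    have rmk : r w t ^+ k <= m ^+ k by rewrite lerXn2r// nnegrE ltW.
    rewrite invr_gt0 !ltr_pwDl// mulrC ler_pdivrMr ?ltr_pwDl// mul1r.
    by split => //; rewrite lerD2l.
  move=> w t /rb/andP[r0 rm]; rewrite /J1; have [r1|r1|->] := ltgtP (r w t) 1.
  - rewrite -[X in _ --> X]invr1; apply: cvgV; first exact: oner_neq0.
    rewrite -[X in _ --> X]addr0; apply: cvgD; first exact: cvg_cst.
    by apply: cvg_expr; rewrite ger0_norm.
  - have ri : `|(r w t)^-1| < 1.
      by rewrite ger0_norm ?invr_ge0// invf_lt1// (lt_trans _ r1).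
    have r00 : r w t != 0 by rewrite gt_eqF// (lt_trans _ r1).
    rewrite (_ : (fun k => _) = fun k => (r w t)^-1 ^+ k * (1 + (r w t)^-1 ^+ k)^-1).
      rewrite -[X in _ --> X](mul0r (1 + 0)^-1); apply: cvgM; first exact: cvg_expr.
      apply: cvgV; first by rewrite addr0 oner_neq0.
      by apply: cvgD; [exact: cvg_cst|exact: cvg_expr].
    apply/funext => k; rewrite exprVn; have rk : r w t ^+ k > 0.
      by rewrite exprn_gt0// (lt_trans _ r1).
    by field; rewrite ?expf_neq0//= ?gt_eqF// ltr_wpDl// ltW.
  - rewrite (_ : (fun k => _) = fun=> 2^-1); first exact: cvg_cst.
    by apply/funext => k; rewrite expr1n.
pose J w t : R := if r w t < 1 then 1 else 0.
have mJ : measurable_calculus J.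
  apply: (@calculus_cvg (fun k w t => J1 w t ^+ k)).
    by move=> k; exact: calculusX.
  move=> w t _; rewrite /J1 /J; have [_|_|_] := ltgtP (r w t) 1.
  - by rewrite (_ : (fun k => _) = fun=> 1); [exact: cvg_cst|apply/funext => k; rewrite expr1n].
  - by apply: cvg_expr; rewrite normr0.
  - by apply: cvg_expr; rewrite ger0_norm ?invr_ge0// invf_lt1// ltr1n.
(* Adding [J] keeps the denominator positive on the spectrum, since [t = 0] gives [r = 0] and
   [J = 1]; it changes nothing where the factor 1 - J is nonzero. *)
have mV : measurable_calculus (fun w t => (t + J w t)^-1).
  apply: (@calculusV (fun w => (1 + lam w 1%N)^-1)).
  - apply: measurable_inv => [w|]; first by rewrite addr_ge0.
    apply: measurable_funD; first exact: measurable_cst.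
    exact: top_eigenvalue_measurable.
  - by apply: calculusD => //; exact: calculus_id.
  move=> w t ts; have /andP[t0 tl] := in_spectrum_bounds ts.
  have l1 : 0 < 1 + lam w 1%N by rewrite ltr_pwDl.
  have J01 : 0 <= J w t <= 1 by rewrite /J; case: ifP; rewrite ?lexx ?ler01.
  have tJ : 0 < t + J w t.
    rewrite /J; case: ifPn => [_|]; first by rewrite ltr_wpDl.
    rewrite addr0 -leNgt /r => r1; rewrite lt_neqAle t0 andbT.
    by apply/eqP => t00; move: r1; rewrite -t00 mulr0 ler10.
  rewrite invr_gt0 mulrC ler_pdivrMr// mul1r; split => //.
  by case/andP: J01; lra.
have mG : measurable_calculus (fun w t => (1 + -1 * J w t) * (t + J w t)^-1).
  apply: calculusM => //; apply: calculusD.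
    by apply: calculus_cst; exact: measurable_cst.
  by apply: calculusM => //; apply: calculus_cst; exact: measurable_cst.
apply: (@calculus_cvg (fun=> fun w t => (1 + -1 * J w t) * (t + J w t)^-1)) => //.
move=> w t ts; have /andP[t0 tl] := in_spectrum_bounds ts.
rewrite (_ : (fun k => _) = fun=> if lam w 1%N <= m * t then t^-1 else 0).
  exact: cvg_cst.
apply/funext => _; rewrite /J /r.
(* If the top eigenvalue is [0] then [t = 0]: the test [0 <= 0] succeeds, but [0^-1 = 0], in
   agreement with 1 - J = 0. *)
have [l1|l1] := eqVneq (lam w 1%N) 0.
  have -> : t = 0 by apply/eqP; rewrite eq_le t0 -l1 tl.
  by rewrite !mulr0 ltr01 l1 lexx invr0 mulr1 subrr mul0r.
have lg : 0 < lam w 1%N by rewrite lt_neqAle eq_sym l1 l0.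
rewrite -mulrA ltr_pdivrMl// mulr1 ltNge; case: (lam w 1%N <= m * t) => /=.
  by rewrite mulr0 !addr0 mul1r.
by rewrite mulr1 subrr mul0r.
Qed.

Lemma Psi_hat_Delta (Y : nat -> Omega -> H) w (lam' : nat -> R) (v' : nat -> H) K y :
  Psi_hat X Y n w lam' v' K y =
  Delta_hat X Y n w (\sum_(1 <= j < K.+1) ((lam' j)^-1 * inner (v' j) y) *: v' j).
Proof.
rewrite /Psi_hat /Delta_hat /tensor.
under [in RHS]eq_bigr do rewrite inner_sumr scaler_suml.
rewrite exchange_big/= scaler_sumr; apply: eq_bigr => j _.
set a := _ * inner _ _; rewrite scalerA (mulrC a) -scalerA; congr (_ *: _).
rewrite scaler_sumr; apply: eq_bigr => k _.
by rewrite innerZr scalerA.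
Qed.

Lemma Psi_hat_measurable (Y : nat -> Omega -> H) Z (m : R) : 1 <= m ->
  (forall k, (1 <= k)%N -> weakly_measurable (Y k)) ->
  weakly_measurable Z -> weakly_measurable (fun w =>
    Psi_hat X Y n w (lam w) (v w) (K_trunc (lam w) m) (Z w)).
Proof.
move=> m1 mY mZ; under eq_fun do rewrite Psi_hat_Delta.
apply: Delta_hat_measurable => //.
rewrite (_ : (fun w => _) = fun w => spec n (lam w) (v w)
   (fun t => if lam w 1%N <= m * t then t^-1 else 0) (Z w)).
  exact: calculus_truncated_inverse.
by apply/funext => w; rewrite (truncated_inverse (fr w) (es w)).
Qed.

End empirical_covariance.

(** * Laws of i.i.d. sequences *)

Section sequence_law.
Context dS (S : measurableType dS).

Lemma measurable_seqspace d (T : measurableType d) (z : T -> seqspace S) :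
  (forall i, measurable_fun setT (fun w => z w i)) -> measurable_fun setT z.
Proof.
move=> mz; apply: (@measurability _ _ _ (seqspace S) setT z (@cylinder _ S)) => //.
move=> _ [_ [i [B [mB ->]] <-]].
exact: (mz i measurableT B mB).
Qed.

Lemma measurable_coord (i : nat) :
  measurable_fun setT (fun s : seqspace S => s i).
Proof.
move=> _ B mB; rewrite setTI; apply: sub_sigma_algebra.
by exists i, B.
Qed.

(** A pi-system generating the product sigma-algebra. The sides are eventually the whole space, so
    that each rectangle is a finite intersection of coordinate events, to which independence
    applies. *)
Definition rectangles : set (set (seqspace S)) :=
  [set A | exists (N : nat) (B : nat -> set S),
    [/\ forall i, measurable (B i), forall i, (N <= i)%N -> B i = setT
      & A = [set s | forall i, B i (s i)]]].

Lemma rectangle_bigsetI N (B : nat -> set S) d (T : measurableType d)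
    (z : T -> seqspace S) : (forall i, (N <= i)%N -> B i = setT) ->
  z @^-1` [set s | forall i, B i (s i)] =
  \big[setI/setT]_(i <- iota 0 N) ((fun w => z w i) @^-1` B i).
Proof.
move=> BN; apply/seteqP; split => w /=.
  move=> zB; elim: (iota 0 N) => [|i r IHr]; first by rewrite big_nil.
  by rewrite big_cons; split => //; exact: zB.
move=> zB i; have [Ni|iN] := leqP N i; first by rewrite BN.
have : i \in iota 0 N by rewrite mem_iota.
elim: (iota 0 N) zB => // j r IHr; rewrite big_cons => -[zj zr].
by rewrite inE => /predU1P[->|/(IHr zr)].
Qed.

Lemma rectangles_setI : setI_closed rectangles.
Proof.
move=> _ _ [N1 [B1 [mB1 BN1 ->]]] [N2 [B2 [mB2 BN2 ->]]].
exists (maxn N1 N2), (fun i => B1 i `&` B2 i); split.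
- by move=> i; exact: measurableI.
- by move=> i; rewrite geq_max => /andP[i1 i2]; rewrite BN1// BN2// setIT.
- by apply/seteqP; split => s /= => [[s1 s2] i|s12]; [split|split => i; case: (s12 i)].
Qed.

Lemma rectangles_measurable : rectangles `<=` @measurable _ (seqspace S).
Proof.
move=> _ [N [B [mB BN ->]]].
rewrite (_ : [set s | _] = id @^-1` [set s : seqspace S | forall i, B i (s i)])//.
rewrite (@rectangle_bigsetI N B _ (seqspace S) id BN).
apply: bigsetI_measurable => i _; rewrite -[X in measurable X]setTI.
exact: measurable_coord.
Qed.

Lemma rectangles_generate : @measurable _ (seqspace S) = <<s rectangles >>.
Proof.
apply/seteqP; split; last first.
  apply: smallest_sub; last exact: rectangles_measurable.
  exact: sigma_algebra_measurable.
apply: smallest_sub; first exact: smallest_sigma_algebra.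
move=> _ [i [B [mB ->]]]; apply: sub_sigma_algebra.
exists i.+1, (fun j => if j == i then B else setT); split.
- by move=> j; case: ifP.
- by move=> j ij; rewrite gtn_eqF.
- apply/seteqP; split => s /= => [sB j|/(_ i)]; last by rewrite eqxx.
  by case: eqP => // ->.
Qed.

Section iid_uniqueness.
Context (R : realType) d1 (T1 : measurableType d1) (P1 : probability T1 R)
  d2 (T2 : measurableType d2) (P2 : probability T2 R).
Variables (z1 : nat -> T1 -> S) (z2 : nat -> T2 -> S).
Hypotheses (iid1 : iid P1 z1) (iid2 : iid P2 z2).
Hypothesis marginal : forall B, measurable B ->
  P1 (z1 0%N @^-1` B) = P2 (z2 0%N @^-1` B).

Let path1 w : seqspace S := fun i => z1 i w.
Let path2 w : seqspace S := fun i => z2 i w.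

Let mpath1 : measurable_fun setT path1.
Proof. by apply: measurable_seqspace => i; case: iid1 => m _ _; exact: m. Qed.

Let mpath2 : measurable_fun setT path2.
Proof. by apply: measurable_seqspace => i; case: iid2 => m _ _; exact: m. Qed.

(** On rectangles both laws are products of the common marginal; uniqueness of measures on a
    pi-system extends this. Stationarity, coupling and decoupling are all obtained from it through
    an injective choice of indices. *)
Lemma iid_law (A : set (seqspace S)) : measurable A ->
  P1 (path1 @^-1` A) = P2 (path2 @^-1` A).
Proof.
have [_ id1 ind1] := iid1; have [_ id2 ind2] := iid2.
pose f1 : {mfun T1 >-> seqspace S} :=
  HB.pack path1 (isMeasurableFun.Build _ _ _ _ path1 mpath1).
pose f2 : {mfun T2 >-> seqspace S} :=
  HB.pack path2 (isMeasurableFun.Build _ _ _ _ path2 mpath2).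
apply: (@measure_unique _ _ (seqspace S) rectangles (fun=> setT)
  rectangles_generate rectangles_setI _ _ (distribution P1 f1) (distribution P2 f2)) => //=.
- move=> _; exists 0%N, (fun=> setT); split => //.
  by apply/seteqP; split => s.
- by apply/seteqP; split => // s _; exists 0%N.
- move=> _ [N [B [mB BN ->]]]; rewrite /distribution /pushforward/=.
  rewrite (rectangle_bigsetI path1 BN) (rectangle_bigsetI path2 BN).
  rewrite ind1 ?iota_uniq// ind2 ?iota_uniq//.
  apply: eq_bigr => i _; rewrite (id1 _ 0%N)// marginal//.
  exact: id2.
- by move=> _; rewrite probability_setT ltry.
Qed.

Lemma iid_integral (F : seqspace S -> \bar R) : measurable_fun setT F ->
  (\int[P1]_w F (path1 w) = \int[P2]_w F (path2 w))%E.
Proof.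
have ge0 (G : seqspace S -> \bar R) : measurable_fun setT G ->
    (forall s, 0 <= G s)%E ->
    (\int[P1]_w G (path1 w) = \int[P2]_w G (path2 w))%E.
  move=> mG G0.
  have <- := @ge0_integral_pushforward _ _ _ _ R path1 mpath1 P1 setT G
    measurableT mG (fun s _ => G0 s).
  have <- := @ge0_integral_pushforward _ _ _ _ R path2 mpath2 P2 setT G
    measurableT mG (fun s _ => G0 s).
  apply: eq_measure_integral => A mA _; exact: iid_law.
move=> mF; rewrite integralE [RHS]integralE.
rewrite -[fun w => F (path1 w)]/(F \o path1) -[fun w => F (path2 w)]/(F \o path2).
rewrite (funepos_comp F path1) (funepos_comp F path2).
rewrite (funeneg_comp F path1) (funeneg_comp F path2).
congr (_ - _)%E; apply: ge0 => //; first exact: measurable_funepos.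
exact: measurable_funeneg.
Qed.

End iid_uniqueness.

Lemma iid_reindex (R : realType) d (T : measurableType d) (P : probability T R)
    (I J : eqType) (xi : I -> T -> S) (s : J -> I) :
  injective s -> iid P xi -> iid P (xi \o s).
Proof.
move=> sI [mxi idxi indxi]; split; first by move=> j; exact: mxi.
  by move=> i j B mB; exact: idxi.
move=> r B ur mB.
(* The events are transported along [s], with the whole space outside its range; injectivity makes
   [B' (s j)] equal to [B j]. *)
pose B' i := if pselect (exists j, s j = i) is left h then B (sval (cid h)) else setT.
have B'E j : B' (s j) = B j.
  rewrite /B'; case: pselect => [h|]; last by move=> []; exists j.
  by congr B; apply: sI; rewrite (svalP (cid h)).
have mB' i : measurable (B' i) by rewrite /B'; case: pselect.
have := @indxi (map s r) B'; rewrite map_inj_uniq// !big_map.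
under eq_bigr do rewrite B'E.
by under [in RHS]eq_bigr do rewrite B'E; exact.
Qed.

Section product_space.
Context (R : realType) d (T : measurableType d) (P : probability T R).
Variables (I : eqType) (xi : I -> T -> S).

(** The sequence and its independent copy form one i.i.d. family on the product space, so a coupled
    path is just another selection of indices. *)
Definition two_copies (k : bool * I) (w : T * T) : S :=
  xi k.2 (if k.1 then w.2 else w.1).

Hypothesis iidxi : iid P xi.

Let two_copies_preimage k (B : set S) :
  two_copies k @^-1` B =
  if k.1 then setT `*` (xi k.2 @^-1` B) else (xi k.2 @^-1` B) `*` setT.
Proof.
by case: k => [[] i]; apply/seteqP; split => -[w1 w2] //= [].
Qed.

Lemma two_copies_marginal k (B : set S) : measurable B ->
  ((P \x P)%E : probability (T * T)%type R) (two_copies k @^-1` B) =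
  P (xi k.2 @^-1` B).
Proof.
have [mxi _ _] := iidxi => mB; have mxB : measurable (xi k.2 @^-1` B).
  by rewrite -[X in measurable X]setTI; exact: mxi.
rewrite two_copies_preimage; case: k.1.
  by apply: etrans (product_measure1E _ _ _ _) _; rewrite //= probability_setT mul1e.
by apply: etrans (product_measure1E _ _ _ _) _; rewrite //= probability_setT mule1.
Qed.

Lemma iid_two_copies : iid (P \x P)%E two_copies.
Proof.
have [mxi idxi indxi] := iidxi; split.
- move=> [[] i]; rewrite /two_copies/=.
    by apply: measurableT_comp (mxi i) measurable_snd.
  by apply: measurableT_comp (mxi i) measurable_fst.
- by move=> i j B mB; rewrite !two_copies_marginal//; exact: idxi.
move=> r B ur mB.
pose r' b := [seq k.2 | k <- r & k.1 == b].
have ur' b : uniq (r' b).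
  rewrite map_inj_in_uniq ?filter_uniq// => -[b1 i1] [b2 i2].
  by rewrite !mem_filter/= => /andP[/eqP -> _] /andP[/eqP -> _] ->.
have -> : \big[setI/setT]_(k <- r) (two_copies k @^-1` B k) =
    (\big[setI/setT]_(i <- r' false) (xi i @^-1` B (false, i))) `*`
    (\big[setI/setT]_(i <- r' true) (xi i @^-1` B (true, i))).
  rewrite /r'; elim: (r) => [|[b i] r0 IHr]; first by rewrite !big_nil setXTT.
  rewrite big_cons IHr two_copies_preimage/=.
  by case: b => /=; rewrite big_cons -setXI ?setTI ?setIT.
apply: etrans (product_measure1E _ _ _ _) _.
- apply: bigsetI_measurable => i _; rewrite -[X in measurable X]setTI; exact: mxi.
- apply: bigsetI_measurable => i _; rewrite -[X in measurable X]setTI; exact: mxi.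
apply: etrans (congr2 mule
  (indxi _ (fun i => B (false, i)) (ur' false) (fun=> mB _))
  (indxi _ (fun i => B (true, i)) (ur' true) (fun=> mB _))) _.
under [RHS]eq_bigr do rewrite two_copies_marginal//.
rewrite /r' !big_map !big_filter [RHS](bigID (fun k => k.1 == false))/=.
congr (_ * _)%E; first by apply: eq_big => //= -[b i]/= /eqP ->.
by apply: eq_big => //= -[[] i].
Qed.

End product_space.

End sequence_law.

(** * Bounds on first moments *)

Section mean_bound.
Context d (T : measurableType d) (R : realType) (mu : {measure set T -> \bar R}).
Implicit Types (Z : T -> R) (q a : R).

(** Measurability and sign travel with the bound, so that moment estimates compose like real
    inequalities and yield integrability by domination. *)
Definition mean_le Z q :=
  [/\ measurable_fun setT Z, forall w, 0 <= Z w
    & (\int[mu]_w (Z w)%:E <= q%:E)%E].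

Lemma mean_leD Z1 Z2 q1 q2 : mean_le Z1 q1 -> mean_le Z2 q2 ->
  mean_le (fun w => Z1 w + Z2 w) (q1 + q2).
Proof.
move=> [m1 Z10 i1] [m2 Z20 i2]; split.
- exact: measurable_funD.
- by move=> w; rewrite addr_ge0.
under eq_integral do rewrite EFinD.
rewrite ge0_integralD//; last 4 first.
- by move=> w _; rewrite lee_fin.
- exact/measurable_EFinP.
- by move=> w _; rewrite lee_fin.
- exact/measurable_EFinP.
by rewrite EFinD leeD.
Qed.

Lemma mean_leZ a Z q : 0 <= a -> mean_le Z q -> mean_le (fun w => a * Z w) (a * q).
Proof.
move=> a0 [mZ Z0 iZ]; split.
- by apply: measurable_funM => //; exact: measurable_cst.
- by move=> w; rewrite mulr_ge0.
under eq_integral do rewrite EFinM.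
rewrite ge0_integralZl_EFin//; first by rewrite EFinM lee_wpmul2l// lee_fin.
  by move=> w _; rewrite lee_fin.
exact/measurable_EFinP.
Qed.

Lemma mean_le_mono Z Z' q : mean_le Z q -> measurable_fun setT Z' ->
  (forall w, 0 <= Z' w <= Z w) -> mean_le Z' q.
Proof.
move=> [mZ Z0 iZ] mZ' ZZ'; split => //; first by move=> w; case/andP: (ZZ' w).
apply: le_trans iZ; apply: ge0_le_integral => //.
- by move=> w _; rewrite lee_fin; case/andP: (ZZ' w).
- exact/measurable_EFinP.
- exact/measurable_EFinP.
- by move=> w _; rewrite lee_fin; case/andP: (ZZ' w).
Qed.

Lemma mean_le_weaken Z q q' : q <= q' -> mean_le Z q -> mean_le Z q'.
Proof. by move=> qq [mZ Z0 iZ]; split => //; rewrite (le_trans iZ)// lee_fin. Qed.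

Lemma mean_le_ge0 Z q : mean_le Z q -> 0 <= q.
Proof.
move=> [mZ Z0 iZ]; rewrite -lee_fin (le_trans _ iZ)//.
by apply: integral_ge0 => w _; rewrite lee_fin.
Qed.

Lemma mean_le_integrable Z Z' q : mean_le Z q -> measurable_fun setT Z' ->
  (forall w, `|Z' w| <= Z w) -> mu.-integrable setT (EFin \o Z').
Proof.
move=> [mZ Z0 iZ] mZ' ZZ'; apply/integrableP; split; first exact/measurable_EFinP.
apply: le_lt_trans (ltry q); apply: le_trans iZ; apply: ge0_le_integral => //.
- by apply: measurableT_comp => //; exact/measurable_EFinP.
- exact/measurable_EFinP.
- by move=> w _; rewrite /= lee_fin.
Qed.

End mean_bound.

Lemma mean_le_cst d (T : measurableType d) (R : realType) (P : probability T R) (a : R) :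
  0 <= a -> mean_le P (fun=> a) a.
Proof.
move=> a0; split => //.
by rewrite integral_cst//= probability_setT mule1.
Qed.

Lemma weakly_measurable_comp (R : realType) (H : hilbertType R) d1 d2
    (T1 : measurableType d1) (T2 : measurableType d2) (f : T2 -> H) (s : T1 -> T2) :
  weakly_measurable f -> measurable_fun setT s -> weakly_measurable (f \o s).
Proof. by move=> mf ms u; exact: (measurableT_comp (mf u) ms). Qed.

Section interleave.
Context (T : Type).

(** Packs two paths into one, so that the joint law of two paths follows from the law of a single
    i.i.d. sequence as soon as all the indices involved are distinct. *)
Definition interleave (a b : nat -> T) (i : nat) : T :=
  if odd i then b i./2 else a i./2.

Definition evens (z : nat -> T) (i : nat) := z i.*2.
Definition odds (z : nat -> T) (i : nat) := z i.*2.+1.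

Lemma evens_interleave a b : evens (interleave a b) = a.
Proof. by apply/funext => i; rewrite /evens /interleave odd_double doubleK. Qed.

Lemma odds_interleave a b : odds (interleave a b) = b.
Proof.
by apply/funext => i; rewrite /odds /interleave/= odd_double/= uphalf_double.
Qed.

Lemma interleave_inj a b : injective a -> injective b ->
  (forall i j, a i <> b j) -> injective (interleave a b).
Proof.
move=> ainj binj ab i j; rewrite /interleave.
case: ifP => oi; case: ifP => oj h.
- by rewrite -(odd_double_half i) -(odd_double_half j) oi oj (binj _ _ h).
- by have := ab _ _ (esym h).
- by have := ab _ _ h.
- by rewrite -(odd_double_half i) -(odd_double_half j) oi oj (ainj _ _ h).
Qed.

End interleave.

Section stationary_laws.
Context dS (S : measurableType dS) (R : realType) d (T : measurableType d).
Variables (P : probability T R) (delta : int -> T -> S).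
Hypothesis iid_delta : iid P delta.

Let PP : probability (T * T)%type R := (P \x P)%E.

Definition copies_path (s : nat -> bool * int) (w : T * T) : seqspace S :=
  fun i => two_copies delta (s i) w.

Let mdelta i : measurable_fun setT (delta i).
Proof. by case: iid_delta => m _ _; exact: m. Qed.

Lemma copies_path_measurable s : measurable_fun setT (copies_path s).
Proof.
apply: measurable_seqspace => i.
by case: (iid_two_copies iid_delta) => m _ _; exact: m.
Qed.

Lemma past_measurable n : measurable_fun setT (past delta n).
Proof. by apply: measurable_seqspace => i; exact: mdelta. Qed.

Lemma coupled_pastE n m :
  coupled_past delta n m = copies_path (fun i => ((m <= i)%N, n%:Z - i%:Z)).
Proof.
apply/funext => w; apply/funext => i.
by rewrite /coupled_past /copies_path /two_copies/= ltnNge; case: (leqP m i).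
Qed.

Lemma copies_law s t (F : seqspace S -> \bar R) : injective s -> injective t ->
  measurable_fun setT F ->
  (\int[PP]_w F (copies_path s w) = \int[PP]_w F (copies_path t w))%E.
Proof.
move=> sI tI mF.
apply: (iid_integral (iid_reindex sI (iid_two_copies iid_delta))
  (iid_reindex tI (iid_two_copies iid_delta)) _ mF) => B mB /=.
have [_ idx _] := iid_two_copies iid_delta; exact: idx.
Qed.

Let past_index_inj n : injective (fun i : nat => n%:Z - i%:Z).
Proof. by move=> i j; lia. Qed.

Lemma past_law n t (F : seqspace S -> \bar R) : injective t ->
  measurable_fun setT F ->
  (\int[P]_w F (past delta n w) = \int[PP]_w F (copies_path t w))%E.
Proof.
move=> tI mF.
apply: (iid_integral (iid_reindex (@past_index_inj n) iid_delta)
  (iid_reindex tI (iid_two_copies iid_delta)) _ mF) => B mB /=.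
rewrite two_copies_marginal//.
by have [_ idx _] := iid_delta; exact: idx.
Qed.

Lemma past_index_pair_inj b n : injective (fun i : nat => (b, n%:Z - i%:Z) : bool * int).
Proof. by move=> i j [] /past_index_inj. Qed.

Lemma coupled_index_inj n m :
  injective (fun i : nat => ((m <= i)%N, n%:Z - i%:Z) : bool * int).
Proof. by move=> i j [_] /past_index_inj. Qed.

Lemma past_stationary n m (F : seqspace S -> \bar R) : measurable_fun setT F ->
  (\int[P]_w F (past delta n w) = \int[P]_w F (past delta m w))%E.
Proof.
move=> mF; rewrite (past_law n (@past_index_pair_inj false 0) mF).
by rewrite (past_law m (@past_index_pair_inj false 0) mF).
Qed.

End stationary_laws.

(** * Sample second moments *)

(** The two truncated subtractions add up to |k - l|, and each lag occurs at most twice, once on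
    either side of [k]. *)
Lemma sum_dist_le (R : realDomainType) (c : nat -> R) (B : R) k n :
  (forall h, 0 <= c h) -> (forall N, \sum_(1 <= h < N) c h <= B) ->
  (1 <= k)%N -> (k <= n)%N ->
  \sum_(1 <= l < n.+1 | l != k) c ((k - l) + (l - k))%N <= B *+ 2.
Proof.
move=> c0 cB k1 kn.
rewrite (big_cat_nat (n := k))//= ?leqW// mulr2n lerD//.
  rewrite big_nat_rev/=.
  rewrite (_ : \sum_(_ <= _ < _ | _) _ = \sum_(1 <= h < k) c h)//.
  rewrite big_nat_cond [RHS]big_nat_cond; apply: eq_big => i.
    by rewrite /=; lia.
  by move=> /andP[/andP[i1 ik] _]; congr c; lia.
rewrite (@big_ltn_cond _ _ _ k)//= eqxx/=.
rewrite (_ : \sum_(_ <= _ < _ | _) _ = \sum_(1 <= h < (n.+1 - k)%N) c h)//.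
rewrite -[k.+1]add1n -[n.+1 in LHS](subnK (leqW kn)) big_addn addnK.
rewrite big_nat_cond [RHS]big_nat_cond; apply: eq_big => i.
  by rewrite /=; lia.
by move=> /andP[/andP[i1 ik] _]; congr c; lia.
Qed.

(** * Double sums of a degenerate kernel along a coupled process *)

Section degenerate_kernel.
Context dS (S : measurableType dS) (R : realType) (H : hilbertType R).
Context d (T : measurableType d) (P : probability T R) (delta : int -> T -> S).
Hypothesis sepH : separable H.
Hypothesis iid_delta : iid P delta.
Variables (f g : seqspace S -> H).
Hypotheses (mf : weakly_measurable f) (mg : weakly_measurable g).

Let PP : probability (T * T)%type R := (P \x P)%E.

(** By the arithmetic-geometric mean inequality, sums of this weight dominate products of at most
    four norms of [f] and [g]; [gap] measures the coupling error in the same power. *)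
Definition moment_weight s : R := 1 + `|f s| ^+ 4 + `|g s| ^+ 4.
Definition gap s t : R := `|f s - f t| ^+ 4 + `|g s - g t| ^+ 4.

Local Notation Q := moment_weight.

Lemma moment_weight_ge1 s : 1 <= Q s.
Proof. by rewrite /Q -addrA lerDl addr_ge0// exprn_ge0. Qed.

Lemma gap_ge0 s t : 0 <= gap s t.
Proof. by rewrite addr_ge0// exprn_ge0. Qed.

Lemma measurable_moment_weight d' (T' : measurableType d') (s : T' -> seqspace S) :
  measurable_fun setT s -> measurable_fun setT (fun w => Q (s w)).
Proof.
move=> ms; apply: measurable_funD; last first.
  by apply: measurable_funX; apply: measurable_norm => //; exact: (weakly_measurable_comp mg).
apply: measurable_funD; first exact: measurable_cst.
by apply: measurable_funX; apply: measurable_norm => //; exact: (weakly_measurable_comp mf).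
Qed.

Lemma measurable_gap d' (T' : measurableType d') (s t : T' -> seqspace S) :
  measurable_fun setT s -> measurable_fun setT t ->
  measurable_fun setT (fun w => gap (s w) (t w)).
Proof.
move=> ms mt; apply: measurable_funD; apply: measurable_funX;
  apply: measurable_norm => //; apply: weakly_measurableB.
- exact: (weakly_measurable_comp mf).
- exact: (weakly_measurable_comp mf).
- exact: (weakly_measurable_comp mg).
- exact: (weakly_measurable_comp mg).
Qed.

Variables (q B : R) (r : nat -> R).
Hypothesis Q_mean : mean_le P (fun w => Q (past delta 1 w)) q.
Hypothesis r_gt0 : forall h, 0 < r h.
Hypothesis gap_mean : forall h, (1 <= h)%N ->
  mean_le PP (fun w => gap (past delta h w.1) (coupled_past delta h h w))
    (2 * r h ^+ 4).
Hypothesis r_sum : forall N, \sum_(1 <= h < N) r h <= B.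

Variables (Phi : seqspace S -> seqspace S -> R) (A : R).
Hypothesis A_ge0 : 0 <= A.
Hypothesis mPhi : forall d' (T' : measurableType d') (s t : T' -> seqspace S),
  measurable_fun setT s -> measurable_fun setT t ->
  measurable_fun setT (fun w => Phi (s w) (t w)).
Hypothesis Phi_sym : forall s t, Phi s t = Phi t s.
Hypothesis Phi_le : forall s t, `|Phi s t| <= A * (Q s + Q t).
(** The free parameter [a] balances the weights against the coupling error; it will be set to [r h]
    at lag [h]. *)
Hypothesis Phi_diff : forall s t t' (a : R), 0 < a ->
  `|Phi s t - Phi s t'| <= A * a * (Q s + Q t + Q t' + (a ^+ 4)^-1 * gap t t').
Hypothesis Phi_degenerate : forall s,
  (\int[P]_w (Phi s (past delta 1 w))%:E = 0)%E.

Let Q_ge0 s : 0 <= Q s.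
Proof. by rewrite (le_trans _ (moment_weight_ge1 s)). Qed.

Let mQ : measurable_fun setT (fun s => (Q s)%:E).
Proof.
apply/measurable_EFinP.
exact: (@measurable_moment_weight _ (seqspace S) id (@measurable_id _ _ _)).
Qed.

Let Q_past n : mean_le P (fun w => Q (past delta n w)) q.
Proof.
split => //; first exact: (measurable_moment_weight (past_measurable iid_delta n)).
rewrite (past_stationary iid_delta n 1 mQ); by case: Q_mean.
Qed.

Let Q_copies t : injective t -> mean_le PP (fun w => Q (copies_path delta t w)) q.
Proof.
move=> tI; split => //.
  exact: (measurable_moment_weight (copies_path_measurable iid_delta t)).
rewrite -(past_law iid_delta 1 tI mQ); by case: Q_mean.
Qed.

Let mix h (z : seqspace S) : seqspace S :=
  fun i => if (i < h)%N then evens z i else odds z (i - h)%N.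

Let shift h (z : seqspace S) : seqspace S := fun i => z (i + h)%N.

Let m_evens : measurable_fun setT (@evens S : seqspace S -> seqspace S).
Proof. by apply: measurable_seqspace => i; exact: measurable_coord. Qed.

Let m_odds : measurable_fun setT (@odds S : seqspace S -> seqspace S).
Proof. by apply: measurable_seqspace => i; exact: measurable_coord. Qed.

Let m_mix h : measurable_fun setT (mix h).
Proof.
apply: measurable_seqspace => i; rewrite /mix.
by case: (i < h)%N; exact: measurable_coord.
Qed.

Let m_shift h : measurable_fun setT (shift h).
Proof. by apply: measurable_seqspace => i; exact: measurable_coord. Qed.

Let pI := past_index_pair_inj.

(** Shift invariance of the coupling error. Both paths are functions, [evens] and [mix h], of one
    injective selection of indices: the first copy up to time [k + h] and the second up to time [k].
    The law of the selection does not depend on [k]. *)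
Let gap_coupled k h : (1 <= h)%N ->
  mean_le PP (fun w => gap (past delta (k + h)%N w.1)
    (coupled_past delta (k + h)%N h w)) (2 * r h ^+ 4).
Proof.
move=> h1; pose s k0 := interleave (fun i : nat => (false, (k0 + h)%N%:Z - i%:Z))
  (fun i : nat => (true, k0%:Z - i%:Z)).
have sI k0 : injective (s k0) by apply: interleave_inj => //; exact: pI.
have pE k0 w : past delta (k0 + h)%N w.1 = evens (copies_path delta (s k0) w).
  apply/funext => i; rewrite /evens /copies_path.
  by rewrite -[s k0 i.*2]/(evens (s k0) i) evens_interleave.
have cE k0 w : coupled_past delta (k0 + h)%N h w = mix h (copies_path delta (s k0) w).
  apply/funext => i; rewrite /coupled_past /mix; case: ltnP => ih.
    rewrite /evens /copies_path.
    by rewrite -[s k0 i.*2]/(evens (s k0) i) evens_interleave.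
  rewrite /odds /copies_path.
  rewrite -[s k0 _.+1]/(odds (s k0) (i - h)%N) odds_interleave /two_copies/=.
  by congr delta; lia.
have mF : measurable_fun setT (fun z : seqspace S => (gap (evens z) (mix h z))%:E).
  apply/measurable_EFinP; apply: measurable_gap; [exact: m_evens|exact: m_mix].
split.
- apply: measurable_gap; last first.
    by rewrite coupled_pastE; exact: (copies_path_measurable iid_delta).
  exact: (measurableT_comp (past_measurable iid_delta _) measurable_fst).
- by move=> w; exact: gap_ge0.
have [_ _] := gap_mean h1.
under eq_integral => w _ do rewrite -[h in past delta h]add0n
  -[h in coupled_past delta h]add0n pE cE.
under [in X in _ -> X]eq_integral => w _ do rewrite pE cE.
by rewrite (copies_law iid_delta (sI 0%N) (sI k) mF).
Qed.

(* [past k] and [coupled_past (k + h) h] are independent, so degeneracy kills the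
   coupled integral and only the coupling error remains. *)
Let kernel_cov k h : (1 <= h)%N ->
  (`|\int[P]_w (Phi (past delta k w) (past delta (k + h)%N w))%:E|
   <= (A * (3 * q + 2) * r h)%:E)%E.
Proof.
move=> h1; set l := (k + h)%N.
pose s1 (w : T * T) := past delta k w.1.
pose t1 (w : T * T) := past delta l w.1.
pose t2 := coupled_past delta l h.
have s1E : s1 = copies_path delta (fun i => (false, k%:Z - i%:Z)) by [].
have t1E : t1 = copies_path delta (fun i => (false, l%:Z - i%:Z)) by [].
have t2E : t2 = copies_path delta (fun i => ((h <= i)%N, l%:Z - i%:Z)).
  exact: coupled_pastE.
have ms1 : measurable_fun setT s1 by rewrite s1E; exact: (copies_path_measurable iid_delta).
have mt1 : measurable_fun setT t1 by rewrite t1E; exact: (copies_path_measurable iid_delta).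
have mt2 : measurable_fun setT t2 by rewrite t2E; exact: (copies_path_measurable iid_delta).
have Qs1 : mean_le PP (fun w => Q (s1 w)) q by rewrite s1E; exact/Q_copies/pI.
have Qt1 : mean_le PP (fun w => Q (t1 w)) q by rewrite t1E; exact/Q_copies/pI.
have Qt2 : mean_le PP (fun w => Q (t2 w)) q.
  by rewrite t2E; exact/Q_copies/coupled_index_inj.
have i1 : PP.-integrable setT (EFin \o (fun w => Phi (s1 w) (t1 w))).
  apply: mean_le_integrable (mean_leZ A_ge0 (mean_leD Qs1 Qt1)) _ _; first exact: mPhi.
  by move=> w; exact: Phi_le.
have i2 : PP.-integrable setT (EFin \o (fun w => Phi (s1 w) (t2 w))).
  apply: mean_le_integrable (mean_leZ A_ge0 (mean_leD Qs1 Qt2)) _ _; first exact: mPhi.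
  by move=> w; exact: Phi_le.
have -> : (\int[P]_w (Phi (past delta k w) (past delta l w))%:E =
    \int[PP]_w (Phi (s1 w) (t1 w))%:E)%E.
  have mF : measurable_fun setT (fun z : seqspace S => (Phi (shift h z) z)%:E).
    apply/measurable_EFinP; apply: mPhi; [exact: m_shift|exact: measurable_id].
  have shE w : past delta k w = shift h (past delta l w).
    by apply/funext => i; rewrite /past /shift /l; congr delta; lia.
  apply: etrans (etrans _ (past_law iid_delta l (@pI false l) mF)) _.
    by apply: eq_integral => w _; rewrite shE.
  by apply: eq_integral => w _; rewrite /s1 shE.
have z2 : (\int[PP]_w (Phi (s1 w) (t2 w))%:E = 0)%E.
  pose a (i : nat) : bool * int := (false, k%:Z - i%:Z).
  pose b (i : nat) : bool * int := ((h <= i)%N, l%:Z - i%:Z).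
  pose b' (i : nat) : bool * int := (true, k%:Z - i%:Z).
  have mF : measurable_fun setT
      (fun z : seqspace S => (Phi (evens z) (odds z))%:E).
    apply/measurable_EFinP; apply: mPhi; [exact: m_evens|exact: m_odds].
  have evE (x y : nat -> bool * int) w :
      evens (copies_path delta (interleave x y) w) = copies_path delta x w.
    apply/funext => i; rewrite /evens /copies_path.
    by rewrite -[interleave x y _]/(evens (interleave x y) i) evens_interleave.
  have odE (x y : nat -> bool * int) w :
      odds (copies_path delta (interleave x y) w) = copies_path delta y w.
    apply/funext => i; rewrite /odds /copies_path.
    by rewrite -[interleave x y _]/(odds (interleave x y) i) odds_interleave.
  (* For [i < h] the coupled path reads the first copy at times after [k], which [a] never uses; for
     [h <= i] it reads the second copy. The pair thus has the same law as two paths taken from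
     separate copies ([b']), and Fubini's theorem applies. *)
  have I1 : injective (interleave a b).
    apply: interleave_inj; [exact: pI|exact: coupled_index_inj|].
    by move=> i j [] + ; rewrite /l; lia.
  have I2 : injective (interleave a b').
    by apply: interleave_inj => //; exact: pI.
  have := copies_law iid_delta I1 I2 mF.
  under eq_integral do rewrite evE odE.
  under [in X in _ = X -> _]eq_integral do rewrite evE odE.
  rewrite s1E t2E => ->.
  have i3 : (P \x P)%E.-integrable setT (EFin \o (fun w : T * T =>
      Phi (copies_path delta a w) (copies_path delta b' w))).
    rewrite -[(P \x P)%E]/(PP : set (T * T) -> \bar R).
    apply: mean_le_integrable (mean_leZ A_ge0
      (mean_leD (Q_copies (@pI false k)) (Q_copies (@pI true k)))) _ _.
      by apply: mPhi; exact: (copies_path_measurable iid_delta).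
    by move=> w; exact: Phi_le.
  rewrite -(integral12_prod_meas1 i3) /fubini_F.
  apply: integral0_eq => w1 _ /=.
  have mPs : measurable_fun setT (fun z : seqspace S => (Phi (past delta k w1) z)%:E).
    by apply/measurable_EFinP; apply: mPhi => //; exact: measurable_cst.
  rewrite -[RHS](Phi_degenerate (past delta k w1)).
  exact: (past_stationary iid_delta k 1 mPs).
have -> : (\int[PP]_w (Phi (s1 w) (t1 w))%:E =
    \int[PP]_w (Phi (s1 w) (t1 w) - Phi (s1 w) (t2 w))%:E)%E.
  under [RHS]eq_integral do rewrite EFinB.
  by rewrite integralB_EFin// z2 sube0.
apply: le_trans (le_abse_integral _ _ _) _ => //.
  by apply/measurable_EFinP; apply: measurable_funB; exact: mPhi.
have rh4 : 0 <= (r h ^+ 4)^-1 by rewrite invr_ge0 exprn_ge0// ltW.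
have Ar : 0 <= A * r h by rewrite mulr_ge0// ltW.
(* With [a = r h] in [Phi_diff] the weighted gap contributes [(r h ^+ 4)^-1 * (2 * r h ^+ 4) = 2]
   and the three weights contribute [3 * q], which leaves a bound linear in [r h]. *)
have G := mean_leZ Ar (mean_leD (mean_leD (mean_leD Qs1 Qt1) Qt2)
  (mean_leZ rh4 (gap_coupled k h1))).
have mdiff : measurable_fun setT (fun w => `|Phi (s1 w) (t1 w) - Phi (s1 w) (t2 w)|).
  apply: (measurableT_comp (@normr_measurable R setT)).
  by apply: measurable_funB; exact: mPhi.
have [|_ _ G3] := mean_le_mono G mdiff.
  by move=> w; rewrite normr_ge0/=; exact: Phi_diff.
apply: le_trans G3 _; rewrite lee_fin le_eqVlt; apply/orP; left; apply/eqP.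
by field; rewrite gt_eqF.
Qed.

(** Each row has one diagonal term, bounded by twice the mean weight, and off-diagonal terms bounded
    by [r] at their lag, which sum to at most [B *+ 2]. The rows are therefore bounded uniformly and
    the double sum is linear in [n]. *)
Lemma degenerate_kernel_sum n :
  (\int[P]_w (\sum_(1 <= k < n.+1) \sum_(1 <= l < n.+1)
     Phi (past delta k w) (past delta l w))%:E
   <= ((A * (q *+ 2) + A * (3 * q + 2) * (B *+ 2)) * n%:R)%:E)%E.
Proof.
have q0 := mean_le_ge0 Q_mean.
have c0 : 0 <= A * (3 * q + 2) by rewrite mulr_ge0// addr_ge0// mulr_ge0.
have int k l : P.-integrable setT
    (EFin \o (fun w => Phi (past delta k w) (past delta l w))).
  apply: mean_le_integrable (mean_leZ A_ge0 (mean_leD (Q_past k) (Q_past l))) _ _.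
    by apply: mPhi; exact: (past_measurable iid_delta).
  by move=> w; exact: Phi_le.
pose b k l : R := if l == k then A * (q *+ 2)
  else A * (3 * q + 2) * r ((k - l) + (l - k))%N.
have intb k l :
    (\int[P]_w (Phi (past delta k w) (past delta l w))%:E <= (b k l)%:E)%E.
  have cov k0 l0 : (k0 < l0)%N ->
      (\int[P]_w (Phi (past delta k0 w) (past delta l0 w))%:E
        <= (A * (3 * q + 2) * r (l0 - k0)%N)%:E)%E.
    move=> kl; have := @kernel_cov k0 (l0 - k0)%N; rewrite subnKC ?(ltnW kl)// subn_gt0.
    by move=> /(_ kl); apply: le_trans; exact: lee_abs.
  rewrite /b; have [kl|lk|->] := ltngtP k l.
  - by rewrite (eqP (ltnW kl)) add0n; exact: cov.
  - under eq_integral do rewrite Phi_sym.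
    by rewrite (eqP (ltnW lk)) addn0; exact: cov.
  - have [_ _] := mean_leZ A_ge0 (mean_leD (Q_past l) (Q_past l)).
    rewrite mulr2n; apply: le_trans; apply: le_integral => //; first exact: int.
      have QQ := mean_leZ A_ge0 (mean_leD (Q_past l) (Q_past l)).
      case: (QQ) => mQQ QQ0 _; apply: (mean_le_integrable QQ mQQ) => w.
      by rewrite ger0_norm//; exact: QQ0.
    by move=> w _; rewrite lee_fin (le_trans (ler_norm _))// Phi_le.
have -> : (\int[P]_w (\sum_(1 <= k < n.+1) \sum_(1 <= l < n.+1)
     Phi (past delta k w) (past delta l w))%:E =
   \sum_(1 <= k < n.+1) \sum_(1 <= l < n.+1)
     \int[P]_w (Phi (past delta k w) (past delta l w))%:E)%E.
  under eq_integral => w _.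
    rewrite -sumEFin; under eq_bigr do rewrite -sumEFin.
    over.
  rewrite integral_sum//; last first.
    by move=> k; apply: integrable_sum => // l _; exact: int.
  by apply: eq_bigr => k _; rewrite integral_sum// => l; exact: int.
apply: (@le_trans _ _ (\sum_(1 <= k < n.+1) \sum_(1 <= l < n.+1) (b k l)%:E)%E).
  by apply: lee_sum => k _; apply: lee_sum.
under eq_bigr do rewrite sumEFin.
rewrite sumEFin lee_fin.
apply: (@le_trans _ _ (\sum_(1 <= k < n.+1)
    (A * (q *+ 2) + A * (3 * q + 2) * (B *+ 2)))); last first.
  by rewrite sumr_const_nat subn1/= mulr_natr.
rewrite big_nat [leRHS]big_nat; apply: ler_sum => k /andP[k1 kn].
rewrite (bigD1_seq k) ?iota_uniq ?mem_index_iota ?k1//= lerD//.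
  by rewrite /b eqxx.
apply: (@le_trans _ _ (\sum_(1 <= l < n.+1 | l != k)
    A * (3 * q + 2) * r ((k - l) + (l - k))%N)).
  by apply: ler_sum => l /negPf lk; rewrite /b lk.
rewrite -mulr_sumr ler_wpM2l//; apply: sum_dist_le => // h; exact: ltW.
Qed.

End degenerate_kernel.

Lemma mean_le_markov d (T : measurableType d) (R : realType) (P : probability T R)
    (Z : T -> R) (q a : R) :
  mean_le P Z q -> 0 < a -> (P [set w | (a < Z w)%R] <= (q / a)%:E)%E.
Proof.
move=> [mZ Z0 iZ] a0.
have mZa : measurable [set w | a < Z w].
  rewrite (_ : [set w | _] = Z @^-1` `]a, +oo[).
    by rewrite -[X in measurable X]setTI; exact: mZ.
  by apply/seteqP; split => w /=; rewrite in_itv/= andbT.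
rewrite mulrC EFinM lee_pdivlMl//; apply: le_trans iZ.
rewrite -[X in P X]setIT -integral_indic//.
have mI : measurable_fun setT (fun w => (\1_[set w | (a < Z w)%R] w)%:E : \bar R).
  by apply/measurable_EFinP; exact: measurable_indic.
rewrite -(ge0_integralZl_EFin P measurableT _ mI (ltW a0)) => [|w _]; last first.
  by rewrite lee_fin.
apply: ge0_le_integral => //.
- by move=> w _; rewrite -EFinM lee_fin mulr_ge0// ltW.
- by apply: emeasurable_funM => //; exact: measurable_cst.
- exact/measurable_EFinP.
move=> w _; rewrite -EFinM lee_fin indicE; case: (boolP (w \in _)) => [|_].
  by rewrite inE/= mulr1 => /ltW.
by rewrite mulr0.
Qed.

Section amgm.
Context (R : realFieldType).
Implicit Types a b c e r : R.

Lemma amgm4 a b c e : a * b * c * e <= (a ^+ 4 + b ^+ 4 + c ^+ 4 + e ^+ 4) / 4.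
Proof.
have h1 := sqr_ge0 (a * b - c * e).
have h2 := sqr_ge0 (a ^+ 2 - b ^+ 2).
have h3 := sqr_ge0 (c ^+ 2 - e ^+ 2).
rewrite ler_pdivlMr//; nra.
Qed.

(** [amgm4] with [c / r] in place of [c]: the small factor [c] is rescaled to unit size and the gain
    [r] is kept in front. *)
Lemma young4 r a b c e : 0 < r ->
  a * b * c * e <= r * (a ^+ 4 + b ^+ 4 + (r ^+ 4)^-1 * c ^+ 4 + e ^+ 4) / 4.
Proof.
move=> r0; have := amgm4 a b (c / r) e.
rewrite -(ler_pM2l r0) exprMn exprVn.
rewrite (_ : r * (a * b * (c / r) * e) = a * b * c * e); last first.
  by field; rewrite gt_eqF.
by move=> /le_trans; apply; rewrite mulrA (mulrC (c ^+ 4)).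
Qed.

End amgm.

(** * Cross-covariance and covariance as degenerate kernels *)

Section covariance_kernels.
Context dS (S : measurableType dS) (R : realType) (H : hilbertType R).
Context d (T : measurableType d) (P : probability T R) (delta : int -> T -> S).
Hypothesis sepH : separable H.
Hypothesis iid_delta : iid P delta.
Variables (f g : seqspace S -> H).
Hypotheses (mf : weakly_measurable f) (mg : weakly_measurable g).

Let PP : probability (T * T)%type R := (P \x P)%E.

Variables (q B : R) (r : nat -> R).
Hypothesis Q_mean : mean_le P (fun w => moment_weight f g (past delta 1 w)) q.
Hypothesis r_gt0 : forall h, 0 < r h.
Hypothesis gap_mean : forall h, (1 <= h)%N ->
  mean_le PP (fun w => gap f g (past delta h w.1) (coupled_past delta h h w))
    (2 * r h ^+ 4).
Hypothesis r_sum : forall N, \sum_(1 <= h < N) r h <= B.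

Let mfs d' (T' : measurableType d') (s : T' -> seqspace S) :
  measurable_fun setT s -> weakly_measurable (f \o s).
Proof. exact: weakly_measurable_comp. Qed.

Let mgs d' (T' : measurableType d') (s : T' -> seqspace S) :
  measurable_fun setT s -> weakly_measurable (g \o s).
Proof. exact: weakly_measurable_comp. Qed.

(** The kernel is <f s, f t> <g s, g t>. Integrating out [t] with [s] fixed gives the hypothesis at
    [u = f s] and [v = g s], so orthogonality of regressor and error is its degeneracy. *)
Lemma gram_trace_mean :
  (forall u v, (\int[P]_w (inner (f (past delta 1 w)) u *
                          inner (g (past delta 1 w)) v)%:E = 0)%E) ->
  exists K : R, forall n, mean_le P (fun w => gram_trace (index_iota 1 n.+1)
    (fun k => f (past delta k w)) (fun k => g (past delta k w))) (K * n%:R).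
Proof.
move=> orth.
pose Phi s t := inner (f s) (f t) * inner (g s) (g t).
have mPhi d' (T' : measurableType d') (s t : T' -> seqspace S) :
    measurable_fun setT s -> measurable_fun setT t ->
    measurable_fun setT (fun w => Phi (s w) (t w)).
  move=> ms mt; apply: measurable_funM; apply: measurable_inner => //.
  - exact: mfs.
  - exact: mfs.
  - exact: mgs.
  - exact: mgs.
have Q0 s : 0 <= `|f s| ^+ 4 /\ 0 <= `|g s| ^+ 4.
  by split; rewrite exprn_ge0.
have Phib s t t' : `|inner (f s) t * inner (g s) t'| <= `|f s| * `|t| * (`|g s| * `|t'|).
  by rewrite normrM ler_pM//; exact: inner_le.
have h := @degenerate_kernel_sum _ S R H _ T P delta sepH iid_delta f g mf mg
  q B r Q_mean r_gt0 gap_mean r_sum Phi 1 ler01 mPhi.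
exists (1 * (q *+ 2) + 1 * (3 * q + 2) * (B *+ 2)) => n; split.
- rewrite /gram_trace; apply: measurable_sum => k; apply: measurable_sum => l.
  by apply: mPhi; exact: (past_measurable iid_delta).
- by move=> w; exact: gram_trace_ge0.
apply: h.
- by move=> s t; rewrite /Phi (innerC (f s)) (innerC (g s)).
- move=> s t; apply: le_trans (Phib _ _ _) _.
  have := amgm4 `|f s| `|f t| `|g s| `|g t|; rewrite /moment_weight.
  have := Q0 s; have := Q0 t; lra.
- move=> s t t' a a0.
  have -> : Phi s t - Phi s t' = inner (f s) (f t - f t') * inner (g s) (g t)
      + inner (f s) (f t') * inner (g s) (g t - g t').
    by rewrite /Phi !innerBr; ring.
  apply: le_trans (ler_normD _ _) _.
  apply: le_trans (lerD (Phib _ _ _) (Phib _ _ _)) _.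
  have := @young4 _ a `|f s| `|g s| `|f t - f t'| `|g t| a0.
  have := @young4 _ a `|f s| `|g s| `|g t - g t'| `|f t'| a0.
  rewrite /moment_weight /gap.
  have [fs gs] := Q0 s; have [ft gt] := Q0 t; have [ft' gt'] := Q0 t'.
  set c1 := `|f t - f t'|; set c2 := `|g t - g t'|.
  have a40 : 0 <= (a ^+ 4)^-1 by rewrite invr_ge0 exprn_ge0// ltW.
  have c10 : 0 <= (a ^+ 4)^-1 * c1 ^+ 4.
    by apply: mulr_ge0 => //; apply: exprn_ge0; exact: normr_ge0.
  have c20 : 0 <= (a ^+ 4)^-1 * c2 ^+ 4.
    by apply: mulr_ge0 => //; apply: exprn_ge0; exact: normr_ge0.
  move: c10 c20; rewrite !(mulrDr (a ^+ 4)^-1).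
  set e1 := (a ^+ 4)^-1 * c1 ^+ 4; set e2 := (a ^+ 4)^-1 * c2 ^+ 4.
  move=> c10 c20 y2 y1.
  rewrite [leLHS](_ : _ = `|f s| * `|g s| * c1 * `|g t| + `|f s| * `|g s| * c2 * `|f t'|);
    last by ring.
  apply: le_trans (lerD y1 y2) _.
  rewrite -mulrDl -mulrDr mul1r -!mulrA ler_wpM2l ?(ltW a0)//.
  lra.
- move=> s; have := orth (f s) (g s); apply: etrans.
  by apply: eq_integral => w _; rewrite /Phi (innerC (f s)) (innerC (g s)).
Qed.

(** The kernel is the inner product of the centred vectors <f, z> f - mu, degenerate because [mu] is
    their mean. The bias is examined at finitely many [z], so a bound for fixed [z] suffices. *)
Lemma covariance_mean (z mu : H) :
  (forall u, (\int[P]_w (inner (f (past delta 1 w)) z *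
                         inner (f (past delta 1 w)) u)%:E = (inner mu u)%:E)%E) ->
  exists K : R, forall n, mean_le P (fun w =>
    `|\sum_(1 <= k < n.+1) (inner (f (past delta k w)) z *: f (past delta k w) - mu)|
      ^+ 2) (K * n%:R).
Proof.
move=> muE.
pose phi s := inner (f s) z *: f s.
pose Phi s t := inner (phi s - mu) (phi t - mu).
(* One constant for both the size bound [phib] and the Lipschitz-type bound [phid], so that the
   kernel constant is [K ^+ 2]. *)
pose K := `|z| + `|mu|.
have K0 : 0 <= K by rewrite addr_ge0.
have mphi d' (T' : measurableType d') (s : T' -> seqspace S) :
    measurable_fun setT s -> weakly_measurable (fun w => phi (s w) - mu).
  move=> ms; apply: weakly_measurableB; last exact: weakly_measurable_cst.
  by apply: weakly_measurableZ; [apply: (mfs ms)|exact: mfs].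
have mPhi d' (T' : measurableType d') (s t : T' -> seqspace S) :
    measurable_fun setT s -> measurable_fun setT t ->
    measurable_fun setT (fun w => Phi (s w) (t w)).
  by move=> ms mt; apply: measurable_inner => //; exact: mphi.
have Q0 s : 0 <= `|f s| ^+ 4 /\ 0 <= `|g s| ^+ 4.
  by split; rewrite exprn_ge0.
have phib s : `|phi s - mu| <= K * (`|f s| ^+ 2 + 1).
  apply: le_trans (ler_normB _ _) _.
  have : `|phi s| <= `|z| * `|f s| ^+ 2.
    rewrite /phi normrZ expr2 mulrA ler_wpM2r// mulrC; exact: inner_le.
  have := mulr_ge0 (normr_ge0 mu) (sqr_ge0 `|f s|).
  have := normr_ge0 z; rewrite /K; lra.
have phid s t : `|phi s - phi t| <= K * (`|f s - f t| * (`|f s| + `|f t|)).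
  have -> : phi s - phi t = inner (f s - f t) z *: f s + inner (f t) z *: (f s - f t).
    by rewrite /phi innerBl scalerBr scalerBl addrA subrK.
  apply: le_trans (ler_normD _ _) _; rewrite !normrZ.
  have h1 : `|inner (f s - f t) z| * `|f s| <= `|f s - f t| * `|z| * `|f s|.
    by rewrite ler_wpM2r//; exact: inner_le.
  have h2 : `|inner (f t) z| * `|f s - f t| <= `|f t| * `|z| * `|f s - f t|.
    by rewrite ler_wpM2r//; exact: inner_le.
  have h3 : 0 <= `|mu| * (`|f s - f t| * (`|f s| + `|f t|)).
    by rewrite !mulr_ge0// addr_ge0.
  rewrite /K; lra.
have h := @degenerate_kernel_sum _ S R H _ T P delta sepH iid_delta f g mf mg
  q B r Q_mean r_gt0 gap_mean r_sum Phi (K ^+ 2) (sqr_ge0 K) mPhi.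
exists (K ^+ 2 * (q *+ 2) + K ^+ 2 * (3 * q + 2) * (B *+ 2)) => n; split.
- apply: measurable_funX; apply: measurable_norm => //.
  apply: weakly_measurable_sum => k.
  exact: (mphi _ _ _ (past_measurable iid_delta k)).
- by move=> w; rewrite sqr_ge0.
under eq_integral.
  move=> w _; rewrite -inner_norm inner_suml; under eq_bigr do rewrite inner_sumr.
  over.
apply: h.
- by move=> s t; rewrite /Phi innerC.
- move=> s t; apply: le_trans (inner_le _ _) _.
  apply: le_trans (ler_pM _ _ (phib s) (phib t)) _ => //.
  rewrite mulrACA -expr2 ler_wpM2l ?sqr_ge0// /moment_weight.
  have := sqr_ge0 (`|f s| ^+ 2 - `|f t| ^+ 2).
  have := sqr_ge0 (`|f s| ^+ 2 - 1); have := sqr_ge0 (`|f t| ^+ 2 - 1).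
  have := Q0 s; have := Q0 t; nra.
- move=> s t t' a a0; rewrite /Phi -innerBr.
  have -> : phi t - mu - (phi t' - mu) = phi t - phi t' by rewrite opprB addrA subrK.
  apply: le_trans (inner_le _ _) _.
  apply: le_trans (ler_pM _ _ (phib s) (phid t t')) _ => //.
  rewrite mulrACA -expr2 -[leRHS]mulrA ler_wpM2l ?sqr_ge0//.
  set c := `|f t - f t'|; set x := `|f s|; set b := `|f t|; set b' := `|f t'|.
  have y1 := @young4 _ a x x c b a0; have y2 := @young4 _ a x x c b' a0.
  have y3 := @young4 _ a 1 1 c b a0; have y4 := @young4 _ a 1 1 c b' a0.
  rewrite [leLHS](_ : _ = x * x * c * b + x * x * c * b' + 1 * 1 * c * b + 1 * 1 * c * b');
    last by ring.
  apply: le_trans (lerD (lerD (lerD y1 y2) y3) y4) _.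
  rewrite -!mulrDl -!mulrDr -mulrA ler_wpM2l ?(ltW a0)//.
  rewrite /moment_weight /gap mulrDr -/c -/x -/b -/b'.
  have [fs gs] := Q0 s; have [ft gt] := Q0 t; have [ft' gt'] := Q0 t'.
  have e0 : 0 <= (a ^+ 4)^-1 * `|g t - g t'| ^+ 4.
    have a40 : 0 <= (a ^+ 4)^-1 by rewrite invr_ge0 exprn_ge0// ltW.
    by apply: mulr_ge0 => //; apply: exprn_ge0; exact: normr_ge0.
  by rewrite /x /b /b' in fs ft ft' *; lra.
- move=> s; set y := phi s - mu.
  have int : P.-integrable setT (EFin \o (fun w =>
      inner (f (past delta 1 w)) z * inner (f (past delta 1 w)) y)).
    have zy0 : 0 <= `|z| * `|y| by rewrite mulr_ge0.
    have m1 := mfs (past_measurable iid_delta 1).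
    apply: (mean_le_integrable (mean_leZ zy0 Q_mean)).
      by apply: measurable_funM; [exact: (m1 z)|exact: (m1 y)].
    move=> w; set x := f _; rewrite normrM.
    apply: le_trans (ler_pM _ _ (inner_le _ _) (inner_le _ _)) _ => //.
    rewrite mulrACA mulrC ler_wpM2l// /moment_weight -/x -expr2.
    have := sqr_ge0 (`|x| ^+ 2 - 1); have := Q0 (past delta 1 w); rewrite -/x.
    by nra.
  transitivity (\int[P]_w ((inner (f (past delta 1 w)) z *
      inner (f (past delta 1 w)) y)%:E - (inner mu y)%:E))%E.
    apply: eq_integral => w _; rewrite -EFinB /Phi -/y innerBr.
    by rewrite /phi innerZr (innerC y) (innerC y).
  rewrite (integralB_EFin (f2 := fun=> inner mu y))//; last first.
    exact: finite_measure_integrable_cst.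
  rewrite muE (integral_cst P measurableT (inner mu y)%:E)/=.
  by rewrite probability_setT mule1 subee.
Qed.

End covariance_kernels.

Section moments.
Context (R : realType) (H : hilbertType R) d (T : measurableType d)
  (mu : {measure set T -> \bar R}).
Implicit Types Z : T -> H.

Lemma nu_ge0 p Z : (0 <= nu mu p Z)%E.
Proof. exact: Lnorm_ge0. Qed.

Lemma nu_pow n Z : (0 < n)%N ->
  (nu mu n%:R Z `^ n%:R = \int[mu]_w (`|Z w| ^+ n)%:E)%E.
Proof.
move=> n0; rewrite /nu poweR_Lnorm ?pnatr_eq0 -?lt0n//.
apply: eq_integral => w _.
by rewrite abse_EFin normr_id poweR_EFin powR_mulrn.
Qed.

Lemma nu_le_mean n Z r : (0 < n)%N -> measurable_fun setT (fun w => `|Z w|) ->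
  (nu mu n%:R Z <= r%:E)%E -> mean_le mu (fun w => `|Z w| ^+ n) (r ^+ n).
Proof.
move=> n0 mZ nur; have r0 : 0 <= r by rewrite -lee_fin (le_trans (nu_ge0 _ _) nur).
split; [exact: measurable_funX|by move=> w; rewrite exprn_ge0|].
rewrite -nu_pow// -powR_mulrn// -poweR_EFin.
apply: gt0_ler_poweR nur => //.
  by rewrite in_itv/= leey nu_ge0.
by rewrite in_itv/= leey lee_fin r0.
Qed.

Lemma mean_le_nu n Z r : (0 < n)%N -> 0 <= r ->
  mean_le mu (fun w => `|Z w| ^+ n) (r ^+ n) -> (nu mu n%:R Z <= r%:E)%E.
Proof.
move=> n0 r0 [_ _ iZ].
have n0' : (n%:R : R) != 0 by rewrite pnatr_eq0 -lt0n.
have nuE : (nu mu n%:R Z = (nu mu n%:R Z `^ n%:R) `^ n%:R^-1)%E.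
  by rewrite -poweRrM mulfV// poweRe1// nu_ge0.
have rE : (r%:E = (r ^+ n)%:E `^ n%:R^-1)%E.
  by rewrite -powR_mulrn// -poweR_EFin -poweRrM mulfV// poweRe1// lee_fin.
rewrite nuE nu_pow// rE; apply: gt0_ler_poweR iZ.
- by rewrite invr_ge0.
- rewrite in_itv/= leey andbT; apply: integral_ge0 => w _.
  by rewrite lee_fin exprn_ge0.
- by rewrite in_itv/= leey andbT lee_fin exprn_ge0.
Qed.

End moments.

Lemma mean_le_ae d (T : measurableType d) (R : realType)
    (mu : {measure set T -> \bar R}) (Z Z' : T -> R) q :
  mean_le mu Z q -> measurable_fun setT Z' -> (forall w, 0 <= Z' w) ->
  {ae mu, forall w, Z w = Z' w} -> mean_le mu Z' q.
Proof.
move=> [mZ Z0 iZ] mZ' Z'0 ae; split => //.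
rewrite (ae_eq_integral (fun w => (Z w)%:E))//.
- exact/measurable_EFinP.
- exact/measurable_EFinP.
- by apply: filterS ae => w -> _.
Qed.

Lemma ae_fst d1 d2 (T1 : measurableType d1) (T2 : measurableType d2) (R : realType)
    (P1 : probability T1 R) (P2 : probability T2 R) (A : T1 -> Prop) :
  {ae P1, forall w, A w} -> {ae (P1 \x P2)%E, forall w, A w.1}.
Proof.
move=> [N [mN PN NA]]; exists (N `*` setT); split.
- exact: measurableX.
- apply: etrans (product_measure1E _ _ mN measurableT) _.
  by apply: etrans (congr1 (fun t => t * P2 setT)%E PN) _; exact: mul0e.
- by move=> w /= Aw; split => //; exact: NA.
Qed.

Lemma sum_half_le1 (R : realFieldType) N : \sum_(1 <= h < N) 2^-1 ^+ h <= 1 :> R.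
Proof.
case: N => [|N]; first by rewrite big_geq.
suff -> : \sum_(1 <= h < N.+1) 2^-1 ^+ h = 1 - 2^-1 ^+ N :> R.
  by rewrite gerBl exprn_ge0// invr_ge0.
elim: N => [|N IHN]; first by rewrite big_geq// subrr.
by rewrite big_nat_recr//= IHN exprS; field.
Qed.

(** * Constants extracted from approximability *)

Section approximable.
Context dS (S : measurableType dS) (R : realType) (H : hilbertType R).
Context d (T : measurableType d) (P : probability T R) (delta : int -> T -> S).
Hypothesis sepH : separable H.
Variables (f g : seqspace S -> H) (X e : nat -> T -> H).
Hypothesis apX : Lp_m_approximable P 4 delta f X.
Hypothesis ape : Lp_m_approximable P 4 delta g e.

Let PP : probability (T * T)%type R := (P \x P)%E.

Let rho (h : seqspace S -> H) (Z : nat -> T -> H) m : \bar R :=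
  nu PP 4 (fun w => Z m w.1 - h (coupled_past delta m m w)).

Let approximable_gap (h : seqspace S -> H) (Z : nat -> T -> H) :
  Lp_m_approximable P 4 delta h Z -> exists (rr : nat -> R) (B : R),
  [/\ forall m, 0 <= rr m, forall N, \sum_(1 <= m < N) rr m <= B
    & forall m, (1 <= m)%N -> mean_le PP
       (fun w => `|h (past delta m w.1) - h (coupled_past delta m m w)| ^+ 4)
       (rr m ^+ 4)].
Proof.
move=> [LZ iid_delta mh Zh sumZ].
have mh' := random_element_weakly mh.
have rho0 m : (0 <= rho h Z m)%E by exact: nu_ge0.
have rhoS N : (\sum_(1 <= m < N) rho h Z m <= \sum_(1 <= m <oo) rho h Z m)%E.
  exact: nneseries_lim_ge.
have Sfin : (\sum_(1 <= m <oo) rho h Z m)%E \is a fin_num.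
  by rewrite ge0_fin_numE// nneseries_ge0.
have rhofin m : (1 <= m)%N -> rho h Z m \is a fin_num.
  move=> m1; rewrite ge0_fin_numE//; apply: le_lt_trans sumZ.
  apply: le_trans (rhoS m.+1); rewrite big_nat_recr//=.
  by rewrite leeDr// sume_ge0.
exists (fun m => fine (rho h Z m)), (fine (\sum_(1 <= m <oo) rho h Z m)%E); split.
- by move=> m; rewrite fine_ge0.
- move=> N; rewrite -lee_fin fineK// -sumEFin.
  rewrite (eq_big_nat _ _ (F2 := fun m => rho h Z m))//.
  by move=> m /andP[m1 _]; rewrite fineK// rhofin.
move=> m m1.
have mc : weakly_measurable (fun w => h (coupled_past delta m m w)).
  apply: (weakly_measurable_comp mh'); rewrite coupled_pastE.
  exact: (copies_path_measurable iid_delta).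
have mZ : weakly_measurable (fun w : T * T => Z m w.1).
  have [/random_element_weakly mZm _] := LZ m m1.
  exact: (weakly_measurable_comp mZm measurable_fst).
have := @nu_le_mean _ _ _ _ PP 4 (fun w => Z m w.1 - h (coupled_past delta m m w))
  (fine (rho h Z m)) isT.
move=> /(_ (measurable_norm sepH (weakly_measurableB mZ mc))).
rewrite fineK ?rhofin// => /(_ (lexx _)) mean4.
apply: mean_le_ae mean4 _ _ _.
- apply: measurable_funX; apply: measurable_norm => //.
  apply: weakly_measurableB => //; apply: (weakly_measurable_comp mh').
  exact: (measurableT_comp (past_measurable iid_delta _) measurable_fst).
- by move=> w; rewrite exprn_ge0.
- by apply: filterS (ae_fst P (Zh m m1)) => w ->.
Qed.

Let approximable_moment (h : seqspace S -> H) (Z : nat -> T -> H) :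
  Lp_m_approximable P 4 delta h Z ->
  exists q : R, mean_le P (fun w => `|h (past delta 1 w)| ^+ 4) q.
Proof.
move=> [LZ iid_delta mh Zh _]; have [/random_element_weakly mZ nuZ] := LZ 1%N isT.
have fin : nu P 4 (Z 1%N) \is a fin_num by rewrite ge0_fin_numE// nu_ge0.
exists (fine (nu P 4 (Z 1%N)) ^+ 4).
have := @nu_le_mean _ _ _ _ P 4 (Z 1%N) (fine (nu P 4 (Z 1%N))) isT
  (measurable_norm sepH mZ).
rewrite fineK// => /(_ (lexx _)) mean4.
apply: mean_le_ae mean4 _ _ _.
- apply: measurable_funX; apply: measurable_norm => //.
  apply: (weakly_measurable_comp (random_element_weakly mh)).
  exact: (past_measurable iid_delta).
- by move=> w; rewrite exprn_ge0.
- by apply: filterS (Zh 1%N isT) => w ->.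
Qed.

Lemma approximable_bounds : exists (q B : R) (r : nat -> R),
  [/\ mean_le P (fun w => moment_weight f g (past delta 1 w)) q,
      forall h, 0 < r h,
      forall h, (1 <= h)%N ->
        mean_le PP (fun w => gap f g (past delta h w.1) (coupled_past delta h h w))
          (2 * r h ^+ 4)
    & forall N, \sum_(1 <= h < N) r h <= B].
Proof.
have [r1 [B1 [r10 B1r gap1]]] := approximable_gap apX.
have [r2 [B2 [r20 B2r gap2]]] := approximable_gap ape.
have [q1 Q1] := approximable_moment apX; have [q2 Q2] := approximable_moment ape.
(* The geometric term makes [r] strictly positive, as required to divide by [r h ^+ 4], and keeps it
   summable. Each of [r1 h] and [r2 h] is at most [r h], hence the factor [2] in the gap bound. *)
pose r h := r1 h + r2 h + 2^-1 ^+ h.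
exists (1 + q1 + q2), (B1 + B2 + 1), r; split.
- exact: mean_leD (mean_leD (mean_le_cst _ ler01) Q1) Q2.
- by move=> h; rewrite /r ltr_wpDl ?addr_ge0// exprn_gt0// invr_gt0.
- move=> h h1; apply: mean_le_weaken (mean_leD (gap1 h h1) (gap2 h h1)).
  have p0 : 0 <= 2^-1 ^+ h :> R by rewrite exprn_ge0// invr_ge0.
  rewrite mulr_natl mulr2n lerD// lerXn2r ?nnegrE ?addr_ge0// /r.
    by rewrite -addrA lerDl addr_ge0.
  by rewrite (addrC (r1 h)) -addrA lerDl addr_ge0.
- move=> N; rewrite /r !big_split/= !lerD//.
  exact: sum_half_le1.
Qed.

End approximable.

(** * Consistency *)

Section estimation_error.
Context {R : realType} (H : hilbertType R) d (Omega : measurableType d).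
Variables (Psi : {linear H -> H}) (X Y e : nat -> Omega -> H) (n : nat) (w : Omega).
Variables (lam : nat -> R) (v : nat -> H) (m : R).
Hypothesis es : eigen_system (C_hat X n w) lam v.
Hypothesis m1 : 1 <= m.
Hypothesis lam1 : 0 < lam 1%N.

Let K := K_trunc lam m.
Let fr := @C_hat_frame _ _ _ _ X n w.

(** The residual of [x] is telescoped through a net point [p], a vector [c] (later [C z]) and its
    empirical counterpart. The residual map is a contraction on the three differences, and on the
    range of [C_hat] it gains the first discarded eigenvalue. *)
Lemma projection_error x p c z :
  `|x - eigen_proj v K x| <=
  `|x - p| + `|p - c| + `|c - C_hat X n w z| + lam 1%N / m * `|z|.
Proof.
pose D y := y - eigen_proj v K y.
have DB y t : D (y - t) = D y - D t.
  rewrite /D eigen_projB !opprB addrACA [RHS]addrACA; congr (_ + _).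
  exact: addrC.
have pe y : `|D y| <= `|y| := eigen_proj_error_le es K y.
rewrite -/(D x) (_ : D x = D (x - p) + D (p - c) + D (c - C_hat X n w z)
   + D (C_hat X n w z)); last by rewrite !DB !subrKA subrK.
apply: le_trans (ler_normD _ _) _; apply: lerD; last first.
  apply: le_trans (tail_le fr es K z) _.
  by have [_ lK _] := K_truncP fr es m1 lam1; rewrite ler_wpM2r.
apply: le_trans (ler_normD _ _) _; apply: lerD; last exact: pe.
by apply: le_trans (ler_normD _ _) _; apply: lerD; exact: pe.
Qed.

Hypothesis Psi_le : forall y, `|Psi y| <= `|y|.
Hypothesis model : forall k, (1 <= k)%N -> Y k w = Psi (X k w) + e k w.

Lemma Delta_hat_model y :
  Delta_hat X Y n w y = Psi (C_hat X n w y) + Delta_hat X e n w y.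
Proof.
rewrite /C_hat /Delta_hat linearZ/= -scalerDr; congr (_ *: _).
rewrite (linear_sum Psi) -big_split/= big_nat [RHS]big_nat; apply: eq_bigr => k /andP[k1 _].
by rewrite /tensor model// linearZ/= scalerDr.
Qed.

(** Uniformity in [y] matters: the bound is applied to a vector computed from the whole sample. *)
Lemma Delta_hat_le y : `|Delta_hat X e n w y| <=
  n%:R^-1 * Num.sqrt (gram_trace (index_iota 1 n.+1) (X^~ w) (e^~ w)) * `|y|.
Proof.
rewrite /Delta_hat normrZ ger0_norm ?invr_ge0// -mulrA ler_wpM2l ?invr_ge0//.
rewrite -(@ler_pXn2r _ 2) ?nnegrE ?mulr_ge0 ?sqrtr_ge0//.
rewrite exprMn sqr_sqrtr ?gram_trace_ge0// mulrC.
exact: operator_le_gram_trace.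
Qed.

Lemma Psi_hat_error x :
  `|Psi x - Psi_hat X Y n w lam v K x| <= `|x - eigen_proj v K x|
  + n%:R^-1 * Num.sqrt (gram_trace (index_iota 1 n.+1) (X^~ w) (e^~ w))
    * (m / lam 1%N * `|x|).
Proof.
rewrite Psi_hat_Delta Delta_hat_model (truncated_inverse_apply fr es)//.
rewrite opprD addrA -linearB; apply: le_trans (ler_normB _ _) _.
rewrite lerD//; apply: le_trans (Delta_hat_le _) _.
rewrite ler_wpM2l ?mulr_ge0 ?invr_ge0 ?sqrtr_ge0//.
exact: (truncated_inverse_norm fr es).
Qed.

End estimation_error.

Lemma cvg0_measure d (T : measurableType d) (R : realType) (P : probability T R)
    (A : nat -> set T) :
  (forall ep : R, 0 < ep -> \forall n \near \oo, (P (A n) <= ep%:E)%E) ->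
  P (A n) @[n --> \oo] --> 0%E.
Proof.
move=> PA; apply/fine_cvgP; split.
  have := PA 1 ltr01; apply: filterS => n PAn.
  by rewrite ge0_fin_numE// (le_lt_trans PAn)// ltry.
apply/cvgrPdist_le => ep ep0; have := PA ep ep0; apply: filterS => n PAn /=.
have PAf : P (A n) \is a fin_num by rewrite ge0_fin_numE// (le_lt_trans PAn)// ltry.
by rewrite sub0r normrN ger0_norm ?fine_ge0// -lee_fin fineK.
Qed.

(** By density the sets of points at distance at least [a] from the first [L] centres decrease to
    the empty set. The exceptional set is a Borel set of [H] and not only an event, so that
    stationarity carries the bound from [X 1] to every [X n] with the same [L]. *)
Lemma tightness (R : realType) (H : hilbertType R) d (T : measurableType d)
    (P : probability T R) (Z : T -> H) (q : nat -> H) (a ep : R) :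
  separable H ->
  (forall (x : H) (r : R), 0 < r -> exists n, `|x - q n| < r) ->
  weakly_measurable Z -> 0 < a -> 0 < ep -> exists L,
    measurable [set x : borel H | forall i, (i < L)%N -> a <= `|(x : H) - q i|] /\
      (P (Z @^-1` [set x : borel H | forall i, (i < L)%N -> (a <= `|(x : H) - q i|)%R])
      <= ep%:E)%E.
Proof.
move=> sepH qd mZ a0 ep0.
pose F L := [set x : borel H | forall i, (i < L)%N -> a <= `|(x : H) - q i|].
have mF L : measurable (F L).
  rewrite /F (_ : [set x | _] = \bigcap_(i in [set i | (i < L)%N])
    [set x : borel H | a <= `|(x : H) - q i|])//.
  apply: bigcap_measurableType => i _.
  have mn : measurable_fun setT (fun x : borel H => `|(x : H) - q i|).
    apply: (measurable_norm sepH); apply: weakly_measurableB.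
      exact/random_element_weakly/measurable_id.
    exact: weakly_measurable_cst.
  rewrite (_ : [set x | _] = (fun x : borel H => `|(x : H) - q i|) @^-1` `[a, +oo[).
    by rewrite -[X in measurable X]setTI; exact: mn.
  by apply/seteqP; split => x /=; rewrite in_itv/= andbT.
have mZF L : measurable (Z @^-1` F L).
  rewrite -[X in measurable X]setTI.
  exact: (weakly_measurable_random_element sepH mZ).
have F0 : \bigcap_L (Z @^-1` F L) = set0.
  apply/seteqP; split => // w /= Fw; have [k Zq] := qd (Z w) a a0.
  have := Fw k.+1 I k (ltnSn k); rewrite leNgt.
  by rewrite Zq.
have : P (Z @^-1` F L) @[L --> \oo] --> P (\bigcap_L (Z @^-1` F L)).
  apply: nonincreasing_cvg_mu => //.
  - by rewrite (le_lt_trans (probability_le1 _ _))// ltry.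
  - by rewrite F0.
  - move=> i j ij; apply/subsetPset => w /= Fw k ki; apply: Fw.
    exact: leq_trans ki ij.
rewrite F0 measure0 => /fine_cvgP[Ffin /cvgrPdist_le/(_ _ ep0)].
move=> /(filterI Ffin)[L _ /(_ L (leqnn L))[/= Lfin]].
rewrite sub0r normrN ger0_norm ?fine_ge0// -lee_fin fineK// => PL.
by exists L; split => //; exact: mF.
Qed.

Lemma opnorm_le (R : realType) (H : hilbertType R) (T : {linear H -> H}) y :
  bounded_operator T -> `|T y| <= opnorm T * `|y|.
Proof.
move=> [M TM]; have [->|y0] := eqVneq y 0; first by rewrite linear0 !normr0 mulr0.
have yg : 0 < `|y| by rewrite normr_gt0.
rewrite -ler_pdivrMr// mulrC -[X in X * _]ger0_norm ?invr_ge0// -normrZ -linearZ/=.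
apply: ub_le_sup.
  exists `|M| => _ [x /= x1 <-]; apply: le_trans (TM x) _.
  by rewrite (le_trans (ler_norm _))// normrM normr_id ler_piMr.
exists (`|y|^-1 *: y) => //=.
by rewrite normrZ normfV normr_id mulVf// gt_eqF.
Qed.

Lemma opnorm_ge0 (R : realType) (H : hilbertType R) (T : {linear H -> H}) :
  bounded_operator T -> 0 <= opnorm T.
Proof.
move=> [M TM]; apply: (@le_trans _ _ `|T 0|) => //; apply: ub_le_sup.
  exists `|M| => _ [x /= x1 <-]; apply: le_trans (TM x) _.
  by rewrite (le_trans (ler_norm _))// normrM normr_id ler_piMr.
by exists 0 => //=; rewrite normr0.
Qed.

(** With density of the range of [C], this yields some [z0] with [C z0 != 0], hence a positive lower
    bound on the top empirical eigenvalue. *)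
Lemma infinite_dimensional_neq0 (R : realType) (H : hilbertType R) :
  infinite_dimensional H -> exists x : H, x != 0.
Proof.
move=> infH; apply: contrapT => H0; apply: infH; exists [::] => x.
exists (fun=> 0); rewrite big_ord0; apply/eqP/negPn/negP => x0.
by apply: H0; exists x.
Qed.

Lemma dense_range (R : realType) (H : hilbertType R) (C : H -> H) :
  closure (range C) = setT -> forall (x : H) (a : R), 0 < a ->
  exists z, `|x - C z| < a.
Proof.
move=> imC x a a0; have : closure (range C) x by rewrite imC.
move=> /(_ _ (nbhsx_ballx x a a0))[_ [[z _ <-]]].
by rewrite -ball_normE => /= xz; exists z.
Qed.

Section consistency.
Context (R : realType) (H : hilbertType R) d (Omega : measurableType d).
Variables (P : probability Omega R) (Psi : {linear H -> H}).
Variables (X Y e : nat -> Omega -> H) (C : H -> H).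
Hypothesis sepH : separable H.
Hypothesis infH : infinite_dimensional H.
Hypothesis Psi_bounded : bounded_operator Psi.
Hypothesis Psi_le1 : opnorm Psi <= 1.
Hypothesis mX : forall n, (1 <= n)%N -> random_element (X n).
Hypothesis mY : forall n, (1 <= n)%N -> random_element (Y n).
Hypothesis statX : stationary P X.
Hypothesis CE : is_mean_tensor P (X 1%N) (X 1%N) C.
Hypothesis imC : closure (range C) = setT.
Hypothesis assA : assumptionA P Psi X Y e.

Let mXw n : (1 <= n)%N -> weakly_measurable (X n).
Proof. by move=> /mX/random_element_weakly. Qed.

Let mYw n : (1 <= n)%N -> weakly_measurable (Y n).
Proof. by move=> /mY/random_element_weakly. Qed.

Let ae_integral (F G : Omega -> R) : measurable_fun setT F -> measurable_fun setT G ->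
  {ae P, forall w, F w = G w} ->
  (\int[P]_w (F w)%:E = \int[P]_w (G w)%:E)%E.
Proof.
move=> mF mG FG; apply: ae_eq_integral => //.
- exact/measurable_EFinP.
- exact/measurable_EFinP.
- by apply: filterS FG => w -> _.
Qed.

(* [X'] and [e'] are the functions of the innovations that represent [X] and [e]
   almost surely: the couplings need versions defined on every path. *)
Lemma sample_bounds : exists (X' e' : nat -> Omega -> H) (q Kg : R) (Kc : H -> R),
  [/\ {ae P, forall w k, (1 <= k)%N ->
         [/\ X k w = X' k w, e k w = e' k w & Y k w = Psi (X k w) + e k w]},
      forall k, weakly_measurable (X' k),
      forall k, mean_le P (fun w => `|X' k w| ^+ 2) q,
      forall n, mean_le P (fun w => gram_trace (index_iota 1 n.+1)
        (X'^~ w) (e'^~ w)) (Kg * n%:R)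
    & forall z n, (1 <= n)%N -> mean_le P (fun w => `|C_hat X' n w z - C z| ^+ 2)
        (Kc z / n%:R)].
Proof.
have [_ YE _ [d' [S [delta [f [g [apX ape]]]]]] [_ orthA]] := assA.
have [LX iid_delta /random_element_weakly mf Xf _] := apX.
have [Le _ /random_element_weakly mg eg _] := ape.
have [q [B [r [Qm r0 gapm rsum]]]] := approximable_bounds sepH apX ape.
have mp k := past_measurable iid_delta k.
have mfp k : weakly_measurable (fun w => f (past delta k w)).
  exact: (weakly_measurable_comp mf (mp k)).
have mgp k : weakly_measurable (fun w => g (past delta k w)).
  exact: (weakly_measurable_comp mg (mp k)).
have [Kg Kg_le] : exists K : R, forall n, mean_le P (fun w =>
    gram_trace (index_iota 1 n.+1) (fun k => f (past delta k w))
      (fun k => g (past delta k w))) (K * n%:R).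
  apply: (gram_trace_mean sepH iid_delta mf mg Qm r0 gapm rsum) => u v.
  have := orthA 1%N isT u v; rewrite inner0l unlock => h.
  apply: etrans h; apply: ae_integral.
  - by apply: measurable_funM; [exact: mfp|exact: mgp].
  - rewrite /tensor; under eq_fun do rewrite innerZl.
    apply: measurable_funM; first exact: mXw.
    by have [/random_element_weakly me _] := Le 1%N isT; exact: me.
  - apply: filterS2 (Xf 1%N isT) (eg 1%N isT) => w -> ->.
    by rewrite /tensor innerZl.
have /choice[Kc Kc_le] : forall z, exists K : R, forall n, mean_le P (fun w =>
    `|\sum_(1 <= k < n.+1) (inner (f (past delta k w)) z *: f (past delta k w) - C z)|
      ^+ 2) (K * n%:R).
  move=> z; apply: (covariance_mean sepH iid_delta mf mg Qm r0 gapm rsum) => u.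
  have := CE z u; rewrite unlock => h.
  apply: etrans h; apply: ae_integral.
  - by apply: measurable_funM; exact: mfp.
  - rewrite /tensor; under eq_fun do rewrite innerZl.
    by apply: measurable_funM; exact: mXw.
  - by apply: filterS (Xf 1%N isT) => w ->; rewrite /tensor innerZl.
exists (fun k w => f (past delta k w)), (fun k w => g (past delta k w)), q, Kg, Kc.
split => //.
- apply: ae_foralln => k; case: k => [|k].
    by apply: (@filterS _ _ _ setT); [move=> w _|exact: filterT].
  apply: filterS3 (Xf k.+1 isT) (eg k.+1 isT) (YE k.+1 isT) => w hX he hY _.
  by split.
- move=> k; have mQ : measurable_fun setT (fun s => (moment_weight f g s)%:E).
    apply/measurable_EFinP.
    exact: (measurable_moment_weight sepH mf mg (@measurable_id _ _ _)).
  have Qk : mean_le P (fun w => moment_weight f g (past delta k w)) q.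
    case: Qm => _ _ iQ; split.
    - exact: (measurable_moment_weight sepH mf mg (mp k)).
    - by move=> w; exact: le_trans (moment_weight_ge1 _ _ _).
    - by rewrite (past_stationary iid_delta k 1 mQ).
  apply: mean_le_mono Qk _ _.
    by apply: measurable_funX; exact: measurable_norm.
  move=> w; rewrite sqr_ge0/= /moment_weight.
  have : 0 <= `|g (past delta k w)| ^+ 4 by rewrite exprn_ge0.
  by have := sqr_ge0 (`|f (past delta k w)| ^+ 2 - 1); nra.
- move=> z n n1; have n0 : (n%:R : R) != 0 by rewrite pnatr_eq0 -lt0n.
  have n20 : 0 <= (n%:R : R) ^- 2 by rewrite invr_ge0 exprn_ge0.
  have := mean_leZ n20 (Kc_le z n).
  rewrite (_ : n%:R ^- 2 * (Kc z * n%:R) = Kc z / n%:R); last by field.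
  have E w : n%:R ^- 2 * `|\sum_(1 <= k < n.+1)
      (inner (f (past delta k w)) z *: f (past delta k w) - C z)| ^+ 2
      = `|C_hat (fun k w => f (past delta k w)) n w z - C z| ^+ 2.
    rewrite -[X in X * _]ger0_norm// -exprVn normrX -exprMn -normrZ.
    rewrite sumrB sumr_const_nat subn1/= scalerBr -[C z *+ n]scaler_nat scalerA.
    by rewrite mulVf// scale1r.
  by under eq_fun do rewrite E.
Qed.

Variable m : nat -> R.
Hypothesis m_infty : m @ \oo --> +oo.
Hypothesis m_small : m n / Num.sqrt n%:R @[n --> \oo] --> 0.
Variables (lam : nat -> Omega -> nat -> R) (v : nat -> Omega -> nat -> H).
Hypothesis es : forall n w, (1 <= n)%N ->
  eigen_system (C_hat X n w) (lam n w) (v n w).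

Let error n w := `|Psi (X n w) - Psi_hat X Y n w (lam n w) (v n w)
   (K_trunc (lam n w) (m n)) (X n w)|.

Let error_measurable n : (1 <= n)%N -> 1 <= m n ->
  measurable_fun setT (error n).
Proof.
move=> n1 m1; apply: measurable_norm => //; apply: weakly_measurableB.
  exact: (weakly_measurable_linear Psi_bounded (mXw n1)).
apply: (Psi_hat_measurable sepH mXw (fun w => es w n1)) => //.
exact: mXw.
Qed.

Lemma prediction_consistency : cvg0_in_probability P error.
Proof.
move=> eta eta0; apply: cvg0_measure => ep ep0.
have [X' [e' [q [Kg [Kc [aeX mX' X'2 Kg_le Kc_le]]]]]] := sample_bounds.
have [Q QD] := dense_seq sepH.
have [y y0] := infinite_dimensional_neq0 infH.
(* The bias will be a sum of four terms of size at most [del], that is [eta / 2]; the noise term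
   takes the other half. Likewise [ep] is shared among four exceptional events. *)
pose del := eta / 8; have del0 : 0 < del by rewrite divr_gt0.
have ep4 : 0 < ep / 4 by rewrite divr_gt0.
have [L [mF PL]] := tightness P sepH QD (mXw (leqnn 1)) del0 ep4.
have /choice[z Qz] : forall i, exists z, `|Q i - C z| < del.
  by move=> i; exact: dense_range.
have [z0 Cz0] : exists z0, C z0 != 0.
  have y2 : 0 < `|y| by rewrite normr_gt0.
  have [z0 hz] := dense_range imC y y2; exists z0; apply/eqP => Cz.
  by move: hz; rewrite Cz subr0 ltxx.
have Cz0' : 0 < `|C z0| by rewrite normr_gt0.
(* Lower bound for the top eigenvalue: when [C_hat z0] is within half the norm of [C z0], that half
   is at most the top eigenvalue times |z0|. The [+ 1] keeps the denominator positive. *)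
pose kap := `|C z0| / (2 * (`|z0| + 1)).
have kap0 : 0 < kap by rewrite divr_gt0// mulr_gt0// ltr_wpDl.
pose t := Num.min del (`|C z0| / 2).
have t0 : 0 < t by rewrite lt_min del0 divr_gt0.
pose M := \sum_(i < L) `|Q i| + del.
pose Zs := \sum_(i < L) `|z i|.
have Zs0 : 0 <= Zs by apply: sumr_ge0.
have q0 := mean_le_ge0 (X'2 0%N).
(* Markov thresholds: [b] bounds the empirical trace, hence the top eigenvalue, and [a2 * n] bounds
   the Gram trace, each outside an event of probability at most [ep / 4]. *)
pose b := 4 * (q + 1) / ep; have b0 : 0 < b.
  by rewrite divr_gt0// mulr_gt0// ltr_wpDl.
pose a2 := 4 * (`|Kg| + 1) / ep; have a20 : 0 < a2.
  by rewrite divr_gt0// mulr_gt0// ltr_wpDl.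
pose a := Num.sqrt a2; have a0 : 0 < a by rewrite sqrtr_gt0.
pose Ks := \sum_(i < L) `|Kc (z i)| + `|Kc z0|.
have Ks0 : 0 <= Ks by rewrite addr_ge0// sumr_ge0.
have M0 : 0 < M by rewrite ltr_wpDl// sumr_ge0.
near=> n.
have n1 : (1 <= n)%N by near: n; exact: nbhs_infty_ge.
have m1 : 1 <= m n by near: n; move/cvgryPge : m_infty; exact.
have mb : b * Zs / del <= m n by near: n; move/cvgryPge : m_infty; exact.
have ms : m n / Num.sqrt n%:R <= eta / 2 / (a / kap * M).
  near: n; move/cvgrPdist_le : m_small => /(_ (eta / 2 / (a / kap * M))).
  have h : 0 < eta / 2 / (a / kap * M) by rewrite !(divr_gt0, mulr_gt0).
  move=> /(_ h); apply: filterS => n; rewrite sub0r normrN.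
  exact: le_trans (ler_norm _).
have nK : Ks / t ^+ 2 / (ep / 4) <= n%:R.
  by near: n; exact: nbhs_infty_ger.
have n0 : 0 < (n%:R : R) by rewrite ltr0n.
have m0 : 0 < m n by exact: lt_le_trans m1.
have [N [mN PN goodN]] := aeX.
pose W w := \sum_(i < L) `|C_hat X' n w (z i) - C (z i)| ^+ 2
  + `|C_hat X' n w z0 - C z0| ^+ 2.
have mean_sum L' (F : nat -> Omega -> R) (c : nat -> R) :
    (forall i, mean_le P (F i) (c i)) ->
    mean_le P (fun w => \sum_(i < L') F i w) (\sum_(i < L') c i).
  move=> FC; elim: L' => [|l IHl].
    rewrite (_ : (fun w => _) = fun=> 0); last first.
      by apply/funext => w; rewrite big_ord0.
    by rewrite big_ord0; exact: mean_le_cst.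
  rewrite (_ : (fun w => _) = fun w => \sum_(i < l) F i w + F l w); last first.
    by apply/funext => w; rewrite big_ord_recr.
  by rewrite big_ord_recr/=; exact: mean_leD.
have Wmean : mean_le P W (Ks / n%:R).
  rewrite /Ks mulrDl mulr_suml; apply: mean_leD.
    apply: (mean_sum L (fun i w => `|C_hat X' n w (z i) - C (z i)| ^+ 2)
      (fun i => `|Kc (z i)| / n%:R)) => i.
    by apply: mean_le_weaken (Kc_le _ _ n1); rewrite ler_wpM2r ?invr_ge0// ler_norm.
  by apply: mean_le_weaken (Kc_le _ _ n1); rewrite ler_wpM2r ?invr_ge0// ler_norm.
pose tr w := n%:R^-1 * \sum_(1 <= k < n.+1) `|X' k w| ^+ 2.
have trmean : mean_le P tr q.
  have -> : q = n%:R^-1 * (\sum_(1 <= k < n.+1) q).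
    by rewrite sumr_const_nat subn1/= -(mulr_natl q n) mulrA mulVf ?mul1r// gt_eqF.
  apply: mean_leZ; first by rewrite invr_ge0.
  elim: n.+1 => [|l IHl].
    rewrite big_geq// (_ : (fun w => _) = fun=> 0); first exact: mean_le_cst.
    by apply/funext => w; rewrite big_geq.
  case: l IHl => [|l] IHl.
    rewrite big_geq// (_ : (fun w => _) = fun=> 0); first exact: mean_le_cst.
    by apply/funext => w; rewrite big_geq.
  rewrite (_ : (fun w => _) = fun w => \sum_(1 <= k < l.+1) `|X' k w| ^+ 2
      + `|X' l.+1 w| ^+ 2); last by apply/funext => w; rewrite big_nat_recr.
  by rewrite big_nat_recr//=; exact: mean_leD.
pose G w := gram_trace (index_iota 1 n.+1) (X'^~ w) (e'^~ w).
pose E0 := X n @^-1` [set x : borel H | forall i, (i < L)%N -> del <= `|(x : H) - Q i|].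
pose E4 := [set w | t ^+ 2 < W w].
pose E5 := [set w | a2 * n%:R < G w].
pose E6 := [set w | b < tr w].
have msup (F : Omega -> R) c : measurable_fun setT F -> measurable [set w | c < F w].
  move=> mFF; rewrite (_ : [set w | _] = F @^-1` `]c, +oo[).
    by rewrite -[X in measurable X]setTI; exact: mFF.
  by apply/seteqP; split => w /=; rewrite in_itv/= andbT.
have mE0 : measurable E0 by rewrite -[X in measurable X]setTI; exact: mX.
have mE4 : measurable E4 by apply: msup; case: Wmean.
have mE5 : measurable E5 by apply: msup; case: (Kg_le n).
have mE6 : measurable E6 by apply: msup; case: trmean.
have PE0 : (P E0 <= (ep / 4)%:E)%E.
  apply: le_trans PL; rewrite le_eqVlt; apply/orP; left; apply/eqP.
  have := statX 1 (n - 1)%N (fun=> mF); rewrite !big_nat1 subnKC//.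
have PE4 : (P E4 <= (ep / 4)%:E)%E.
  apply: le_trans (mean_le_markov Wmean _) _; first by rewrite exprn_gt0.
  rewrite lee_fin mulrAC ler_pdivrMr//.
  by move: nK; rewrite ler_pdivrMr// (mulrC n%:R).
have PE5 : (P E5 <= (ep / 4)%:E)%E.
  apply: le_trans (mean_le_markov (Kg_le n) _) _; first by rewrite mulr_gt0.
  rewrite lee_fin -mulf_div divff ?mulr1 ?gt_eqF// ler_pdivrMr//.
  rewrite /a2 (_ : ep / 4 * (4 * (`|Kg| + 1) / ep) = `|Kg| + 1); last first.
    by field; rewrite gt_eqF.
  by rewrite (le_trans (ler_norm _))// lerDl.
have PE6 : (P E6 <= (ep / 4)%:E)%E.
  apply: le_trans (mean_le_markov trmean b0) _.
  rewrite lee_fin ler_pdivrMr// /b (_ : ep / 4 * (4 * (q + 1) / ep) = q + 1).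
    by rewrite lerDl.
  by field; rewrite gt_eqF.
have bad : [set w | eta < `|error n w|] `<=` N `|` (E0 `|` (E4 `|` (E5 `|` E6))).
  move=> w; apply: contraPP => /not_orP[/(contra_not (goodN w))/contrapT good].
  move=> /not_orP[/= nE0 /not_orP[nE4 /not_orP[nE5 nE6]]].
  apply/negP; rewrite -leNgt normr_id.
  (* The net point near [X n w] depends on [w], but only through an index below [L], and [W]
     controls all these indices at once. *)
  have /existsNP[i /not_implyP[iL /negP]] := nE0; rewrite -ltNge => xQ.
  have XX k : (1 <= k)%N -> X k w = X' k w by move=> /good[].
  have CC u : C_hat X n w u = C_hat X' n w u.
    rewrite /C_hat /Delta_hat; congr (_ *: _); rewrite big_nat [RHS]big_nat.
    by apply: eq_bigr => k /andP[k1 _]; rewrite /tensor XX.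
  have GG : gram_trace (index_iota 1 n.+1) (X^~ w) (e^~ w) = G w.
    rewrite /G /gram_trace big_nat [RHS]big_nat; apply: eq_bigr => k /andP[k1 _].
    rewrite big_nat [RHS]big_nat; apply: eq_bigr => l /andP[l1 _].
    have [hX he _] := good k k1; have [hX' he' _] := good l l1.
    by rewrite hX he hX' he'.
  have esw := es w n1; have fr := @C_hat_frame _ _ _ _ X n w.
  have Wt : W w <= t ^+ 2 by rewrite leNgt; apply/negP.
  have zC u : `|C_hat X' n w u - C u| ^+ 2 <= t ^+ 2 -> `|C u - C_hat X n w u| <= t.
    by rewrite ler_pXn2r ?nnegrE ?(ltW t0)// CC distrC.
  have zCi : `|C (z i) - C_hat X n w (z i)| <= t.
    apply: zC; apply: le_trans Wt; rewrite /W (bigD1 (Ordinal iL))//= -addrA lerDl.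
    by rewrite addr_ge0 ?sqr_ge0// sumr_ge0// => j _; rewrite sqr_ge0.
  have zC0 : `|C z0 - C_hat X n w z0| <= t.
    apply: zC; apply: le_trans Wt; rewrite lerDr.
    by apply: sumr_ge0 => j _; rewrite sqr_ge0.
  have lamk : kap <= lam n w 1%N.
    have h1 := frame_norm_le fr esw z0.
    have h2 : `|C z0| / 2 <= `|C_hat X n w z0|.
      have tC : t <= `|C z0| / 2 by rewrite ge_min lexx orbT.
      by have := lerB_dist (C z0) (C_hat X n w z0); lra.
    have l0 := eigenvalue_ge0 esw (leqnn 1).
    rewrite /kap invfM mulrA ler_pdivrMr ?ltr_wpDl//.
    rewrite mulrDr mulr1; lra.
  have lam0 : 0 < lam n w 1%N by exact: lt_le_trans lamk.
  have lamb : lam n w 1%N <= b.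
    apply: le_trans (eigenvalue1_le_trace fr esw) _.
    rewrite scaled_sample_trace; apply: (@le_trans _ _ (tr w)).
      rewrite /tr ler_wpM2l ?invr_ge0// !big_nat; apply: ler_sum => k /andP[k1 _].
      by rewrite XX.
    by rewrite leNgt; apply/negP.
  have xM : `|X n w| <= M.
    rewrite -[X n w](subrK (Q i)) (le_trans (ler_normD _ _))// addrC lerD ?(ltW xQ)//.
    by rewrite (bigD1 (Ordinal iL))//= lerDl sumr_ge0.
  have model k : (1 <= k)%N -> Y k w = Psi (X k w) + e k w by move=> /good[].
  have Psi1 u : `|Psi u| <= `|u|.
    by apply: le_trans (opnorm_le u Psi_bounded) _; rewrite ler_piMl.
  have := Psi_hat_error esw m1 lam0 Psi1 model (X n w).
  rewrite -/(error n w) GG => /le_trans; apply.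
  have p1 := projection_error esw m1 lam0 (X n w) (Q i) (C (z i)) (z i).
  have p2 : lam n w 1%N / m n * `|z i| <= del.
    apply: (@le_trans _ _ (b / m n * Zs)).
      apply: ler_pM => //; first by rewrite divr_ge0// ltW.
        by rewrite ler_wpM2r ?invr_ge0// ltW.
      by rewrite /Zs (bigD1 (Ordinal iL))//= lerDl sumr_ge0.
    move: mb; rewrite ler_pdivrMr// => mb.
    by rewrite mulrAC ler_pdivrMr// (mulrC del).
  have tdel : t <= del by rewrite ge_min lexx.
  (* The Gram trace contributes the square root of [n], so the term is at most [m n / Num.sqrt n%:R]
     times the constant [a / kap * M]; the growth condition on [m] is used here, through [ms]. *)
  have p3 : n%:R^-1 * Num.sqrt (G w) * (m n / lam n w 1%N * `|X n w|) <= eta / 2.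
    have Gle : Num.sqrt (G w) <= a * Num.sqrt n%:R.
      rewrite -sqrtrM ?(ltW a20)// ler_wsqrtr// leNgt; exact/negP.
    have ml : m n / lam n w 1%N <= m n / kap.
      by rewrite ler_wpM2l ?(ltW m0)// lef_pV2 ?posrE.
    apply: (@le_trans _ _ (n%:R^-1 * (a * Num.sqrt n%:R) * (m n / kap * M))).
      apply: ler_pM => //.
      - by rewrite mulr_ge0 ?divr_ge0 ?(ltW m0) ?(ltW lam0).
      - by rewrite ler_wpM2l ?invr_ge0 ?ler0n.
      - by apply: ler_pM => //; rewrite divr_ge0 ?(ltW m0) ?(ltW lam0).
    have sn0 : 0 < Num.sqrt (n%:R : R) by rewrite sqrtr_gt0.
    have -> : n%:R^-1 = (Num.sqrt n%:R)^-1 * (Num.sqrt n%:R)^-1 :> R.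
      by rewrite -invfM -expr2 sqr_sqrtr.
    have -> : (Num.sqrt n%:R)^-1 * (Num.sqrt n%:R)^-1 * (a * Num.sqrt n%:R)
        * (m n / kap * M) = m n / Num.sqrt n%:R * (a / kap * M).
      by field; rewrite !gt_eqF.
    by rewrite -ler_pdivlMr// !(divr_gt0, mulr_gt0).
  have Qz' := ltW (Qz i); have xQ' := ltW xQ.
  have d8 : del * 8 = eta by rewrite /del; field.
  move: p1 p2 p3 zCi tdel Qz' xQ'; set A1 := `|X n w - _ |; set A2 := _ * (_ * _).
  lra.
(* The inclusion [bad] bounds the probability only once the event is known to be measurable, which
   the functional calculus provides. *)
have mbad : measurable [set w | eta < `|error n w|].
  apply: msup; apply: (measurableT_comp (@normr_measurable R setT)).
  exact: error_measurable.
have PU : (P [set w | (eta < `|error n w|)%R]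
    <= P (N `|` (E0 `|` (E4 `|` (E5 `|` E6)))))%E.
  by apply: le_measure bad; rewrite inE//; do ?[apply: measurableU => //].
apply: le_trans PU _.
have -> : ep%:E = (0 + ((ep / 4)%:E + ((ep / 4)%:E + ((ep / 4)%:E + (ep / 4)%:E))))%E.
  by rewrite add0e -!EFinD; congr EFin; field.
apply: le_trans (measureU2 _ _ _) _ => //; first by do ?[apply: measurableU => //].
apply: leeD; first by rewrite le_eqVlt; apply/orP; left; apply/eqP; exact: PN.
apply: le_trans (measureU2 _ _ _) _ => //; first by do ?[apply: measurableU => //].
apply: leeD => //.
apply: le_trans (measureU2 _ _ _) _ => //; first by do ?[apply: measurableU => //].
apply: leeD => //.
by apply: le_trans (measureU2 _ _ _) _ => //; apply: leeD.
Unshelve. all: by end_near. Qed.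

End consistency.

(** * Linear filters of i.i.d. innovations *)

Section weighted_sums.
Context (R : realFieldType) (c : R).
Hypotheses (c_ge0 : 0 <= c) (c_lt1 : c < 1).

Lemma geometric_sum_le N : \sum_(0 <= j < N) c ^+ j <= (1 - c)^-1.
Proof.
have c1 : 0 < 1 - c by rewrite subr_gt0.
rewrite -[leRHS]mul1r ler_pdivlMr//.
suff -> : (\sum_(0 <= j < N) c ^+ j) * (1 - c) = 1 - c ^+ N.
  by rewrite gerBl exprn_ge0.
elim: N => [|N IHN]; first by rewrite big_geq// mul0r expr0 subrr.
by rewrite big_nat_recr//= mulrDl IHN exprS; ring.
Qed.

(** Weighted Cauchy-Schwarz, from a nonnegative variance: with [s] the total weight and [t] the
    weighted sum, the weighted sum of [(s * a j - t) ^+ 2] equals [s * (s * Q - t ^+ 2)]. Used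
    twice, it gives the fourth power with the cube of [(1 - c)^-1]. *)
Lemma weighted_sqr_le N (a : nat -> R) :
  (\sum_(0 <= j < N) c ^+ j * a j) ^+ 2 <=
  (1 - c)^-1 * \sum_(0 <= j < N) c ^+ j * a j ^+ 2.
Proof.
pose s := \sum_(0 <= j < N) c ^+ j; pose t := \sum_(0 <= j < N) c ^+ j * a j.
pose Q := \sum_(0 <= j < N) c ^+ j * a j ^+ 2; rewrite -/t -/Q.
have Q0 : 0 <= Q by rewrite /Q; apply: sumr_ge0 => j _; rewrite mulr_ge0 ?sqr_ge0 ?exprn_ge0.
have c1 : 0 <= (1 - c)^-1 by rewrite invr_ge0 subr_ge0 ltW.
have [N0|N0] := posnP N; first by rewrite /t N0 big_geq// expr0n mulr_ge0.
have s0 : 0 < s.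
  rewrite /s (@big_ltn _ _ _ 0)// expr0 ltr_pwDl//.
  by apply: sumr_ge0 => j _; rewrite exprn_ge0.
apply: le_trans (_ : s * Q <= _); last first.
  by rewrite ler_wpM2r// geometric_sum_le.
have : 0 <= \sum_(0 <= j < N) c ^+ j * (s * a j - t) ^+ 2.
  by apply: sumr_ge0 => j _; rewrite mulr_ge0 ?sqr_ge0 ?exprn_ge0.
rewrite (_ : \sum_(0 <= j < N) _ = s * (s * Q - t ^+ 2)).
  by rewrite pmulr_rge0// subr_ge0.
rewrite (eq_bigr (fun j => s ^+ 2 * (c ^+ j * a j ^+ 2) +
   - (2 * s * t) * (c ^+ j * a j) + t ^+ 2 * c ^+ j)); last by move=> j _; ring.
rewrite !big_split/= -!mulr_sumr -/Q -/t -/s; ring.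
Qed.

Lemma weighted_fourth_le N (a : nat -> R) :
  (\sum_(0 <= j < N) c ^+ j * a j) ^+ 4 <=
  (1 - c)^-1 ^+ 3 * \sum_(0 <= j < N) c ^+ j * a j ^+ 4.
Proof.
have c1 : 0 <= (1 - c)^-1 by rewrite invr_ge0 subr_ge0 ltW.
have h1 := weighted_sqr_le N a; have h2 := weighted_sqr_le N (fun j => a j ^+ 2).
have Q0 : 0 <= \sum_(0 <= j < N) c ^+ j * a j ^+ 2.
  by apply: sumr_ge0 => j _; rewrite mulr_ge0 ?sqr_ge0 ?exprn_ge0.
rewrite (exprM _ 2 2); apply: (@le_trans _ _
    (((1 - c)^-1 * \sum_(0 <= j < N) c ^+ j * a j ^+ 2) ^+ 2)).
  by rewrite ler_pXn2r ?nnegrE ?sqr_ge0 ?mulr_ge0.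
rewrite exprMn (exprSr (1 - c)^-1 2) -mulrA ler_wpM2l ?sqr_ge0//; apply: le_trans h2 _.
by under eq_bigr do rewrite -exprM.
Qed.

End weighted_sums.

(** [U] is the full series made real by [fine]. Its mean is finite, so the series is finite almost
    everywhere; the bound is claimed only there because [fine] sends infinite values to [0]. *)
Lemma weighted_energy_mean d (T : measurableType d) (R : realType)
    (mu : {measure set T -> \bar R}) (c : R) (a : nat -> T -> R) (M : R) :
  0 <= c < 1 -> (forall j, mean_le mu (a j) M) ->
  exists U : T -> R, mean_le mu U ((1 - c)^-1 * M) /\
    {ae mu, forall w N, \sum_(0 <= j < N) c ^+ j * a j w <= U w}.
Proof.
move=> /andP[c0 c1] aM.
pose V w := (\sum_(j <oo) (c ^+ j * a j w)%:E)%E.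
have term j : mean_le mu (fun w => c ^+ j * a j w) (c ^+ j * M).
  by apply: mean_leZ => //; rewrite exprn_ge0.
have t0 j w : (0 <= (c ^+ j * a j w)%:E)%E by rewrite lee_fin; case: (term j).
have mt j : measurable_fun setT (fun w => (c ^+ j * a j w)%:E).
  by apply/measurable_EFinP; case: (term j).
have M0 := mean_le_ge0 (aM 0%N).
have V0 w : (0 <= V w)%E by exact: nneseries_ge0.
have iV : (\int[mu]_w V w <= ((1 - c)^-1 * M)%:E)%E.
  rewrite integral_nneseries//; apply: lime_le.
    by apply: is_cvg_nneseries => j _ _; exact: integral_ge0.
  apply: nearW => N; apply: (@le_trans _ _ (\sum_(0 <= j < N) (c ^+ j * M)%:E)%E).
    by apply: lee_sum => j _; case: (term j).
  by rewrite sumEFin lee_fin -mulr_suml ler_wpM2r// geometric_sum_le.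
have mV : measurable_fun setT V.
  by apply: ge0_emeasurable_sum => //.
have intV : mu.-integrable setT V.
  apply/integrableP; split => //.
  under eq_integral do rewrite gee0_abs//.
  exact: le_lt_trans iV (ltry _).
have Vfin := integrable_ae measurableT intV.
exists (fun w => fine (V w)); split; last first.
  apply: filterS Vfin => w /(_ I) Vw N; rewrite -lee_fin fineK// -sumEFin.
  exact: nneseries_lim_ge.
split.
- exact: (measurableT_comp (fine_measurable measurableT) mV).
- by move=> w; exact: fine_ge0.
rewrite (ae_eq_integral V)//.
  by apply/measurable_EFinP; exact: (measurableT_comp (fine_measurable measurableT) mV).
by apply: filterS Vfin => w /(_ I) Vw _; rewrite fineK.
Qed.

(** * The stationary solution as a measurable function of the past *)

Section linear_filter.
Context {R : realType} (H : hilbertType R) (Psi : {linear H -> H}).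
Hypothesis Psi_bounded : bounded_operator Psi.
Hypothesis Psi_lt1 : opnorm Psi < 1.
Let c := opnorm Psi.
Let kappa := (1 - c)^-1 ^+ 3.

Let c_ge0 : 0 <= c := opnorm_ge0 Psi_bounded.

Let kappa_ge0 : 0 <= kappa.
Proof. by rewrite exprn_ge0// invr_ge0 subr_ge0 ltW. Qed.

Lemma iter_opnorm_le j y : `|iter j Psi y| <= c ^+ j * `|y|.
Proof.
elim: j => [|j IHj]; first by rewrite mul1r.
rewrite iterS (le_trans (opnorm_le _ Psi_bounded))// exprS -mulrA.
by rewrite ler_wpM2l.
Qed.

Lemma iter_linearB j : {morph iter j Psi : x y / x - y}.
Proof. by elim: j => [|j IHj] x y //; rewrite !iterS IHj linearB. Qed.

(* Paths are read from index 1 on: [s 0] is the innovation of the next step. *)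
Definition filter_partial (s : nat -> H) N := \sum_(0 <= j < N) iter j Psi (s j.+1).
(** Up to the factor [kappa] it bounds the fourth power of the filter ([weighted_fourth_le]), and
    its mean is computed term by term from one fourth moment. *)
Definition path_energy (s : nat -> H) N := \sum_(0 <= j < N) c ^+ j * `|s j.+1| ^+ 4.
(** Natural bounds present the set as a countable union, which gives its measurability. *)
Definition finite_energy : set (nat -> H) :=
  [set s | exists K : nat, forall N, path_energy s N <= K%:R].
(* The indicator makes the limit exist on every path, hence the filter measurable. *)
Definition linear_filter (s : nat -> H) : H :=
  lim ((\1_finite_energy s : R) *: filter_partial s N @[N --> \oo]).

Lemma filter_partial_cvg s : finite_energy s ->
  filter_partial s N @[N --> \oo] --> linear_filter s.
Proof.
move=> Gs; rewrite /linear_filter.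
have -> : (fun N => (\1_finite_energy s : R) *: filter_partial s N) =
    filter_partial s.
  by apply/funext => N; rewrite indicE mem_set// scale1r.
have [K sK] := Gs.
suff : cvgn (series (fun j => iter j Psi (s j.+1))) by [].
apply: normed_cvg; apply: nondecreasing_is_cvgn.
  apply/nondecreasing_seqP => N; rewrite /normed_series_of seriesSr lerDl.
  exact: normr_ge0.
(* Only the fourth power of the sum of norms is controlled; [x <= 1] or [x <= x ^+ 4] turns this
   into a bound on the sum without taking roots. *)
exists (1 + kappa * K%:R) => _ [N _ <-].
apply: (@le_trans _ _ (\sum_(0 <= j < N) c ^+ j * `|s j.+1|)).
  by apply: ler_sum => j _; exact: iter_opnorm_le.
have : (\sum_(0 <= j < N) c ^+ j * `|s j.+1|) ^+ 4 <= kappa * K%:R.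
  apply: le_trans (weighted_fourth_le c_ge0 Psi_lt1 N (fun j => `|s j.+1|)) _.
  by rewrite ler_wpM2l//; exact: sK.
set x := \sum_(_ <= _ < _) _ => x4.
have K0 : 0 <= kappa * K%:R by rewrite mulr_ge0.
have [x1|x1] := leP x 1; first by rewrite (le_trans x1)// lerDl.
apply: le_trans (_ : x ^+ 4 <= _); last by rewrite (le_trans x4)// lerDr.
by rewrite -[leLHS]expr1 ler_weXn2l// ltW.
Qed.

Lemma finite_energy0 : finite_energy (fun=> 0).
Proof.
exists 0%N => N; rewrite /path_energy big1// => j _.
by rewrite normr0 expr0n mulr0.
Qed.

Lemma linear_filter0 : linear_filter (fun=> 0) = 0.
Proof.
have := filter_partial_cvg finite_energy0.
rewrite (_ : filter_partial _ = fun=> 0) => [/cvg_lim <-//|]; last first.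
  apply/funext => N; rewrite /filter_partial big1// => j _.
  by elim: j => //= j ->; rewrite linear0.
exact: lim_cst.
Qed.

(** On the common prefix the terms cancel and the remaining ones carry at least [p] applications of
    [Psi], hence the factor [c ^+ p]. The bound holds for partial sums up to [N + p] and passes to
    the limit. *)
Lemma linear_filter_diff s s' p u : finite_energy s -> finite_energy s' ->
  (forall j, (j < p)%N -> s j.+1 = s' j.+1) ->
  (forall N, \sum_(0 <= j < N) c ^+ j * `|s (j + p).+1 - s' (j + p).+1| ^+ 4 <= u) ->
  `|linear_filter s - linear_filter s'| ^+ 4 <= (c ^+ p) ^+ 4 * (kappa * u).
Proof.
move=> Gs Gs' ss' eu.
have le N : `|filter_partial s (N + p) - filter_partial s' (N + p)| ^+ 4
    <= (c ^+ p) ^+ 4 * (kappa * u).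
  have -> : filter_partial s (N + p) - filter_partial s' (N + p) =
      \sum_(0 <= j < N) iter (j + p) Psi (s (j + p).+1 - s' (j + p).+1).
    rewrite /filter_partial -sumrB (big_cat_nat (n := p))//= ?leq_addl//.
    rewrite big_nat big1 ?add0r => [|j /andP[_ jp]]; last by rewrite ss'// subrr.
    rewrite -{1}[p]add0n big_addn addnK; apply: eq_bigr => j _.
    by rewrite iter_linearB.
  apply: (@le_trans _ _ ((c ^+ p * \sum_(0 <= j < N)
      c ^+ j * `|s (j + p).+1 - s' (j + p).+1|) ^+ 4)).
    rewrite lerXn2r ?nnegrE// ?mulr_ge0 ?exprn_ge0//.
      by apply: sumr_ge0 => j _; rewrite mulr_ge0// exprn_ge0.
    apply: le_trans (ler_norm_sum _ _ _) _; rewrite mulr_sumr.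
    apply: ler_sum => j _; apply: le_trans (iter_opnorm_le _ _) _.
    by rewrite exprD mulrA (mulrC (c ^+ p)).
  rewrite exprMn ler_wpM2l ?exprn_ge0//.
  apply: le_trans (weighted_fourth_le c_ge0 Psi_lt1 N
    (fun j => `|s (j + p).+1 - s' (j + p).+1|)) _.
  by rewrite ler_wpM2l.
have cv : `|filter_partial s (N + p) - filter_partial s' (N + p)| ^+ 4 @[N --> \oo]
    --> `|linear_filter s - linear_filter s'| ^+ 4.
  have h (s0 : nat -> H) : finite_energy s0 ->
      filter_partial s0 (N + p) @[N --> \oo] --> linear_filter s0.
    by move=> /filter_partial_cvg; rewrite -(cvg_shiftn p).
  have hn : `|filter_partial s (N + p) - filter_partial s' (N + p)| @[N --> \oo]
      --> `|linear_filter s - linear_filter s'|.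
    by apply: cvg_norm; apply: cvgB; exact: h.
  exact: (cvg_comp _ _ hn (@exprn_continuous R 4 _)).
by apply: (cvgr_to_le cv); near=> N; exact: le.
Unshelve. all: by end_near. Qed.

Lemma linear_filter_le s u : (forall N, path_energy s N <= u) ->
  `|linear_filter s| ^+ 4 <= kappa * u.
Proof.
move=> su; have Gs : finite_energy s.
  exists (Num.truncn `|u|).+1 => N; apply: le_trans (su N) _.
  by apply: le_trans (ler_norm _) _; rewrite ltW// truncnS_gt.
have := @linear_filter_diff s (fun=> 0) 0 u Gs finite_energy0.
rewrite linear_filter0 subr0 expr0 expr1n mul1r; apply => // N.
under eq_bigr do rewrite subr0 addn0.
exact: su.
Qed.

(** The filter ignores the coordinate [s 0], which carries the noise of the next step; this
    separates the regressor from the error although both are read from one path. *)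
Lemma linear_filter_ext s s' : (forall j, s j.+1 = s' j.+1) ->
  linear_filter s = linear_filter s'.
Proof.
move=> ss'; have e : path_energy s = path_energy s'.
  by apply/funext => N; apply: eq_bigr => j _; rewrite ss'.
have p : filter_partial s = filter_partial s'.
  by apply/funext => N; apply: eq_bigr => j _; rewrite ss'.
rewrite /linear_filter p; suff -> : \1_finite_energy s = \1_finite_energy s' :> R by [].
rewrite !indicE; congr (_%:R); congr nat_of_bool.
by apply: asbool_equiv_eq; rewrite /finite_energy/= e.
Qed.

Lemma linear_filter_cvg s :
  (\1_finite_energy s : R) *: filter_partial s N @[N --> \oo] --> linear_filter s.
Proof.
have [Gs|nGs] := pselect (finite_energy s).
  under eq_cvg do rewrite indicE mem_set// scale1r; exact: filter_partial_cvg.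
have E : (fun N => (\1_finite_energy s : R) *: filter_partial s N) = fun=> 0.
  by apply/funext => N; rewrite indicE memNset// scale0r.
by rewrite /linear_filter E lim_cst//; exact: cvg_cst.
Qed.

Hypothesis sepH : separable H.

Lemma filter_partial_measurable N :
  weakly_measurable (fun s : seqspace (borel H) => filter_partial s N).
Proof.
apply: weakly_measurable_sum => j.
move: {1}j.+1 => k; elim: j k => [|i IHi] k.
  apply: (weakly_measurable_comp (T2 := borel H) (f := id)).
    exact/random_element_weakly/measurable_id.
  exact: measurable_coord.
exact: (weakly_measurable_linear Psi_bounded (IHi k)).
Qed.

Lemma finite_energy_measurable :
  measurable (finite_energy : set (seqspace (borel H))).
Proof.
rewrite (_ : (finite_energy : set _) = \bigcup_K \bigcap_N
    [set s : seqspace (borel H) | path_energy s N <= K%:R]); last first.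
  apply/seteqP; split => s /=; first by move=> [K sK]; exists K => // N _; exact: sK.
  by move=> [K _ sK]; exists K => N; exact: sK.
apply: bigcup_measurable => K _; apply: bigcap_measurableType => N _.
have mE : measurable_fun setT (fun s : seqspace (borel H) => path_energy s N).
  apply: measurable_sum => j; apply: measurable_funM; first exact: measurable_cst.
  apply: measurable_funX; apply: (measurable_norm sepH).
  apply: (weakly_measurable_comp (T2 := borel H) (f := id)).
    exact/random_element_weakly/measurable_id.
  exact: measurable_coord.
rewrite (_ : [set s | _] = (fun s : seqspace (borel H) => path_energy s N) @^-1`
    `]-oo, K%:R]).
  by rewrite -[X in measurable X]setTI; exact: mE.
by apply/seteqP; split => s /=; rewrite in_itv.
Qed.

Lemma linear_filter_measurable :
  weakly_measurable (linear_filter : seqspace (borel H) -> H).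
Proof.
apply: (@weakly_measurable_cvg _ _ _ _
  (fun N (s : seqspace (borel H)) => (\1_finite_energy s : R) *: filter_partial s N)).
  move=> N; apply: weakly_measurableZ; last exact: filter_partial_measurable.
  by apply: measurable_indic; exact: finite_energy_measurable.
exact: linear_filter_cvg.
Qed.

End linear_filter.

Lemma mean_le_ae_mono d (T : measurableType d) (R : realType)
    (mu : {measure set T -> \bar R}) (Z Z' : T -> R) q :
  mean_le mu Z q -> measurable_fun setT Z' -> (forall w, 0 <= Z' w) ->
  {ae mu, forall w, Z' w <= Z w} -> mean_le mu Z' q.
Proof.
move=> [mZ Z0 iZ] mZ' Z'0 ae; split => //; apply: le_trans iZ.
apply: ae_ge0_le_integral => //.
- by move=> w _; rewrite lee_fin.
- exact/measurable_EFinP.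
- by move=> w _; rewrite lee_fin.
- exact/measurable_EFinP.
- by apply: filterS ae => w h _; rewrite lee_fin.
Qed.

Lemma mean_le_fst d (T : measurableType d) (R : realType) (P : probability T R)
    (Z : T -> R) q :
  mean_le P Z q -> mean_le (P \x P)%E (fun w => Z w.1) q.
Proof.
move=> [mZ Z0 iZ].
have mZf : measurable_fun setT (fun w : T * T => Z w.1).
  exact: (measurableT_comp mZ measurable_fst).
split => //.
apply: le_trans iZ; rewrite (@fubini_tonelli1 _ _ _ _ _ P P (fun w => (Z w.1)%:E)).
- rewrite le_eqVlt; apply/orP; left; apply/eqP; apply: eq_integral => w _.
  rewrite /fubini_F /= (integral_cst P measurableT (Z w)%:E)/=.
  by rewrite probability_setT mule1.
- exact/measurable_EFinP.
- by move=> w; rewrite lee_fin.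
Qed.

Lemma mean_le_snd d (T : measurableType d) (R : realType) (P : probability T R)
    (Z : T -> R) q :
  mean_le P Z q -> mean_le (P \x P)%E (fun w => Z w.2) q.
Proof.
move=> [mZ Z0 iZ].
have mZf : measurable_fun setT (fun w : T * T => Z w.2).
  exact: (measurableT_comp mZ measurable_snd).
split => //.
apply: le_trans iZ; rewrite (@fubini_tonelli1 _ _ _ _ _ P P (fun w => (Z w.2)%:E)).
- rewrite /fubini_F /=.
  have : (\int[P]_w (Z w)%:E >= 0)%E by apply: integral_ge0 => w _; rewrite lee_fin.
  move=> I0; rewrite (integral_cst P measurableT (\int[P]_w (Z w)%:E)%E)/=.
  by rewrite probability_setT mule1.
- exact/measurable_EFinP.
- by move=> w; rewrite lee_fin.
Qed.

Lemma iid_marginal_integral dS (S : measurableType dS) d (T : measurableType d)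
    (R : realType) (P : probability T R) (xi : int -> T -> S) i j (F : S -> \bar R) :
  iid P xi -> measurable_fun setT F ->
  (\int[P]_w F (xi i w) = \int[P]_w F (xi j w))%E.
Proof.
move=> iidxi mF.
have inj k : injective (fun a : nat => k + a%:Z : int) by move=> a b; lia.
have mF0 : measurable_fun setT (fun s : seqspace S => F (s 0%N)).
  exact: (measurableT_comp mF (measurable_coord 0)).
have := iid_integral (iid_reindex (inj i) iidxi) (iid_reindex (inj j) iidxi) _ mF0.
rewrite /= !addr0; apply => B mB.
by have [_ idx _] := iidxi; exact: idx.
Qed.

(** Coordinate [b] is resampled from the second copy: the index map [t] stays injective, so the law
    is unchanged, while [p] sees only the first copy. Fubini's theorem then integrates the resampled
    coordinate, which has mean zero, alone. *)
Lemma coordinate_orthogonal (R : realType) (H : hilbertType R) d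
    (T : measurableType d) (P : probability T R) (delta : int -> T -> borel H)
    (p : seqspace (borel H) -> R) (n b : nat) (q q' : R) (u : H) :
  iid P delta -> measurable_fun setT p ->
  (forall s s', (forall i, i != b -> s i = s' i) -> p s = p s') ->
  mean_le P (fun w => p (past delta n w) ^+ 2) q ->
  mean_le P (fun w => `|past delta n w b : H| ^+ 2) q' ->
  (\int[P]_w (inner (past delta n w b : H) u)%:E = 0)%E ->
  (\int[P]_w (p (past delta n w) * inner (past delta n w b : H) u)%:E = 0)%E.
Proof.
move=> iid_delta mp pE p2 e2 e0.
pose t (i : nat) : bool * int := (i == b, n%:Z - i%:Z).
have tI : injective t by move=> i j []; lia.
have mc : weakly_measurable (fun s : seqspace (borel H) => s b : H).
  apply: (weakly_measurable_comp (T2 := borel H) (f := id)).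
    exact/random_element_weakly/measurable_id.
  exact: measurable_coord.
have mF : measurable_fun setT
    (fun s : seqspace (borel H) => (p s * inner (s b : H) u)%:E).
  by apply/measurable_EFinP; apply: measurable_funM => //; exact: mc.
rewrite (past_law iid_delta n tI mF).
have tE w : copies_path delta t w b = past delta n w.2 b.
  by rewrite /copies_path /two_copies/= eqxx.
have ptE w : p (copies_path delta t w) = p (past delta n w.1).
  apply: pE => i /negPf ib.
  by rewrite /copies_path /two_copies/= ib.
under eq_integral do rewrite tE ptE.
have me : weakly_measurable (fun w => past delta n w b : H).
  exact: (weakly_measurable_comp mc (past_measurable iid_delta n)).
have mpn : measurable_fun setT (fun w => p (past delta n w)).
  exact: (measurableT_comp mp (past_measurable iid_delta n)).
have dom := mean_leD (mean_le_fst p2)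
  (mean_le_snd (mean_leZ (sqr_ge0 `|u|) e2)).
have int : (P \x P)%E.-integrable setT (EFin \o (fun w : T * T =>
    p (past delta n w.1) * inner (past delta n w.2 b : H) u)).
  apply: (mean_le_integrable dom).
    apply: measurable_funM.
      exact: (measurableT_comp mpn measurable_fst).
    exact: (measurableT_comp (me u) measurable_snd).
  move=> w; rewrite normrM; have := inner_le (past delta n w.2 b : H) u.
  set x := p _; set y := inner _ _; set a := `|(past delta n w.2 b : H)|; set b' := `|u|.
  move=> yab; have a0 : 0 <= a by exact: normr_ge0.
  have b0 : 0 <= b' by exact: normr_ge0.
  have := sqr_ge0 (`|x| - a * b'); have := sqr_ge0 (`|x| + a * b').
  have := ler_wpM2l (normr_ge0 x) yab; rewrite -(real_normK (num_real x)).
  nra.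
rewrite -(integral12_prod_meas1 int) /fubini_F.
apply: integral0_eq => w1 _ /=.
under eq_integral do rewrite EFinM.
have inte : P.-integrable setT (fun w => (inner (past delta n w b : H) u)%:E).
  have dom1 := mean_leZ (normr_ge0 u) (mean_leD (mean_le_cst P ler01) e2).
  apply: (mean_le_integrable dom1); first exact: me.
  move=> w; apply: le_trans (inner_le _ _) _; rewrite mulrC ler_wpM2l//.
  set a := `|(past delta n w b : H)|; have := sqr_ge0 (a - 1); have : 0 <= a by exact: normr_ge0.
  nra.
by rewrite integralZl// e0 mule0.
Qed.

Lemma iter_adjoint (R : realType) (H : hilbertType R) (Psi : {linear H -> H}) j u :
  bounded_operator Psi -> exists u', forall x, inner (iter j Psi x) u = inner x u'.
Proof.
move=> bPsi; elim: j u => [|j IHj] u; first by exists u.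
have [u1 hu1] := adjoint_vector u bPsi; have [u' hu'] := IHj u1.
by exists u' => x; rewrite iterS hu1 hu'.
Qed.

(** * Assumption (A) for i.i.d. innovations *)

Section iid_innovations.
Context (R : realType) (H : hilbertType R) d (Omega : measurableType d).
Variables (P : probability Omega R) (Psi : {linear H -> H}).
Variables (eps : int -> Omega -> H) (X : nat -> Omega -> H).
Hypothesis sepH : separable H.
Hypothesis Psi_bounded : bounded_operator Psi.
Hypothesis Psi_lt1 : opnorm Psi < 1.
Hypothesis arhX : ARH1 P Psi eps X.
Hypothesis iid_eps : iid P (eps : int -> Omega -> borel H).
Hypothesis eps4 : forall i, LpH P 4 (eps i).
Hypothesis eps_mean : forall i, is_mean P (eps i) 0.

Let c := opnorm Psi.
Let c01 : 0 <= c < 1.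
Proof. by rewrite opnorm_ge0. Qed.

Let PP : probability (Omega * Omega)%type R := (P \x P)%E.

(* Shifted by one so that [past delta k] starts with the noise
   [e k = eps k.+1]; the filter producing [X k] ignores that coordinate. *)
Let delta (i : int) : Omega -> borel H := eps (i + 1).

Let iid_delta : iid P delta.
Proof.
apply: (iid_reindex (s := fun i : int => i + 1)) iid_eps.
by move=> i j /addIr.
Qed.

Let f := linear_filter Psi : seqspace (borel H) -> H.

Let weps i : weakly_measurable (eps i).
Proof. by case: (eps4 i) => /random_element_weakly. Qed.

Let mX n : (1 <= n)%N -> weakly_measurable (X n).
Proof. by move=> n1; case: arhX => _ /(_ n n1)/random_element_weakly. Qed.

Let m_id : weakly_measurable (id : borel H -> H).
Proof. exact/random_element_weakly/measurable_id. Qed.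

Let eps_moment : exists2 M : R, 0 <= M &
  forall i, mean_le P (fun w => `|eps i w| ^+ 4) M.
Proof.
have [_ nu0] := eps4 0.
have fin : nu P 4 (eps 0) \is a fin_num by rewrite ge0_fin_numE// nu_ge0.
have h := @nu_le_mean _ _ _ _ P 4 (eps 0) (fine (nu P 4 (eps 0))) isT
  (measurable_norm sepH (weps 0)).
have {h} [_ _ i0] : mean_le P (fun w => `|eps 0 w| ^+ 4) (fine (nu P 4 (eps 0)) ^+ 4).
  by apply: h; rewrite fineK.
exists (fine (nu P 4 (eps 0)) ^+ 4) => [|i]; first by rewrite exprn_ge0// fine_ge0// nu_ge0.
split; [|by move=> w; rewrite exprn_ge0|].
  by apply: measurable_funX; exact: measurable_norm.
have mF : measurable_fun setT (fun x : borel H => (`|(x : H)| ^+ 4)%:E : \bar R).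
  by apply/measurable_EFinP; apply: measurable_funX; exact: (measurable_norm sepH m_id).
by rewrite (iid_marginal_integral i 0 iid_eps mF).
Qed.

Let delta_moment2 i : exists q, mean_le P (fun w => `|(delta i w : H)| ^+ 2) q.
Proof.
have [M M0 hM] := eps_moment.
exists (1 + M); apply: mean_le_mono (mean_leD (mean_le_cst P ler01) (hM (i + 1))) _ _.
  by apply: measurable_funX; exact: (measurable_norm sepH (weps _)).
move=> w; rewrite sqr_ge0/= /delta.
by have := sqr_ge0 (`|eps (i + 1) w| ^+ 2 - 1); nra.
Qed.

Let delta_mean i u : (\int[P]_w (inner (delta i w : H) u)%:E = 0)%E.
Proof. by have := eps_mean (i + 1) u; rewrite unlock inner0l. Qed.

Let energy_past M n : (forall i, mean_le P (fun w => `|eps i w| ^+ 4) M) ->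
  exists U : Omega -> R, mean_le P U ((1 - c)^-1 * M) /\
    {ae P, forall w N, path_energy Psi (past delta n w) N <= U w}.
Proof.
move=> hM.
exact: (weighted_energy_mean (a := fun j w => `|(past delta n w j.+1 : H)| ^+ 4) c01
  (fun j => hM _)).
Qed.

Let nat_bound (u : R) : exists K : nat, u <= K%:R.
Proof.
exists (Num.truncn `|u|).+1; apply: le_trans (ler_norm _) _.
by rewrite ltW// truncnS_gt.
Qed.

Let finite_energy_of (s : nat -> H) u : (forall N, path_energy Psi s N <= u) ->
  finite_energy Psi s.
Proof.
by move=> su; have [K uK] := nat_bound u; exists K => N; exact: le_trans (su N) uK.
Qed.

(** The expected energy is finite, so almost every path has finite energy and the filter is the
    limit of its partial sums there; these are the partial sums that converge to [X n] by [ARH1]. *)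
Let X_filter n : (1 <= n)%N -> {ae P, forall w, X n w = f (past delta n w)}.
Proof.
move=> n1; have [M M0 hM] := eps_moment.
have [U [_ aeU]] := energy_past n hM.
case: arhX => _ _ _ _ /(_ n n1) aeX; apply: filterS2 aeU aeX => w hU hX.
have Gs : finite_energy Psi (past delta n w) := finite_energy_of hU.
have hf := filter_partial_cvg Psi_bounded Psi_lt1 Gs.
suff hX' : filter_partial Psi (past delta n w) @ \oo --> X n w.
  by rewrite -(cvg_lim (@norm_hausdorff _ _) hX') (cvg_lim (@norm_hausdorff _ _) hf).
have <- : series (fun j => iter j Psi (eps (n%:Z - j%:Z) w)) =
    filter_partial Psi (past delta n w); last exact: hX.
apply/funext => N; apply: eq_bigr => j _; congr (iter _ _ _).
by rewrite /past /delta; congr eps; lia.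
Qed.

Let filter_moment n : exists q, mean_le P (fun w => `|f (past delta n w)| ^+ 4) q.
Proof.
have [M M0 hM] := eps_moment; have [U [meanU aeU]] := energy_past n hM.
have k0 : 0 <= (1 - c)^-1 ^+ 3.
  by rewrite exprn_ge0// invr_ge0 subr_ge0; case/andP: c01 => _ /ltW.
exists ((1 - c)^-1 ^+ 3 * ((1 - c)^-1 * M)).
apply: mean_le_ae_mono (mean_leZ k0 meanU) _ _ _.
- apply: measurable_funX; apply: (measurable_norm sepH).
  apply: (weakly_measurable_comp (linear_filter_measurable Psi_bounded Psi_lt1 sepH)).
  exact: (past_measurable iid_delta).
- by move=> w; rewrite exprn_ge0.
- by apply: filterS aeU => w; exact: linear_filter_le.
Qed.

Let mf : weakly_measurable f.
Proof. exact: linear_filter_measurable. Qed.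

Let moment_nu (T' : measurableType d) (mu : probability T' R) (Z : T' -> H) p q :
  (0 < p)%N -> mean_le mu (fun w => `|Z w| ^+ p) q -> (nu mu p%:R Z < +oo)%E.
Proof.
move=> p0 Zq; have q0 := mean_le_ge0 Zq.
(* The bound [q <= (1 + q) ^+ p] avoids a [p]-th root. *)
apply: (@le_lt_trans _ _ (1 + q)%:E); last exact: ltry.
apply: mean_le_nu => //; first by rewrite addr_ge0.
apply: mean_le_weaken Zq; apply: (@le_trans _ _ (1 + q)); first by rewrite lerDr.
by rewrite -[leLHS]expr1 ler_weXn2l// lerDl.
Qed.

Lemma X_approximable : Lp_m_approximable P 4 delta f X.
Proof.
have [M M0 hM] := eps_moment; have /andP[c0 c1] := c01.
split.
- move=> n n1; split; first by case: arhX => _ /(_ n n1).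
  have [q fq] := filter_moment n; apply: (moment_nu (p := 4) isT).
  apply: mean_le_ae fq _ _ _.
  + by apply: measurable_funX; exact: (measurable_norm sepH (mX n1)).
  + by move=> w; rewrite exprn_ge0.
  + by apply: filterS (X_filter n1) => w ->.
- exact: iid_delta.
- exact: (weakly_measurable_random_element sepH mf).
- exact: X_filter.
(* The cube comes from the filter bound, the next factor from summing the weights, and [16 * M] from
   |x - y|^4 <= 8 (|x|^4 + |y|^4). Below, [1 + D4] replaces the fourth root of [D4]. *)
pose D4 := (1 - c)^-1 ^+ 3 * ((1 - c)^-1 * (16 * M)).
have i0 : 0 <= (1 - c)^-1 by rewrite invr_ge0 subr_ge0 ltW.
have D40 : 0 <= D4 by rewrite !mulr_ge0 ?exprn_ge0.
have bound m : (1 <= m)%N ->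
    (nu PP 4 (fun w => X m w.1 - f (coupled_past delta m m w))%R <=
     (c ^+ m.-1 * (1 + D4))%:E)%E.
  (* The exponent is [m - 1]: the coupling changes the indices from [m] on, and the filter starts
     reading at index 1. *)
  move=> m1; pose p := m.-1.
  have [U1 [_ aeU1]] := energy_past m hM.
  have cm j : mean_le PP (fun w => `|(coupled_past delta m m w j.+1 : H)| ^+ 4) M.
    rewrite /coupled_past; case: (j.+1 < m)%N.
      exact: (mean_le_fst (hM _)).
    exact: (mean_le_snd (hM _)).
  have [U2 [_ aeU2]] := weighted_energy_mean c01 cm.
  have gm j : mean_le PP (fun w => `|(past delta m w.1 (j + p).+1 : H) -
      (coupled_past delta m m w (j + p).+1 : H)| ^+ 4) (16 * M).
    have -> : 16 * M = 8 * (M + M) by ring.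
    have m8 := mean_leZ (ler0n R 8) (mean_leD (mean_le_fst (hM (m%:Z - (j + p).+1%:Z + 1)))
      (mean_le_snd (hM (m%:Z - (j + p).+1%:Z + 1)))).
    have jm : ((j + p).+1 < m)%N = false by rewrite /p; lia.
    have E w : (past delta m w.1 (j + p).+1 : H) - (coupled_past delta m m w (j + p).+1 : H)
      = eps (m%:Z - (j + p).+1%:Z + 1) w.1 - eps (m%:Z - (j + p).+1%:Z + 1) w.2.
      by rewrite /coupled_past jm.
    under eq_fun do rewrite E.
    apply: mean_le_mono m8 _ _.
      apply: measurable_funX; apply: (measurable_norm sepH); apply: weakly_measurableB.
        exact: (weakly_measurable_comp (weps _) measurable_fst).
      exact: (weakly_measurable_comp (weps _) measurable_snd).
    move=> w; rewrite exprn_ge0//=.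
    set x := eps _ w.1; set y := eps _ w.2.
    apply: (@le_trans _ _ ((`|x| + `|y|) ^+ 4)).
      by rewrite lerXn2r ?nnegrE ?addr_ge0// ler_normB.
    have := sqr_ge0 (`|x| - `|y|); have := sqr_ge0 (`|x| ^+ 2 - `|y| ^+ 2).
    have := normr_ge0 x; have := normr_ge0 y.
    move: `|x| `|y| => a b' b0 a0 h1 h2.
    have s1 : (a + b') ^+ 2 <= 2 * (a ^+ 2 + b' ^+ 2) by lra.
    have s2 : (a + b') ^+ 4 <= (2 * (a ^+ 2 + b' ^+ 2)) ^+ 2.
      by rewrite (exprM _ 2 2) lerXn2r ?nnegrE ?sqr_ge0// mulr_ge0// addr_ge0// sqr_ge0.
    apply: le_trans s2 _; lra.
  have [U3 [meanU3 aeU3]] := weighted_energy_mean c01 gm.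
  have k0 : 0 <= (c ^+ p) ^+ 4 * (1 - c)^-1 ^+ 3 by rewrite mulr_ge0 ?exprn_ge0.
  have mcoup : weakly_measurable (fun w => f (coupled_past delta m m w)).
    apply: (weakly_measurable_comp mf); rewrite coupled_pastE.
    exact: (copies_path_measurable iid_delta).
  have m4 : mean_le PP (fun w => `|X m w.1 - f (coupled_past delta m m w)| ^+ 4)
      ((c ^+ p) ^+ 4 * D4).
    rewrite /D4 [X in mean_le _ _ X]mulrA; apply: mean_le_ae_mono (mean_leZ k0 meanU3) _ _ _.
    + apply: measurable_funX; apply: (measurable_norm sepH); apply: weakly_measurableB.
        exact: (weakly_measurable_comp (mX m1) measurable_fst).
      exact: mcoup.
    + by move=> w; rewrite exprn_ge0.
    + apply: filterS3 (ae_fst P (X_filter m1)) (ae_fst P aeU1) _ => [w Xw hU1 hU|].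
        2: exact: (filterI aeU2 aeU3).
      case: hU => hU2 hU3; rewrite Xw -mulrA.
      apply: (linear_filter_diff Psi_bounded Psi_lt1 (finite_energy_of hU1)
        (finite_energy_of hU2) _ hU3) => j jp.
      by rewrite /coupled_past (_ : (j.+1 < m)%N)//; rewrite /p in jp; lia.
  apply: mean_le_nu => //; first by rewrite mulr_ge0 ?exprn_ge0// addr_ge0.
  apply: mean_le_weaken m4; rewrite [leRHS]exprMn ler_wpM2l ?exprn_ge0//.
  apply: (@le_trans _ _ (1 + D4)); first by rewrite lerDr.
  by rewrite -[leLHS]expr1 ler_weXn2l// lerDl.
apply: (@le_lt_trans _ _ ((1 - c)^-1 * (1 + D4))%:E); last exact: ltry.
apply: lime_le; first by apply: is_cvg_nneseries => m _ _; exact: nu_ge0.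
apply: nearW => N.
apply: (@le_trans _ _ (\sum_(1 <= m < N) (c ^+ m.-1 * (1 + D4)))%:E).
  by rewrite -sumEFin !big_nat; apply: lee_sum => m /andP[m1 _]; exact: bound.
rewrite lee_fin -mulr_suml ler_wpM2r ?addr_ge0//.
case: N => [|N]; first by rewrite big_geq.
by rewrite big_add1/=; exact: geometric_sum_le.
Qed.

Let e (k : nat) : Omega -> H := eps k.+1%:Z.

Let pastE n i w : (i <= n)%N -> past delta n w (n - i)%N = e i w.
Proof. by move=> le_in; rewrite /past /delta /e; congr (eps _ w); lia. Qed.

Let past0E n w : past delta n w 0%N = e n w.
Proof. by rewrite -(pastE w (leqnn n)) subnn. Qed.

(** A coupling at lag at least 1 leaves coordinate [0] unchanged, so every coupling error is
    zero. *)
Lemma noise_approximable :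
  Lp_m_approximable P 4 delta (fun s => s 0%N) (fun k => eps k.+1%:Z).
Proof.
split.
- by move=> n _; exact: eps4.
- exact: iid_delta.
- exact: measurable_coord.
- by move=> n _; apply: aeW => w; rewrite past0E.
rewrite eseries0 ?ltry// => m m1 _; apply/eqP; rewrite eq_le nu_ge0 andbT.
apply: (mean_le_nu (n := 4)) => //.
have h0 := mean_le_cst PP (lexx (0 : R)).
rewrite expr0n/=; congr (mean_le _ _ _): h0; apply/funext => w.
rewrite /coupled_past m1 -/(past delta m w.1 0%N) past0E.
by rewrite subrr normr0 expr0n.
Qed.

Let delta_integrable i u :
  P.-integrable setT (fun w => (inner (delta i w : H) u)%:E).
Proof.
have [q hq] := delta_moment2 i.
have dom := mean_leZ (normr_ge0 u) (mean_leD (mean_le_cst P ler01) hq).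
apply: (mean_le_integrable dom); first exact: weps.
move=> w; apply: le_trans (inner_le _ _) _; rewrite mulrC ler_wpM2l//.
by have := sqr_ge0 (`|(delta i w : H)| - 1); have := normr_ge0 (delta i w : H); nra.
Qed.

Let filter_partial_mean n N u :
  (\int[P]_w (inner (filter_partial Psi (past delta n w) N) u)%:E = 0)%E.
Proof.
have [u' hu'] := choice (fun j => iter_adjoint j u Psi_bounded).
under eq_integral do rewrite inner_suml -sumEFin.
rewrite integral_sum//.
  apply: big1 => j _; under eq_integral do rewrite hu'.
  exact: delta_mean.
by move=> j; under eq_fun do rewrite hu'; exact: delta_integrable.
Qed.

(** Partial sums have mean zero, and dominated convergence passes this to the limit. The dominating
    function comes from [|x| <= 1 + |x|^4] and the almost sure energy bound [U]. *)
Let filter_mean n u : (\int[P]_w (inner (f (past delta n w)) u)%:E = 0)%E.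
Proof.
have [M M0 hM] := eps_moment; have [U [meanU aeU]] := energy_past n hM.
have /andP[c0 c1] := c01.
have k0 : 0 <= (1 - c)^-1 ^+ 3 by rewrite exprn_ge0// invr_ge0 subr_ge0 ltW.
have U0 w : 0 <= U w by case: meanU.
have dom := mean_leZ (normr_ge0 u) (mean_leD (mean_le_cst P ler01) (mean_leZ k0 meanU)).
have intdom : P.-integrable setT
    (EFin \o (fun w => `|u| * (1 + (1 - c)^-1 ^+ 3 * U w))).
  apply: (mean_le_integrable dom) => [|w]; first by case: dom.
  by rewrite ger0_norm// mulr_ge0// addr_ge0// mulr_ge0.
have mpast Z : weakly_measurable (Z : seqspace (borel H) -> H) ->
    weakly_measurable (fun w => Z (past delta n w)).
  by move=> mZ; apply: (weakly_measurable_comp mZ); exact: (past_measurable iid_delta).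
have [||||_ _] := @dominated_convergence _ _ _ P setT measurableT
  (fun N w => (inner (filter_partial Psi (past delta n w) N) u)%:E)
  (fun w => (inner (f (past delta n w)) u)%:E) _ _ _ _ intdom.
- move=> N; apply/measurable_EFinP.
  by apply: (mpast (fun s => filter_partial Psi s N)); exact: filter_partial_measurable.
- by apply/measurable_EFinP; exact: (mpast _ mf).
- apply: filterS aeU => w hU _; apply: cvg_EFin; first exact: nearW.
  apply: cvg_inner; last exact: cvg_cst.
  exact: (filter_partial_cvg Psi_bounded Psi_lt1 (finite_energy_of hU)).
- apply: filterS aeU => w hU N _; rewrite lee_fin.
  apply: le_trans (inner_le _ _) _; rewrite mulrC ler_wpM2l//.
  set x := filter_partial _ _ _.
  have x4 : `|x| ^+ 4 <= (1 - c)^-1 ^+ 3 * U w.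
    apply: (@le_trans _ _ ((1 - c)^-1 ^+ 3 * path_energy Psi (past delta n w) N)).
      apply: le_trans (weighted_fourth_le c0 c1 _ _).
      rewrite lerXn2r ?nnegrE ?sumr_ge0//.
        by move=> j _; rewrite mulr_ge0 ?exprn_ge0.
      apply: le_trans (ler_norm_sum _ _ _) _; apply: ler_sum => j _.
      exact: iter_opnorm_le.
    by rewrite ler_wpM2l.
  apply: le_trans (lerD (lexx 1) x4).
  have := sqr_ge0 (`|x| ^+ 2 - 1); have := sqr_ge0 (`|x| - 1); nra.
under eq_fun do rewrite filter_partial_mean.
by move=> /cvg_lim <-//; rewrite lim_cst.
Qed.

Let filter_noise_orthogonal n u v :
  (\int[P]_w (inner (f (past delta n w)) u * inner (past delta n w 0%N : H) v)%:E
   = 0)%E.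
Proof.
have [q hq] := filter_moment n; have [q' hq'] := delta_moment2 (n%:Z - 0%:Z).
refine (coordinate_orthogonal (p := fun s => inner (f s) u) (q := `|u| ^+ 2 * (1 + q))
  iid_delta _ _ _ hq' _).
- exact: mf.
- move=> s s' ss'; rewrite /f (@linear_filter_ext _ _ _ s s')// => j.
  exact: ss'.
- have dom := mean_leZ (sqr_ge0 `|u|) (mean_leD (mean_le_cst P ler01) hq).
  apply: (mean_le_mono dom).
    apply: measurable_funX; apply: (weakly_measurable_comp mf).
    exact: (past_measurable iid_delta).
  move=> w; rewrite sqr_ge0/=; apply: le_trans (inner_sqr_le _ _) _.
  rewrite mulrC ler_wpM2l ?sqr_ge0//.
  by have := sqr_ge0 (`|f (past delta n w)| ^+ 2 - 1); nra.
- exact: delta_mean.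
Qed.

Let noise_orthogonal i j u v : i != j ->
  (\int[P]_w (inner (e i w) u * inner (e j w) v)%:E = 0)%E.
Proof.
(* Both noises are read as distinct coordinates of the past of the later time, so that
   [coordinate_orthogonal] applies. *)
move=> ij; pose n := maxn i j.
have [q hq] := delta_moment2 (n%:Z - (n - i)%N%:Z).
have [q' hq'] := delta_moment2 (n%:Z - (n - j)%N%:Z).
under eq_integral do rewrite -(pastE _ (leq_maxl i j)) -(pastE _ (leq_maxr i j)).
apply: (coordinate_orthogonal (p := fun s => inner (s (n - i)%N : H) u)
  (q := `|u| ^+ 2 * q) iid_delta _ _ _ hq').
- exact: (weakly_measurable_comp m_id (measurable_coord _)).
- move=> s s' ss'; rewrite ss'//; apply: contraNneq ij.
  by have := leq_maxl i j; have := leq_maxr i j; rewrite -/n; lia.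
- apply: (mean_le_mono (mean_leZ (sqr_ge0 `|u|) hq)).
    by apply: measurable_funX; exact: weps.
  by move=> w; rewrite sqr_ge0/=; apply: le_trans (inner_sqr_le _ _) _; rewrite mulrC.
- exact: delta_mean.
Qed.

(** For fixed [u] the integral is a bounded linear form in [v], represented by a vector [Q u];
    identical distribution makes [Q] common to all indices. *)
Let covariance : exists Q : H -> H, forall i u v,
  (\int[P]_w (inner (eps i w) u * inner (eps i w) v)%:E = (inner (Q u) v)%:E)%E.
Proof.
have [q hq] := delta_moment2 0.
pose g u v w := inner (delta 0 w : H) u * inner (delta 0 w : H) v.
have mg u v : measurable_fun setT (g u v) by apply: measurable_funM; exact: weps.
have g_le u v : mean_le P (fun w => `|g u v w|) (`|u| * `|v| * q).
  have dom := mean_leZ (mulr_ge0 (normr_ge0 u) (normr_ge0 v)) hq.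
  apply: (mean_le_mono dom) => [|w]; first exact: measurableT_comp.
  rewrite normr_ge0/= /g normrM expr2.
  apply: le_trans (ler_pM _ _ (inner_le _ u) (inner_le _ v)) _ => //.
  by rewrite mulrACA mulrC.
have ig u v : P.-integrable setT (EFin \o g u v).
  by apply: (mean_le_integrable (g_le u v)).
have phi u : exists z, forall v, (\int[P]_w g u v w)%R = inner z v.
  apply: (@riesz _ _ _ (`|u| * q)) => [a x y|v].
    have -> : g u (a *: x + y) = fun w => a * g u x w + g u y w.
      by apply/funext => w; rewrite /g innerDr innerZr mulrDr mulrCA.
    have igZ : P.-integrable setT (EFin \o (fun w => a * g u x w)).
      exact: (integrableZl measurableT a (ig u x)).
    by rewrite RintegralD// RintegralZl.
  apply: le_trans (le_normr_Rintegral measurableT (ig u v)) _.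
  have [_ _ h] := g_le u v; rewrite mulrAC -lee_fin.
  apply: le_trans h; rewrite fineK//.
  by apply: integrable_fin_num => //; exact: integrable_abse (ig u v).
have [Q hQ] := choice phi; exists Q => i u v.
have mF : measurable_fun setT
    (fun x : borel H => (inner (x : H) u * inner (x : H) v)%:E : \bar R).
  by apply/measurable_EFinP; apply: measurable_funM; exact: m_id.
rewrite (iid_marginal_integral i (0 + 1) iid_eps mF) -hQ fineK//.
exact: (integrable_fin_num measurableT (ig u v)).
Qed.

Lemma iid_white_noise : white_noise P [set k | (1 <= k)%N] e.
Proof.
split.
- move=> i _; split; first by case: (eps4 i.+1%:Z).
  have [q hq] := delta_moment2 i.
  apply: (moment_nu (p := 2) (q := q)) => //.
  by congr (mean_le _ _ _): hq; apply/funext => w; rewrite /e /delta intS addrC.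
- move=> i j _ _ /eqP ij u v; rewrite unlock inner0l.
  under eq_integral do rewrite /tensor innerZl.
  exact: noise_orthogonal.
have [Q hQ] := covariance; exists 0, Q => i _; split; first exact: eps_mean.
move=> u v; rewrite unlock; under eq_integral do rewrite /tensor subr0 innerZl.
exact: hQ.
Qed.

Lemma iid_assumptionA : assumptionA P Psi X (fun k => X k.+1) e.
Proof.
split => //; last split; last 1 first.
- move=> k k1 u v; rewrite unlock inner0l.
  under eq_integral do rewrite /tensor innerZl.
  apply: etrans (filter_noise_orthogonal k u v).
  have mXe : measurable_fun setT (fun w => (inner (X k w) u * inner (e k w) v)%:E).
    by apply/measurable_EFinP; apply: measurable_funM; [exact: mX|exact: weps].
  apply: ae_eq_integral => //.
    apply/measurable_EFinP; apply: measurable_funM.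
      by apply: (weakly_measurable_comp mf); exact: (past_measurable iid_delta).
    exact: weps.
  by apply: filterS (X_filter k1) => w -> _; rewrite past0E.
- by case: arhX.
- move=> k k1; split; last exact: eps_mean.
  move=> u; rewrite unlock inner0l; apply: etrans (filter_mean k u).
  apply: ae_eq_integral => //.
  + by apply/measurable_EFinP; exact: mX.
  + apply/measurable_EFinP.
    by apply: (weakly_measurable_comp mf); exact: (past_measurable iid_delta).
  + by apply: filterS (X_filter k1) => w -> _.
- exists _, (borel H), delta, f, (fun s => s 0%N).
  by split; [exact: X_approximable|exact: noise_approximable].
- exact: iid_white_noise.
Qed.

End iid_innovations.

Theorem corollary1 (R : realType) (H : hilbertType R) (d : measure_display)
  (Omega : measurableType d) (P : probability Omega R)
  (Psi : {linear H -> H}) (eps : int -> Omega -> H) (X : nat -> Omega -> H)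
  (C : H -> H)
  (sepH : separable H) (infH : infinite_dimensional H)
  (Psi_bounded : bounded_operator Psi) (Psi_lt1 : opnorm Psi < 1)
  (arhX : ARH1 P Psi eps X)
  (CE : is_mean_tensor P (X 1%N) (X 1%N) C)
  (imC : closure (range C) = setT) :
  let Y := fun k => X k.+1 in
  let e := fun k : nat => eps k.+1%:Z in
  (white_noise P setT eps -> assumptionA P Psi X Y e ->
   forall m : nat -> R, m @ \oo --> +oo ->
     m n / Num.sqrt n%:R @[n --> \oo] --> 0 ->
   forall (lam : nat -> Omega -> nat -> R) (v : nat -> Omega -> nat -> H),
     (forall n w, (1 <= n)%N -> eigen_system (C_hat X n w) (lam n w) (v n w)) ->
   cvg0_in_probability P (fun n w =>
     `|Psi (X n w) - Psi_hat X Y n w (lam n w) (v n w)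
                       (K_trunc (lam n w) (m n)) (X n w)|))
  /\
  (iid P (eps : int -> Omega -> borel H) ->
   (forall i, LpH P 4 (eps i)) -> (forall i, is_mean P (eps i) 0) ->
   assumptionA P Psi X Y e).
Proof.
move=> Y e; split=> [_ assA m m_infty m_small lam v es|iid_eps eps4 eps_mean].
  case: (arhX) => _ mX statX _ _.
  apply: (prediction_consistency sepH infH Psi_bounded (ltW Psi_lt1) mX _ statX
    CE imC assA m_infty m_small es) => n _.
  exact: mX.
exact: iid_assumptionA.
Qed.
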